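(* Let $(M,g)$ be a compact hyperbolic surface. Then the multiplicity function $m_x$ and the set of looping times $\mathcal{L}_x$ are audible, i.e. determined by the pointwise Weyl counting function $N_x$: if $x,y\in M$ satisfy $N_x(\lambda)=N_y(\lambda)$ for all $\lambda$, then $m_x(r)=m_y(r)$ for all $r\in(0,\infty)$ and $\mathcal{L}_x=\mathcal{L}_y$.
   Context: A compact hyperbolic surface is a compact Riemannian surface without boundary of constant curvature $-1$, i.e. a compact quotient of the hyperbolic plane $\mathbb{H}$ by its group $\Gamma$ of deck transformations. Let $d_{\tilde g}$ denote the hyperbolic distance on $\mathbb{H}$ and $I$ the identity element of $\Gamma$. For $x\in M$ with a lift $\tilde x\in\mathbb{H}$, the set of looping times at $x$ (the set of lengths of geodesic segments in $M$ with both endpoints at $x$, not necessarily closing smoothly) is \[ \mathcal{L}_x=\{d_{\tilde g}(\tilde x,\gamma(\tilde x)):\gamma\in\Gamma\setminus\{I\}\}, \] and for $r\in(0,\infty)$ the multiplicity is \[ m_x(r)=\#\{\gamma\in\Gamma\setminus\{I\}: d_{\tilde g}(\tilde x,\gamma(\tilde x))=r\}. \] These do not depend on the choice of lift $\tilde x$. Let $\Delta_g$ denote the Laplace-Beltrami operator of $(M,g)$, and let $e_1,e_2,\ldots$ be an orthonormal basis of $L^2(M)$ consisting of eigenfunctions, $\Delta_g e_j=-\lambda_j^2e_j$ with $\lambda_j\ge 0$. The pointwise Weyl counting function is $N_x(\lambda)=\sum_{\lambda_j\le\lambda}|e_j(x)|^2$; it does not depend on the choice of orthonormal eigenbasis.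 *)

(* Defs.v *)
From HB Require Import structures.
From mathcomp Require Import all_boot all_order all_algebra.
From mathcomp Require Import complex finmap.
From mathcomp Require Import all_classical all_reals all_analysis.

Set Implicit Arguments.
Unset Strict Implicit.
Unset Printing Implicit Defensive.

Import Order.TTheory GRing.Theory Num.Theory.
Import numFieldNormedType.Exports.

Local Open Scope classical_set_scope.
Local Open Scope complex_scope.
Local Open Scope quotient_scope.
Local Open Scope ring_scope.

(* The hyperbolic plane is the upper half-plane {(a, b) | 0 < b} with the
   metric (da^2 + db^2) / b^2.  Points of [hyp R] carry the subspace topology
   of the Euclidean plane. *)
Definition halfplane (R : realType) : set (R * R) := [set z | 0 < z.2].
Definition hyp (R : realType) : Type := set_type (@halfplane R).

HB.instance Definition _ (R : realType) := Choice.on (hyp R).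
HB.instance Definition _ (R : realType) := Topological.on (hyp R).
HB.instance Definition _ (R : realType) := SubType.on (hyp R).

Definition arcosh (R : realType) (u : R) : R := ln (u + Num.sqrt (u ^+ 2 - 1)).

Definition hdist (R : realType) (z w : hyp R) : R :=
  arcosh (1 + (((val z).1 - (val w).1) ^+ 2 + ((val z).2 - (val w).2) ^+ 2)
              / (2 * (val z).2 * (val w).2)).

(* A group of isometries of the hyperbolic plane (orientation-reversing ones
   included) acting freely and properly discontinuously; these are exactly the
   groups of deck transformations of the coverings of complete hyperbolic
   surfaces by the hyperbolic plane. *)
Record deck_group (R : realType) := DeckGroup {
  deck : set (hyp R -> hyp R);
  deck_isometry : forall g, deck g -> forall z w, hdist (g z) (g w) = hdist z w;
  deck_id : deck id;
  deck_comp : forall g h, deck g -> deck h -> deck (g \o h);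
  deck_inv : forall g, deck g -> exists2 h, deck h & cancel g h /\ cancel h g;
  deck_free : forall g, deck g -> forall z, g z = z -> g = id;
  deck_properly_discontinuous : forall K : set (hyp R), compact K ->
    finite_set [set g | deck g /\ (g @` K) `&` K !=set0] }.

Section Surface.
Variables (R : realType) (G : deck_group R).

Definition orbit_rel : rel (hyp R) :=
  fun z w => `[< exists2 g, deck G g & g z = w >].

Lemma orbit_rel_refl : reflexive orbit_rel.
Proof. by move=> z; apply/asboolP; exists id => //; exact: deck_id. Qed.

Lemma orbit_rel_sym : symmetric orbit_rel.
Proof.
have sub z w : orbit_rel z w -> orbit_rel w z.
  move=> /asboolP[g Gg <-]; apply/asboolP.
  by have [h Gh [gK _]] := deck_inv Gg; exists h.
by move=> z w; apply/idP/idP; exact: sub.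
Qed.

Lemma orbit_rel_trans : transitive orbit_rel.
Proof.
move=> w z t /asboolP[g Gg <-] /asboolP[h Gh <-]; apply/asboolP.
by exists (h \o g) => //; exact: deck_comp.
Qed.

Definition orbit_equiv :=
  EquivRel orbit_rel orbit_rel_refl orbit_rel_sym orbit_rel_trans.

Definition surface : Type := quotient_topology {eq_quot orbit_equiv}.
HB.instance Definition _ := Quotient.on surface.
HB.instance Definition _ := Topological.on surface.

Definition to_surface (z : hyp R) : surface := \pi_surface z.

(* [repr x] is a lift of [x]; [looping_times] and [multiplicity] do not depend
   on the choice of the lift. *)
Definition looping_times (x : surface) : set R :=
  [set hdist (repr x) (g (repr x)) | g in deck G `\ id].

Definition loops (x : surface) (r : R) : set (hyp R -> hyp R) :=
  [set g | (deck G `\ id) g /\ hdist (repr x) (g (repr x)) = r].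

(* [loops x r] is finite by proper discontinuity ([fset_set] of an infinite set
   would be empty). *)
Definition multiplicity (x : surface) (r : R) : nat :=
  #|` fset_set (loops x r)|%fset.

(* The lift of a function on the surface, extended by 0 to the plane. *)
Definition pullback (f : surface -> R[i]) (z : R * R) : R[i] :=
  if insub z is Some w then f (to_surface w) else 0.

Lemma halfplane_i : (0, 1) \in @halfplane R.
Proof. by rewrite inE /halfplane /=. Qed.

Definition hyp_i : hyp R := Sub (0, 1) halfplane_i.

(* The Dirichlet domain of [G] centred at the point (0, 1): its translates
   cover the hyperbolic plane and overlap in null sets only. *)
Definition dirichlet : set (R * R) :=
  [set val z | z in
    [set z | forall g, deck G g -> hdist z hyp_i <= hdist (g z) hyp_i]].

Definition leb2 :
    {measure set (measurableTypeR R * measurableTypeR R) -> \bar R} :=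
  (@lebesgue_measure R \x @lebesgue_measure R)%E.

(* The area element of the hyperbolic plane is da db / b^2, and integrals over
   the surface are integrals over the Dirichlet domain. *)
Definition sqnormL2 (f : surface -> R[i]) : \bar R :=
  (\int[leb2]_(z in dirichlet) (Normc.normc (pullback f z) ^+ 2 / z.2 ^+ 2)%:E)%E.

Definition L2 (f : surface -> R[i]) : Prop :=
  let H : set (measurableTypeR R * measurableTypeR R) := @halfplane R in
  [/\ measurable_fun H (fun z => complex.Re (pullback f z) : measurableTypeR R),
      measurable_fun H (fun z => complex.Im (pullback f z) : measurableTypeR R)
    & (sqnormL2 f < +oo)%E].

Definition innerL2 (f h : surface -> R[i]) : R[i] :=
  let p z := (pullback f z * (pullback h z)^*)%C in
  (\int[leb2]_(z in dirichlet) (complex.Re (p z) / z.2 ^+ 2))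
  +i* (\int[leb2]_(z in dirichlet) (complex.Im (p z) / z.2 ^+ 2)).

Definition orthonormal_basis (e : nat -> surface -> R[i]) : Prop :=
  [/\ forall j, L2 (e j),
      forall j k, innerL2 (e j) (e k) = (j == k)%:R
    & forall f, L2 f ->
        (fun n => sqnormL2 (fun x => f x - \sum_(j < n) innerL2 f (e j) * e j x))
          @ \oo --> 0%E].

Definition C1 (u : R * R -> R) : Prop := forall z, halfplane z ->
  [/\ derivable u z (1, 0), derivable u z (0, 1),
      {for z, continuous ('D_(1, 0) u)} & {for z, continuous ('D_(0, 1) u)}].

Definition C2 (u : R * R -> R) : Prop :=
  [/\ C1 u, C1 ('D_(1, 0) u) & C1 ('D_(0, 1) u)].

Definition hlaplacian (u : R * R -> R) (z : R * R) : R :=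
  z.2 ^+ 2 * ('D_(1, 0) ('D_(1, 0) u) z + 'D_(0, 1) ('D_(0, 1) u) z).

(* Since the projection is a local isometry, the Laplace-Beltrami operator of
   the surface acts on lifts as that of the hyperbolic plane.  Asking only for
   C^2 is no restriction: such eigenfunctions are smooth. *)
Definition laplace_eigenfunction (f : surface -> R[i]) (lambda : R) : Prop :=
  let u z := complex.Re (pullback f z) in
  let v z := complex.Im (pullback f z) in
  [/\ C2 u, C2 v & forall z, halfplane z ->
    hlaplacian u z +i* hlaplacian v z = - (lambda ^+ 2)%:C * pullback f z].

(* The sum is finite; taking it in the extended reals avoids building this
   into the definition. *)
Definition weyl_counting (e : nat -> surface -> R[i]) (lambda : nat -> R)
    (x : surface) (l : R) : \bar R :=
  (\esum_(j in [set j | (lambda j <= l)%R]) (Normc.normc (e j x) ^+ 2)%:E)%E.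

End Surface.

(* Main.v *)
Require Import Defs.
From HB Require Import structures.
From mathcomp Require Import all_boot all_order all_algebra.
From mathcomp Require Import complex finmap.
From mathcomp Require Import all_classical all_reals all_analysis.
From mathcomp Require Import measurable_realfun ring lra.

Set Implicit Arguments.
Unset Strict Implicit.
Unset Printing Implicit Defensive.

Import Order.TTheory GRing.Theory Num.Theory.
Import numFieldNormedType.Exports.

Local Open Scope classical_set_scope.
Local Open Scope ring_scope.

(** Write [t(z, w)] for the hyperbolic cosine of the distance, [X] for a lift of
    [x], and [K_c(z, w) = max(c - t(z, w), 0)^2]. Summing over the deck group
    gives a function [w |-> sum_g K_c(X, g w)] on the surface. Its norm in L^2,
    and more generally its inner product with the function obtained from another
    radius [c'], is computed in two ways.

    On the spectral side, [K_c] acts on the eigenfunctions of frequency [la] by a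
    scalar [h_c(la)]. By unfolding, the coefficient of the function on [e_j] is
    [h_c(lambda_j)] times the conjugate of [e_j x], and Parseval's identity gives
    [sum_j h_c(lambda_j)^2 |e_j x|^2] for the square of its norm. Grouped by
    frequencies, this sum depends on the counting function at [x] only
    ([esum_weighted]), provided that this function is finite, which Bessel's
    inequality shows for a kernel with [h_c] bounded away from 0 on the
    frequencies up to [l] ([weyl_counting_lty]). Polarisation gives the inner
    products ([overlap_eq]).

    On the geometric side, unfolding over the fundamental domain turns the inner
    product into the sum over [g] of the integrals over the plane of
    [K_c(X, w) K_c'(g X, w)]. The second difference of [K_c] in [c], with step
    [h], is the constant [2 h^2] where [t(X, w) <= c - 2 h] and vanishes where
    [c <= t(X, w)]. For [c'] close to 1 the second factor concentrates at [g X],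
    so that, when no value [t(X, g X)] is close to [c], the second difference of
    the sum is a positive constant times the number of [g] with
    [t(X, g X) <= c] ([overlap_diff2]). These counts are therefore the same at
    [x] and at [y]; their jumps are the multiplicities, and the looping times
    are the radii of nonzero multiplicity.

    That radial kernels act by scalars is shown without geodesic coordinates or
    special functions. The integrals of an eigenfunction against the powers 1, 2
    and 3 of [max(c - t, 0)] are, up to constants, successive derivatives in [c],
    and Green's identity on a box relates them by a linear differential equation
    ([moment_relation]). It is singular at [c = 1], where only the value of the
    eigenfunction at the centre matters ([moment_near]); a Gronwall argument from
    this point ([radial_quot_bound], [radial_quot_variation]) gives both the
    uniqueness behind [h_c] ([moment_unique]) and a lower bound that is uniform
    in the frequency ([moment_lower_bound]).

    The area is the measure of density [1 / b^2]. Deck transformations are known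
    to preserve distances only; that they preserve the area follows from the
    fact that all balls of a given radius have the same area
    ([hmeas_isometry_le]). The translates of the Dirichlet domain overlap in
    bisectors, which are null ([hmeas_bisector], [integral_unfold]). *)

(** * The hyperbolic cosine of the distance *)

Section CoshDistance.
Variable R : realType.
Implicit Types z w x q : R * R.

(** The hyperbolic cosine of the distance. It is a rational function of the
    coordinates, and it carries the same information as the distance because
    [arcosh] is increasing on [1, +oo[. *)
Definition cdist z w : R :=
  1 + ((z.1 - w.1) ^+ 2 + (z.2 - w.2) ^+ 2) / (2 * z.2 * w.2).

Lemma cdistC z w : cdist z w = cdist w z.
Proof. by rewrite /cdist [2 * w.2 * _]mulrAC; congr (1 + _ / _); ring. Qed.

Lemma cdistE z w : 0 < z.2 -> 0 < w.2 ->
  cdist z w = ((z.1 - w.1) ^+ 2 + z.2 ^+ 2 + w.2 ^+ 2) / (2 * z.2 * w.2).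
Proof.
by move=> z0 w0; rewrite /cdist; field; rewrite !gt_eqF.
Qed.

Lemma cdist_ge1 z w : 0 < z.2 -> 0 < w.2 -> 1 <= cdist z w.
Proof.
move=> z0 w0; rewrite lerDl divr_ge0 ?addr_ge0 ?sqr_ge0//.
by rewrite !mulr_ge0 ?ltW.
Qed.

Lemma cdistzz z : cdist z z = 1.
Proof. by rewrite /cdist !subrr expr0n/= addr0 mul0r addr0. Qed.

Lemma cdist_eq1 z w : 0 < z.2 -> 0 < w.2 -> cdist z w = 1 -> z = w.
Proof.
move=> z0 w0 /eqP; rewrite /cdist -subr_eq0 addrAC subrr add0r mulf_eq0 invr_eq0.
rewrite [X in _ || X]gt_eqF ?orbF ?mulr_gt0//.
rewrite paddr_eq0 ?sqr_ge0// !sqrf_eq0 !subr_eq0 => /andP[/eqP e1 /eqP e2].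
by rewrite (surjective_pairing z) e1 e2 -surjective_pairing.
Qed.

Lemma ler_arcosh (s t : R) : 1 <= s -> 1 <= t -> (arcosh s <= arcosh t) = (s <= t).
Proof.
move=> s1 t1; rewrite /arcosh.
have pos (r : R) : 1 <= r -> 0 < r + Num.sqrt (r ^+ 2 - 1).
  by move=> r1; rewrite ltr_pwDl ?sqrtr_ge0// (lt_le_trans _ r1).
have mono (r r' : R) : 1 <= r -> r < r' ->
    r + Num.sqrt (r ^+ 2 - 1) < r' + Num.sqrt (r' ^+ 2 - 1).
  move=> r1 rr'; rewrite ltr_leD// ler_wsqrtr// lerB// ler_sqr ?nnegrE; lra.
rewrite ler_ln ?posrE ?pos//; case: (leP s t) => [|ts].
  by rewrite le_eqVlt => /predU1P[->|st]; [rewrite lexx|rewrite ltW ?mono].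
by apply/negbTE; rewrite -ltNge mono.
Qed.

Lemma hyp_gt0 (z : hyp R) : 0 < (val z).2.
Proof. by case: z => z /= /[!inE]. Qed.

Lemma hdist_cdist (z w : hyp R) : hdist z w = arcosh (cdist (val z) (val w)).
Proof. by []. Qed.

Lemma le_hdist (z w z' w' : hyp R) :
  (hdist z w <= hdist z' w') = (cdist (val z) (val w) <= cdist (val z') (val w')).
Proof. by rewrite !hdist_cdist ler_arcosh ?cdist_ge1 ?hyp_gt0. Qed.

Lemma eq_hdist (z w z' w' : hyp R) :
  (hdist z w == hdist z' w') = (cdist (val z) (val w) == cdist (val z') (val w')).
Proof. by rewrite !eq_le !le_hdist. Qed.

(** A ball lies in a Euclidean box that stays away from the boundary of the
    half-plane: all the compactness and finiteness used below comes from here. *)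
Lemma cdist_box (c : R) z w : 0 < z.2 -> 0 < w.2 -> cdist z w <= c ->
  [/\ w.2 <= 2 * c * z.2, z.2 <= 2 * c * w.2 & (z.1 - w.1) ^+ 2 <= (2 * c * z.2) ^+ 2].
Proof.
move=> z0 w0; rewrite cdistE// ler_pdivrMr ?mulr_gt0// => h.
have s1 := sqr_ge0 (z.1 - w.1); have s2 := sqr_ge0 z.2; have s3 := sqr_ge0 w.2.
have c0 : 0 <= c.
  have : 0 <= c * (2 * z.2 * w.2) by lra.
  by rewrite pmulr_lge0// !mulr_gt0.
have h1 : w.2 <= 2 * c * z.2.
  rewrite -(ler_pM2r w0) -expr2; apply: (@le_trans _ _ (c * (2 * z.2 * w.2))); lra.
have h2 : z.2 <= 2 * c * w.2.
  rewrite -(ler_pM2r z0) -expr2; apply: (@le_trans _ _ (c * (2 * z.2 * w.2))); lra.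
split => //; apply: (@le_trans _ _ (2 * c * z.2 * w.2)); first lra.
by rewrite expr2 ler_wpM2l ?mulr_ge0 // ltW.
Qed.

(** The hyperbolic and the Euclidean metric are comparable at the scale given
    by the height of [z]: for [e <= 1] the height of [w] is at most four times
    that of [z]. *)
Lemma cdist_near (e : R) z w : 0 < z.2 -> 0 < w.2 -> e <= 1 -> cdist z w <= 1 + e ->
  (z.1 - w.1) ^+ 2 + (z.2 - w.2) ^+ 2 <= 8 * e * z.2 ^+ 2.
Proof.
move=> z0 w0 e1 h.
have [//|w4 _ _] := @cdist_box 2 z w z0 w0 _; first lra.
have e0 : 0 <= e by have := cdist_ge1 z0 w0; lra.
move: h; rewrite /cdist lerD2l ler_pdivrMr ?mulr_gt0// => /le_trans; apply.
have h : z.2 * w.2 <= z.2 * (2 * 2 * z.2) by rewrite ler_pM2l.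
have := ler_wpM2l e0 h; lra.
Qed.

(** A triangle inequality in multiplicative form. It is uniform in [x] because a
    small displacement of [q] changes its coordinates by a small proportion of
    its height. *)
Lemma cdist_near_mul (M : R) : 1 < M -> exists2 e, 0 < e &
  forall x q w, 0 < x.2 -> 0 < q.2 -> 0 < w.2 ->
    cdist q w <= 1 + e -> cdist x w <= M * cdist x q.
Proof.
move=> M1.
(* d is the relative Euclidean displacement of w; it has to satisfy
   1 + 5 d <= M (1 - d) and to leave w.2 comparable with q.2. *)
pose d := Num.min (1 / 2) ((M - 1) / (M + 5)).
have M5 : 0 < M + 5 by lra.
have d0 : 0 < d by rewrite lt_min divr_gt0//= divr_gt0//; lra.
have d1 : d <= 1 / 2 by rewrite ge_min lexx.
have dM : d * (M + 5) <= M - 1 by rewrite -ler_pdivlMr// ge_min lexx orbT.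
exists (d ^+ 4 / 8) => [|x q w x0 q0 w0 qw]; first by rewrite divr_gt0 ?exprn_gt0.
have d4 : d ^+ 4 <= 1 by rewrite exprn_ile1//; lra.
have {}qw := cdist_near q0 w0 _ qw.
have {qw} : (q.1 - w.1) ^+ 2 + (q.2 - w.2) ^+ 2 <= (d ^+ 2 * q.2) ^+ 2.
  by apply: le_trans (qw _) _; [lra|rewrite exprMn -exprM; lra].
have := sqr_ge0 (q.1 - w.1); have := sqr_ge0 (q.2 - w.2) => s2 s1 s12.
have d2d : d ^+ 2 <= d by rewrite expr2 ler_piMl//; lra.
have dq0 : 0 <= d ^+ 2 * q.2 by rewrite mulr_ge0 ?ltW ?exprn_gt0.
have dq : d ^+ 2 * q.2 <= d * q.2 by rewrite ler_pM2r.
have h2 : `|q.2 - w.2| <= d ^+ 2 * q.2.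
  by rewrite -ler_sqr ?nnegrE// real_normK ?num_real//; lra.
have {h2} [h2 h2'] : q.2 * (1 - d) <= w.2 /\ w.2 <= q.2 * (1 + d).
  by move: h2; rewrite ler_norml => /andP[]; lra.
have h1 : (q.1 - w.1) ^+ 2 <= d ^+ 4 * q.2 ^+ 2 by move: s12; rewrite exprMn -exprM; lra.
have d3 : d ^+ 3 <= d / 4.
  rewrite exprS (_ : d / 4 = d * (1 / 2) ^+ 2); last by field.
  by rewrite ler_pM2l// ler_sqr ?nnegrE; lra.
have d4' : d ^+ 4 <= d / 4.
  by apply: le_trans d3; rewrite exprS ler_piMl ?exprn_ge0 ?(ltW d0)//; lra.
have q2 : 0 < q.2 ^+ 2 by rewrite exprn_gt0.
have h3 : 2 * (x.1 - q.1) * (q.1 - w.1) <= d * (x.1 - q.1) ^+ 2 + d ^+ 3 * q.2 ^+ 2.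
  rewrite -(ler_pM2l d0).
  have := sqr_ge0 (d * (x.1 - q.1) - (q.1 - w.1)); rewrite sqrrB exprMn; lra.
have h4 : (x.1 - w.1) ^+ 2 <= (1 + d) * (x.1 - q.1) ^+ 2 + d * q.2 ^+ 2.
  rewrite (_ : x.1 - w.1 = (x.1 - q.1) + (q.1 - w.1)); last by ring.
  rewrite sqrrD; have := ler_wpM2r (ltW q2) d3; have := ler_wpM2r (ltW q2) d4'; lra.
have h5 : w.2 ^+ 2 <= (1 + 3 * d) * q.2 ^+ 2.
  have -> : (1 + 3 * d) * q.2 ^+ 2 = (q.2 * (1 + d)) ^+ 2 + (d - d ^+ 2) * q.2 ^+ 2 by ring.
  rewrite ler_wpDr ?mulr_ge0 ?(ltW q2) ?(ltW q0) ?subr_ge0//.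
  by rewrite ler_sqr ?nnegrE ?(ltW w0) ?mulr_ge0 ?addr_ge0 ?(ltW q0) ?(ltW d0).
rewrite !cdistE// mulrA ler_pdivrMr ?mulr_gt0// mulrAC ler_pdivlMr ?mulr_gt0//.
set X := (x.1 - q.1) ^+ 2 in h3 h4 *; have X0 : 0 <= X := sqr_ge0 _.
have x2 := sqr_ge0 x.2.
have h6 : (x.1 - w.1) ^+ 2 + x.2 ^+ 2 + w.2 ^+ 2 <= (1 + 4 * d) * (X + x.2 ^+ 2 + q.2 ^+ 2).
  have := mulr_ge0 (ltW d0) X0; have := mulr_ge0 (ltW d0) x2; lra.
have h7 : (1 + 4 * d) * q.2 <= M * w.2.
  apply: le_trans (_ : M * (q.2 * (1 - d)) <= _); last by rewrite ler_pM2l//; lra.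
  by rewrite mulrCA mulrC ler_pM2l//; lra.
have S0 : 0 <= X + x.2 ^+ 2 + q.2 ^+ 2 by lra.
rewrite [leRHS](_ : _ = (2 * x.2) * ((M * w.2) * (X + x.2 ^+ 2 + q.2 ^+ 2))); last by ring.
rewrite mulrC -!mulrA ler_pM2l// ler_pM2l//.
rewrite [leRHS]mulrA; apply: le_trans (ler_wpM2r S0 h7).
by rewrite [_ * q.2]mulrC -mulrA ler_pM2l.
Qed.

End CoshDistance.

(** * Local finiteness of the deck group *)

Section Deck.
Variable R : realType.

(** The topology of [hyp R] is that of the Euclidean plane, so a cluster point
    is found in the plane; [0 < b0] keeps it inside the half-plane. *)
Lemma compact_hyp_box (a0 a1 b0 b1 : R) : 0 < b0 ->
  compact [set z : hyp R | a0 <= (val z).1 <= a1 /\ b0 <= (val z).2 <= b1].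
Proof.
move=> b00 F FF FA.
pose B : set (R * R) := `[a0, a1]%classic `*` `[b0, b1]%classic.
have cB : compact B by apply: compact_setX; exact: segment_compact.
have GB : (val @ F) B.
  by rewrite /fmap/=; apply: (filterS _ FA) => z [h1 h2]; split; rewrite /= in_itv.
have [p [Bp cp]] := cB (val @ F) _ GB.
have p0 : p \in @halfplane R.
  by case: Bp => _; rewrite inE /= in_itv /= => /andP[+ _]; exact: lt_le_trans.
pose q : hyp R := Sub p p0.
exists q; split; first by case: Bp; rewrite /= !in_itv.
move=> A U FA' /=; rewrite nbhsE => -[V [[W oW WV] Vq] VU].
have FAi : (val @ F) (val @` A).
  by rewrite /fmap/=; apply: (filterS _ FA') => a Aa; exists a.
have Wp : nbhs p W.
  by apply: open_nbhs_nbhs; split => //; move: Vq; rewrite -WV.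
have [_ [[a Aa <-] Wa]] := cp _ _ FAi Wp.
by exists a; split => //; apply: VU; rewrite -WV.
Qed.

Variable G : deck_group R.
Implicit Types (x w : hyp R).

(** Proper discontinuity, for a compact box containing [w] and the ball of
    radius [C] around [x]. *)
Lemma deck_locally_finite x w (C : R) :
  finite_set [set g | deck G g /\ cdist (val x) (val (g w)) <= C].
Proof.
pose C' := Num.max C (cdist (val x) (val w)).
have x0 := hyp_gt0 x.
have C'1 : 1 <= C' by rewrite le_max cdist_ge1 ?hyp_gt0 ?orbT.
pose r : R := 2 * C' * (val x).2.
have r0 : 0 < r by rewrite !mulr_gt0//; lra.
have b0 : 0 < (val x).2 / (2 * C') by rewrite divr_gt0//; lra.
have := deck_properly_discontinuous G
  (@compact_hyp_box ((val x).1 - r) ((val x).1 + r) ((val x).2 / (2 * C')) r b0).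
apply: sub_finite_set => g [Gg gC]; split => //.
have inK (z : hyp R) : cdist (val x) (val z) <= C' ->
    (val x).1 - r <= (val z).1 <= (val x).1 + r /\
    (val x).2 / (2 * C') <= (val z).2 <= r.
  move=> h; have [h1 h2 h3] := cdist_box x0 (hyp_gt0 z) h.
  rewrite h1 ler_pdivrMr ?andbT; last by lra.
  rewrite mulrC h2; split=> //.
  move: h3; rewrite -/r -real_normK ?num_real// ler_sqr ?nnegrE ?(ltW r0)//.
  by rewrite ler_distlC.
exists (g w); split; first by exists w => //; apply: inK; rewrite /C' le_max lexx orbT.
by apply: inK; rewrite /C' le_max gC.
Qed.

Lemma deck_countable : countable (deck G).
Proof.
have -> : deck G = \bigcup_n
    [set g | deck G g /\ cdist (val (hyp_i R)) (val (g (hyp_i R))) <= n%:R].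
  apply/seteqP; split=> [g Gg|g [n _ []//]].
  exists (Num.truncn (cdist (val (hyp_i R)) (val (g (hyp_i R))))).+1 => //; split => //.
  exact/ltW/truncnS_gt.
apply: bigcup_countable => // n _; exact/finite_set_countable/deck_locally_finite.
Qed.

Lemma deck_invE g : deck G g -> exists h, [/\ deck G h, cancel g h & cancel h g].
Proof. by move=> /deck_inv[h Gh [gh hg]]; exists h. Qed.

Lemma cdist_deck g z w : deck G g -> cdist (val (g z)) (val (g w)) = cdist (val z) (val w).
Proof. by move=> Gg; apply/eqP; rewrite -eq_hdist (deck_isometry Gg). Qed.

End Deck.

(** * Borel sets of the plane *)

Section Measurability.
Context d (T : measurableType d) (R : realType).
Local Notation plane := (measurableTypeR R * measurableTypeR R)%type.

(** Inversion is continuous on the complement of 0, whose singleton is measurable. *)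
Lemma measurable_invr : measurable_fun [set: measurableTypeR R] (@GRing.inv R).
Proof.
rewrite (_ : setT = [set~ 0] `|` [set 0]); last by rewrite setUC setUv.
apply/measurable_funU => //; first exact: measurableC.
split; last exact: measurable_fun_set1.
apply: open_continuous_measurable_fun => [|x].
  exact/closed_openC/accessible_closed_set1/hausdorff_accessible/Rhausdorff.
by rewrite inE /= => /eqP x0; exact: inv_continuous.
Qed.

Lemma measurable_funV D (f : T -> R) : measurable_fun D f ->
  measurable_fun D (fun x => (f x)^-1 : measurableTypeR R).
Proof. by move=> mf; apply: measurableT_comp mf; exact: measurable_invr. Qed.

(** An open set is a countable union of products of balls of rational centres,
    hence belongs to the product sigma-algebra. *)
Lemma open_measurable_plane (U : set (R * R)) : open U -> measurable (U : set plane).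
Proof.
move=> oU.
pose B (p q : rat) (n : nat) : set plane :=
  ball (ratr p : R) n.+1%:R^-1 `*` ball (ratr q : R) n.+1%:R^-1.
have mB p q n : measurable (B p q n).
  by apply: measurableX; exact: measurable_ball.
have -> : U = \bigcup_(p in setT) \bigcup_(q in setT) \bigcup_n
    (if `[< B p q n `<=` U >] then B p q n else set0).
  apply/seteqP; split=> [z Uz|z [p _ [q _ [n _]]]]; last by case: asboolP => // BU; exact: BU.
  have /nbhs_ballP[e /= e0 eU] : nbhs z U by exact: open_nbhs_nbhs.
  have [n ne] : exists n, n.+1%:R^-1 < e / 2.
    have [n _ /(_ n (leqnn _))] := near_infty_natSinv_lt (PosNum (divr_gt0 e0 (ltr0n R 2))).
    by exists n.
  have n0 : 0 < n.+1%:R^-1 :> R by rewrite invr_gt0.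
  have rd (a : R) : exists p : rat, ball a n.+1%:R^-1 (ratr p).
    have [||x [/= xa [p _ px]]] := @dense_rat R (ball a n.+1%:R^-1).
    - by exists a; exact: ballxx.
    - exact: ball_open.
    - by exists p; rewrite px.
  have [p pz] := rd z.1; have [q qz] := rd z.2.
  have nn : n.+1%:R^-1 + n.+1%:R^-1 <= e by rewrite [leRHS]splitr lerD ?ltW.
  exists p => //; exists q => //; exists n => //.
  case: asboolP => [_|]; first by split; exact: ball_sym.
  case=> w [w1 w2]; apply: eU; split.
    by apply: (le_ball nn); exact: ball_triangle pz w1.
  by apply: (le_ball nn); exact: ball_triangle qz w2.
apply: bigcupT_measurable_rat => p; apply: bigcupT_measurable_rat => q.
by apply: bigcup_measurable => n _; case: asboolP.
Qed.

Lemma continuous_measurable_plane (U : set (R * R)) (f : R * R -> R) :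
  open U -> (forall z, U z -> {for z, continuous f}) ->
  measurable_fun (U : set plane) (f : plane -> measurableTypeR R).
Proof.
move=> oU cf; apply: (measurability _ (RGenOpens.measurableE R)).
move=> _ [_ [a [b ->]] <-]; apply: open_measurable_plane.
rewrite openE => z [Uz fz]; apply: filterI; first exact: open_nbhs_nbhs.
by apply: (cf z Uz); apply: open_nbhs_nbhs; split => //; exact: interval_open.
Qed.

End Measurability.

(** * The hyperbolic area *)

Section HypMeasure.
Variable R : realType.
Local Notation plane := (measurableTypeR R * measurableTypeR R)%type.
Local Notation leb := (@lebesgue_measure R).
Local Notation leb2 := (@leb2 R).

(** The density of the area [da db / b^2], extended by 0 so that the area can be
    integrated over the whole plane, where Fubini's theorem applies. *)
Definition hden (z : R * R) : R := if 0 < z.2 then (z.2 ^+ 2)^-1 else 0.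

Lemma hden_ge0 z : 0 <= hden z.
Proof. by rewrite /hden; case: ifP => // z0; rewrite invr_ge0 exprn_ge0// ltW. Qed.

Lemma measurable_hden : measurable_fun [set: plane] (hden : plane -> measurableTypeR R).
Proof.
apply: measurable_fun_ifT.
- by apply: measurable_fun_ltr; [exact: measurable_cst|exact: measurable_snd].
- by apply: measurable_funV; apply: measurable_funX; exact: measurable_snd.
- exact: measurable_cst.
Qed.

Lemma measurable_halfplane : measurable (@halfplane R : set plane).
Proof.
have := @measurable_fun_ltr _ plane R setT (fun _ => 0) (fun z => z.2)
  (measurable_cst _) measurable_snd measurableT [set true] I.
by rewrite setTI; congr measurable; apply/seteqP; split => z.
Qed.

Definition hmeas (A : set plane) : \bar R := (\int[leb2]_(z in A) (hden z)%:E)%E.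

Let hmeas0 : hmeas set0 = 0%E. Proof. by rewrite /hmeas integral_set0. Qed.

Let hmeas_ge0 A : (0 <= hmeas A)%E.
Proof. by apply: integral_ge0 => z _; rewrite lee_fin hden_ge0. Qed.

Let hmeas_sigma_additive : semi_sigma_additive hmeas.
Proof.
move=> /= F mF tF mUF; rewrite /hmeas; apply: cvg_toP.
  apply: ereal_nondecreasing_is_cvgn => m n mn.
  apply: lee_sum_nneg_natr => // k _ _; apply: integral_ge0 => /= x Fkx.
  by rewrite lee_fin hden_ge0.
rewrite ge0_integral_bigcup//=.
- by apply/measurable_funTS/measurable_EFinP; exact: measurable_hden.
- by move=> x _; rewrite lee_fin hden_ge0.
Qed.

HB.instance Definition _ := isMeasure.Build _ plane R
  hmeas hmeas0 hmeas_ge0 hmeas_sigma_additive.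

Import HBNNSimple.

(** By monotone convergence, from the case of simple functions. *)
Lemma ge0_integral_hmeas (D : set plane) (f : plane -> \bar R) :
  measurable D -> measurable_fun D f -> (forall z, D z -> 0 <= f z)%E ->
  (\int[hmeas]_(z in D) f z = \int[leb2]_(z in D) (f z * (hden z)%:E))%E.
Proof.
move=> mD mf f0; pose h := nnsfun_approx mD mf.
have mhden : measurable_fun D (fun z => (hden z)%:E).
  by apply/measurable_funTS/measurable_EFinP; exact: measurable_hden.
transitivity (limn (fun n => \int[hmeas]_(z in D) (h n z)%:E))%E.
  rewrite -monotone_convergence//.
  - apply: eq_integral => z /[!inE] Dz; apply/esym/cvg_lim => //.
    by apply: cvg_nnsfun_approx => // *; exact: f0.
  - by move=> n; apply/measurable_EFinP/measurable_funTS.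
  - by move=> n z _; rewrite lee_fin.
  - by move=> z _ m n mn; rewrite lee_fin; exact/lefP/nd_nnsfun_approx.
transitivity (limn (fun n => \int[leb2]_(z in D) ((h n z)%:E * (hden z)%:E)))%E;
  last first.
  rewrite -monotone_convergence//.
  - apply: eq_integral => z /[!inE] Dz; apply/cvg_lim => //.
    apply: cvgeZr => //.
    by apply: cvg_nnsfun_approx => // *; exact: f0.
  - move=> n; apply: emeasurable_funM => //.
    by apply/measurable_EFinP/measurable_funTS.
  - by move=> n z _; rewrite mule_ge0// lee_fin ?hden_ge0.
  - move=> z _ m n mn; rewrite lee_wpmul2r ?lee_fin ?hden_ge0//.
    exact/lefP/nd_nnsfun_approx.
congr (limn _); apply/funext => n.
transitivity (\sum_(k \in range (h n)) \int[hmeas]_(z in D)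
    (k * \1_(h n @^-1` [set k]) z)%:E)%E.
  under eq_integral do rewrite fimfunE -fsumEFin//.
  rewrite ge0_integral_fsum//.
  - by move=> y; exact/measurable_EFinP/measurable_funM.
  - by move=> y x _; rewrite nnfun_muleindic_ge0.
transitivity (\sum_(k \in range (h n)) \int[leb2]_(z in D)
    ((k * \1_(h n @^-1` [set k]) z)%:E * (hden z)%:E))%E; last first.
  rewrite -ge0_integral_fsum//.
  - apply: eq_integral => z _; rewrite [in RHS]fimfunE -fsumEFin//.
    rewrite ge0_mule_fsuml// => r; exact: nnfun_muleindic_ge0.
  - move=> y; apply: emeasurable_funM => //.
    by apply/measurable_EFinP; exact/measurable_funM.
  - by move=> y x _; rewrite mule_ge0 ?nnfun_muleindic_ge0 ?lee_fin ?hden_ge0.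
apply: eq_fsbigr => k /[!inE] -[z _ <-].
have k0 : 0 <= h n z by [].
have mk : measurable (h n @^-1` [set h n z]) by [].
under eq_integral do rewrite EFinM.
rewrite ge0_integralZl//; last by apply/measurable_EFinP.
rewrite integral_indic//=.
under [RHS]eq_integral do rewrite EFinM -muleA.
rewrite ge0_integralZl//.
- congr (_ * _)%E; rewrite /hmeas setIC integral_mkcondr.
  apply: eq_integral => w _; rewrite patchE indicE.
  by case: ifP => _; rewrite ?mul1e ?mul0e.
- apply: emeasurable_funM => //; exact/measurable_EFinP.
- by move=> w _; rewrite mule_ge0 ?lee_fin ?hden_ge0.
Qed.

Lemma integral_hmeas (D : set plane) (f : plane -> \bar R) :
  measurable D -> measurable_fun D f ->
  (\int[hmeas]_(z in D) f z = \int[leb2]_(z in D) (f z * (hden z)%:E))%E.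
Proof.
move=> mD mf; rewrite integralE [RHS]integralE.
rewrite ge0_integral_hmeas//; last exact: measurable_funepos.
rewrite ge0_integral_hmeas//; last exact: measurable_funeneg.
congr (_ - _)%E; apply: eq_integral => z _.
  by rewrite !funeposE maxe_pMl ?mul0e ?lee_fin ?hden_ge0.
by rewrite !funenegE maxe_pMl ?mul0e ?mulNe ?lee_fin ?hden_ge0.
Qed.

Lemma hmeas_halfplaneC : hmeas (~` @halfplane R) = 0%E.
Proof.
rewrite /hmeas integral0_eq// => z /negP; rewrite /halfplane /hden /=.
by move=> /negbTE ->.
Qed.

Lemma hmeas_box (a b c e : R) : 0 < c ->
  (hmeas (`[a, b]%classic `*` `[c, e]%classic) < +oo)%E.
Proof.
move=> c0; set B := _ `*` _.
have mB : measurable (B : set plane) by apply: measurableX.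
apply: (@le_lt_trans _ _ (\int[leb2]_(z in B) ((c ^+ 2)^-1)%:E)%E).
  apply: ge0_le_integral => //.
  - by move=> z _; rewrite lee_fin hden_ge0.
  - by apply/measurable_funTS/measurable_EFinP; exact: measurable_hden.
  - move=> z [_ /=]; rewrite in_itv/= => /andP[cz _].
    rewrite lee_fin /hden (lt_le_trans c0 cz) lef_pV2 ?posrE ?exprn_gt0//.
      by rewrite ler_sqr ?nnegrE ?(ltW c0) ?(le_trans (ltW c0) cz).
    exact: lt_le_trans cz.
rewrite integral_cst//.
have -> : leb2 B = (leb `[a, b]%classic * leb `[c, e]%classic)%E.
  exact: product_measure1E.
rewrite lte_mul_pinfty ?lee_fin//.
  by rewrite invr_ge0 exprn_ge0// ltW.
have fin u v : (leb `[u, v] < +oo)%E.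
  by rewrite lebesgue_measure_itv/=; case: ifP => _; rewrite ?ltry// -EFinD ltry.
by rewrite lte_mul_pinfty ?fin// ge0_fin_numE ?fin.
Qed.

Definition hbox (n : nat) : set plane :=
  `[- n%:R, n%:R]%classic `*` `[n.+1%:R^-1, n%:R]%classic.

Lemma hbox_cover : \bigcup_n hbox n = @halfplane R.
Proof.
apply/seteqP; split=> [z [n _] [_ /=]|z z0].
  by rewrite in_itv/= => /andP[+ _]; apply: lt_le_trans; rewrite invr_gt0.
pose m := `|z.1| + z.2 + z.2^-1.
have m1 : `|z.1| <= m by rewrite /m -addrA lerDl addr_ge0 ?invr_ge0 ?ltW.
have m2 : z.2 <= m by rewrite /m addrAC lerDr addr_ge0 ?invr_ge0 ?(ltW z0).
have m3 : z.2^-1 <= m by rewrite /m lerDr addr_ge0 ?(ltW z0).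
have := archi_boundP (le_trans (normr_ge0 _) m1); set n := Num.bound m => mn.
have {mn}mn := ltW mn.
exists n => //; split; rewrite /= in_itv/=.
  by rewrite -ler_norml (le_trans m1).
rewrite (le_trans m2)// andbT invf_ple ?posrE// (le_trans m3)// (le_trans mn)//.
by rewrite ler_nat.
Qed.

Let hmeas_sigma_finite : sigma_finite setT hmeas.
Proof.
exists (fun n => (~` @halfplane R) `|` hbox n).
  rewrite bigcupUr ?hbox_cover; last by exists 0%N.
  by rewrite setUC setUv.
move=> n; have mb : measurable (hbox n) by apply: measurableX.
have mh : measurable (~` @halfplane R : set plane).
  by apply: measurableC; exact: measurable_halfplane.
split; first exact: measurableU.
apply: le_lt_trans (measureU2 _ _ _) _ => //.
by rewrite [X in (X + _)%E]hmeas_halfplaneC add0e hmeas_box.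
Qed.

HB.instance Definition _ := Measure_isSigmaFinite.Build _ _ _ hmeas hmeas_sigma_finite.

End HypMeasure.

(** * Radial integrals and the area of small balls *)

Section Radial.
Variable R : realType.
Local Notation plane := (measurableTypeR R * measurableTypeR R)%type.
Local Notation leb := (@lebesgue_measure R).
Local Notation leb2 := (@leb2 R).
Local Notation hmeas := (@hmeas R).
Local Notation H := (@halfplane R).

Lemma sqr_le_norm (a b : R) : `|a| <= b -> a ^+ 2 <= b ^+ 2.
Proof.
by move=> ab; rewrite -real_normK ?num_real// ler_sqr ?nnegrE ?(le_trans _ ab).
Qed.

Definition ipt : R * R := (0, 1).

(** The two coordinates are continuous, so that the product sigma-algebra is
    generated by the open sets, and measures can be compared on these. *)
Lemma plane_borel : @measurable _ plane = <<s @open (R * R)%type >>.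
Proof.
apply/seteqP; split; last first.
  apply: smallest_sub; first by exact: sigma_algebra_measurable.
  exact: open_measurable_plane.
pose T' := g_sigma_algebraType (@open (R * R)%type).
have m1 : measurable_fun [set: T'] (fst : T' -> measurableTypeR R).
  apply: (measurability _ (RGenOpens.measurableE R)) => _ [_ [a [b ->]] <-].
  rewrite setTI; apply: sub_sigma_algebra; apply: open_comp => [z _|]; first exact: cvg_fst.
  exact: interval_open.
have m2 : measurable_fun [set: T'] (snd : T' -> measurableTypeR R).
  apply: (measurability _ (RGenOpens.measurableE R)) => _ [_ [a [b ->]] <-].
  rewrite setTI; apply: sub_sigma_algebra; apply: open_comp => [z _|]; first exact: cvg_snd.
  exact: interval_open.
apply: smallest_sub; first exact: smallest_sigma_algebra.
rewrite subUset; split => _ [X mX <-]; [exact: m1|exact: m2].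
Qed.

Lemma measurable_cdist d (T : measurableType d) (D : set T) (f g : T -> plane) :
  measurable_fun D f -> measurable_fun D g ->
  measurable_fun D (fun t => cdist (f t) (g t) : measurableTypeR R).
Proof.
move=> mf mg.
have c1 (h : T -> plane) : measurable_fun D h ->
    measurable_fun D (fun t => (h t).1) /\ measurable_fun D (fun t => (h t).2).
  by move=> mh; split; [apply: (measurableT_comp measurable_fst mh)|
    apply: (measurableT_comp measurable_snd mh)].
have [f1 f2] := c1 _ mf; have [g1 g2] := c1 _ mg.
apply: measurable_funD; first exact: measurable_cst.
apply: measurable_funM.
  by apply: measurable_funD; apply: measurable_funX; exact: measurable_funB.
apply: measurable_funV; apply: measurable_funM => //.
by apply: measurable_funM => //; exact: measurable_cst.
Qed.

Lemma integral_lebesgue_affine (x y : R) (f : measurableTypeR R -> \bar R) : 0 < y ->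
  measurable_fun setT f -> (forall a, 0 <= f a)%E ->
  (\int[leb]_a f (x + y * a)%R = (y^-1)%:E * \int[leb]_a f a)%E.
Proof.
move=> y0 mf f0.
pose phi : measurableTypeR R -> measurableTypeR R := fun a => x + y * a.
have mphi : measurable_fun setT phi.
  apply: measurable_funD; first exact: measurable_cst.
  by apply: measurable_funM; [exact: measurable_cst|exact: measurable_id].
pose phi' : {mfun measurableTypeR R >-> measurableTypeR R} :=
  HB.pack phi (isMeasurableFun.Build _ _ _ _ _ mphi).
pose yn := NngNum (ltW y0).
have lebE A : measurable A -> leb A = mscale yn (pushforward leb phi') A.
  apply: lebesgue_measure_unique => _ [[a b] ab <-].
  change (leb `]a, b]%classic = y%:E * leb (phi @^-1` `]a, b]%classic))%E.
  have -> : phi @^-1` `]a, b]%classic = `](a - x) / y, (b - x) / y]%classic.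
    apply/seteqP; split => r; rewrite /phi /= !in_itv/= ltr_pdivrMr// ler_pdivlMr//;
      by rewrite ltrBlDr lerBrDr mulrC addrC.
  rewrite !lebesgue_measure_itv/= !lte_fin ltr_pM2r ?invr_gt0// ltrD2r.
  by case: ifP => _; rewrite ?mule0// -!EFinD -EFinM; congr _%:E; field; rewrite gt_eqF.
transitivity (\int[pushforward leb phi']_a f a)%E.
  by rewrite ge0_integral_pushforward// preimage_setT.
rewrite [in RHS](eq_measure_integral (mscale yn (pushforward leb phi'))); last first.
  by move=> A mA _; exact: lebE.
rewrite ge0_integral_mscale//= muleA -EFinM mulVf ?mul1e// gt_eqF//.
Qed.

(** The isometries [z |-> x.1 + x.2 z] move the point (0, 1) to any [x]. *)
Definition hshift (x z : R * R) : R * R := (x.1 + x.2 * z.1, x.2 * z.2).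

(** The Jacobian [x.2 ^+ 2] of the affine map cancels against the density. *)
Lemma ge0_integral_hshift (x : R * R) (f : plane -> \bar R) : 0 < x.2 ->
  measurable_fun setT f -> (forall z, 0 <= f z)%E ->
  (\int[hmeas]_z f (hshift x z) = \int[hmeas]_z f z)%E.
Proof.
move=> x0 mf f0.
have mshift : measurable_fun setT (hshift x : plane -> plane).
  apply: measurable_fun_pair.
    apply: measurable_funD; first exact: measurable_cst.
    by apply: measurable_funM; [exact: measurable_cst|exact: measurable_fst].
  by apply: measurable_funM; [exact: measurable_cst|exact: measurable_snd].
pose F z := (f z * (hden z)%:E)%E.
have mF : measurable_fun setT F.
  by apply: emeasurable_funM => //; apply/measurable_EFinP; exact: measurable_hden.
have F0 z : (0 <= F z)%E by rewrite mule_ge0// lee_fin hden_ge0.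
rewrite !ge0_integral_hmeas//; last exact: measurableT_comp mshift.
transitivity (\int[leb2]_z ((x.2 ^+ 2)%:E * F (hshift x z)))%E.
  apply: eq_integral => z _; rewrite /F muleCA; congr (_ * _)%E; rewrite -EFinM.
  congr _%:E; rewrite /hden /= pmulr_rgt0//; case: ifP => z0; last by rewrite mulr0.
  by field; rewrite !gt_eqF.
rewrite ge0_integralZl//; [|exact: measurableT_comp mshift|by rewrite lee_fin sqr_ge0].
rewrite fubini_tonelli2//; last exact: measurableT_comp mshift.
rewrite [in RHS]fubini_tonelli2// /fubini_G /=.
pose Gf b := (\int[leb]_a F (a, b))%E.
have mG : measurable_fun setT Gf by exact: measurable_fun_fubini_tonelli_G.
have G0 b : (0 <= Gf b)%E by exact: integral_ge0.
transitivity ((x.2 ^+ 2)%:E * \int[leb]_b ((x.2^-1)%:E * Gf (0 + x.2 * b)%R))%E.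
  congr (_ * _)%E; apply: eq_integral => b _; rewrite add0r.
  rewrite -(integral_lebesgue_affine x.1 x0)//.
  apply: measurableT_comp mF _; exact: measurable_pair2.
rewrite ge0_integralZl//; first last.
- by rewrite lee_fin invr_ge0 ltW.
- apply: measurableT_comp mG _; apply: measurable_funD; first exact: measurable_cst.
  by apply: measurable_funM; [exact: measurable_cst|exact: measurable_id].
rewrite integral_lebesgue_affine// !muleA -!EFinM.
by rewrite (_ : _ * _ = 1) ?mul1e//; field; rewrite gt_eqF.
Qed.

Lemma cdist_hshift x z : 0 < x.2 -> 0 < z.2 -> cdist x (hshift x z) = cdist ipt z.
Proof. by move=> x0 z0; rewrite /cdist /hshift /=; field; rewrite !gt_eqF. Qed.

Lemma halfplane_hshift x z : 0 < x.2 -> H (hshift x z) = H z.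
Proof. by move=> x0; rewrite /halfplane /= pmulr_rgt0. Qed.

Lemma measurable_cdistr (x : R * R) (D : set plane) :
  measurable_fun D (fun z : plane => cdist x z : measurableTypeR R).
Proof. by apply: measurable_cdist => //; exact: measurable_cst. Qed.

(** [hshift x] preserves the area and takes the distance to (0, 1) to the
    distance to [x]. *)
Lemma ge0_integral_radial (k : R -> \bar R) (x : R * R) : 0 < x.2 ->
  measurable_fun setT (k : measurableTypeR R -> \bar R) -> (forall t, 0 <= k t)%E ->
  (\int[hmeas]_(z in H) k (cdist x z) =
   \int[hmeas]_(z in H) k (cdist ipt z))%E.
Proof.
move=> x0 mk k0.
rewrite integral_mkcond -(ge0_integral_hshift x0); first last.
- by move=> z; rewrite patchE; case: ifP.
- apply/(measurable_restrictT _ _).1; first exact: measurable_halfplane.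
  by apply/measurable_funTS; apply: measurableT_comp mk _; exact: measurable_cdistr.
rewrite [RHS]integral_mkcond; apply: eq_integral => z _; rewrite !patchE.
have [Hz|Hz] := pselect (H z).
  by rewrite !mem_set ?halfplane_hshift// cdist_hshift.
by rewrite !memNset ?halfplane_hshift.
Qed.

Definition hball (z : R * R) (e : R) : set plane := [set w | H w /\ cdist z w <= 1 + e].

Lemma measurable_hball z e : measurable (hball z e).
Proof.
apply: measurableI; first exact: measurable_halfplane.
have := @measurable_fun_ler _ plane R setT (cdist z) (fun _ => 1 + e)
  (@measurable_cdistr z setT) (measurable_cst _) measurableT [set true] I.
by rewrite setTI; congr measurable; apply/seteqP; split => w.
Qed.

Lemma hmeas_hballE z e : 0 < z.2 -> hmeas (hball z e) = hmeas (hball ipt e).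
Proof.
move=> z0.
pose k (t : R) : \bar R := (\1_[set s : R | s <= 1 + e] t)%:E.
have mk : measurable_fun setT (k : measurableTypeR R -> \bar R).
  apply/measurable_EFinP/measurable_indic.
  rewrite (_ : [set s : R | _] = `]-oo, 1 + e]%classic); first exact: measurable_itv.
  by apply/seteqP; split => s; rewrite /= in_itv.
have E x : (\int[hmeas]_(w in H) k (cdist x w) = hmeas (hball x e))%E.
  transitivity (\int[hmeas]_(w in H) (\1_(hball x e) w)%:E)%E.
    apply: eq_integral => w /[!inE] Hw; rewrite /k !indicE; congr ((_ : bool)%:R)%:E.
    by apply/idP/idP; rewrite !inE // => -[].
  rewrite integral_indic; [|exact: measurable_halfplane|exact: measurable_hball].
  by congr (hmeas _); apply/seteqP; split => [w []//|w []].
by rewrite -!E ge0_integral_radial// => t; rewrite lee_fin.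
Qed.

(** With [e = s ^+ 2], the ball contains a box of sides [2 s] and [s] and lies in
    a box of comparable sides; the density is bounded above and below on them. *)
Lemma hball_area (e : R) : 0 < e -> e <= 1 ->
  ((e / 2)%:E <= hmeas (hball ipt e) <= (512 * e)%:E)%E.
Proof.
move=> e0 e1.
pose s : R := Num.sqrt e; have s0 : 0 < s by rewrite sqrtr_gt0.
have se : s ^+ 2 = e by rewrite sqr_sqrtr// ltW.
have s1 : s <= 1 by rewrite -(ler_sqr) ?nnegrE ?(ltW s0)// se expr1n.
have mI (a b c d : R) : measurable (`[a, b]%classic `*` `[c, d]%classic : set plane).
  exact: measurableX.
have leI (a b : R) : a <= b -> leb `[a, b]%classic = (b - a)%:E.
  rewrite le_eqVlt lebesgue_measure_itv/= lte_fin => /predU1P[->|->].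
    by rewrite ltxx subrr.
  by rewrite EFinB.
have lebX (a b c d : R) : a <= b -> c <= d ->
    leb2 (`[a, b]%classic `*` `[c, d]%classic) = ((b - a) * (d - c))%:E.
  move=> ab cd; transitivity (leb `[a, b]%classic * leb `[c, d]%classic)%E.
    exact: product_measure1E.
  by rewrite !leI.
have lebC (k a b c d : R) : a <= b -> c <= d ->
    (\int[leb2]_(z in `[a, b]%classic `*` `[c, d]%classic) k%:E)%E =
    (k * ((b - a) * (d - c)))%:E.
  move=> ab cd; rewrite integral_cst// EFinM -lebX//.
apply/andP; split.
  pose B : set plane := `[- s, s]%classic `*` `[1, 1 + s]%classic.
  have mB : measurable B by exact: mI.
  have BH : B `<=` hball ipt e.
    move=> z [/=]; rewrite !in_itv/= => /andP[h1 h2] /andP[h3 h4].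
    have z0 : 0 < z.2 by lra.
    split => //; rewrite /cdist /= lerD2l ler_pdivrMr ?mulr_gt0// -se.
    have : (0 - z.1) ^+ 2 <= s ^+ 2.
      by apply: sqr_le_norm; rewrite ler_norml; lra.
    have : (1 - z.2) ^+ 2 <= s ^+ 2.
      by apply: sqr_le_norm; rewrite ler_norml; lra.
    have : s ^+ 2 * 1 <= s ^+ 2 * z.2 by rewrite ler_wpM2l ?sqr_ge0.
    lra.
  apply: le_trans (le_measure hmeas _ _ BH); rewrite ?inE//; last exact: measurable_hball.
  apply: (@le_trans _ _ (\int[leb2]_(z in B) (4^-1)%:E)%E).
    by rewrite lebC ?lee_fin -?se; lra.
  apply: ge0_le_integral => //.
  - by apply/measurable_funTS/measurable_EFinP; exact: measurable_hden.
  - move=> z [_ /=]; rewrite in_itv/= => /andP[h3 h4].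
    rewrite lee_fin /hden (lt_le_trans _ h3)// lef_pV2 ?posrE ?exprn_gt0//; last lra.
    by rewrite (_ : 4 = 2 ^+ 2) ?ler_sqr ?nnegrE//; [lra|lra|ring].
pose r : R := Num.sqrt (8 * e).
have re : r ^+ 2 = 8 * e by rewrite sqr_sqrtr//; lra.
have r0 : 0 <= r by exact: sqrtr_ge0.
pose B : set plane := `[- r, r]%classic `*` `[Num.max (1 / 4) (1 - r), 1 + r]%classic.
have mB : measurable B by exact: mI.
have HB : hball ipt e `<=` B.
  move=> z [z0 ze]; have := cdist_near (ltr01 : 0 < ipt.2) z0 e1 ze.
  have [//|_ h _] := @cdist_box R 2 ipt z ltr01 z0; first by apply: (le_trans ze); lra.
  rewrite /= expr1n mulr1 -re in h * => hr.
  have h1 : `|0 - z.1| <= r.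
    by rewrite -ler_sqr ?nnegrE// real_normK ?num_real//; have := sqr_ge0 (1 - z.2); lra.
  have h2 : `|1 - z.2| <= r.
    by rewrite -ler_sqr ?nnegrE// real_normK ?num_real//; have := sqr_ge0 (0 - z.1); lra.
  move: h1 h2; rewrite !ler_norml => /andP[h1 h1'] /andP[h2 h2'].
  by split; rewrite /= in_itv/= ?ge_max; lra.
apply: le_trans (le_measure hmeas _ _ HB) _; rewrite ?inE//; first exact: measurable_hball.
apply: (@le_trans _ _ (\int[leb2]_(z in B) (16)%:E)%E); last first.
  rewrite lebC; [|lra|by rewrite ge_max; lra]; rewrite lee_fin.
  have h : 1 - r <= Num.max (1 / 4) (1 - r) by rewrite le_max lexx orbT.
  apply: (@le_trans _ _ (16 * ((r - - r) * (2 * r)))); last lra.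
  by rewrite ler_wpM2l// ler_wpM2l//; lra.
apply: ge0_le_integral => //.
- by move=> z _; rewrite lee_fin hden_ge0.
- by apply/measurable_funTS/measurable_EFinP; exact: measurable_hden.
- move=> z [_ /=]; rewrite in_itv/= ge_max => /andP[/andP[h3 _] h4].
  rewrite lee_fin /hden (lt_le_trans _ h3)// -[leRHS]invrK lef_pV2 ?posrE ?invr_gt0 ?exprn_gt0//; last lra.
  apply: (@le_trans _ _ ((1 / 4) ^+ 2)); first lra.
  by rewrite ler_sqr ?nnegrE; lra.
Qed.

End Radial.

(** * Isometries preserve the area *)

Section Isometry.
Variable R : realType.
Local Notation plane := (measurableTypeR R * measurableTypeR R)%type.
Local Notation hmeas := (@hmeas R).
Local Notation H := (@halfplane R).
Local Notation ipt := (@ipt R).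

(** Measures giving the same mass to all balls of the same radius agree
    (Christensen): averaging over small balls and exchanging the integrals
    compares the mass of [P] with that of any set [Q] containing a
    neighbourhood of its image. This takes the place of the change of variables
    formula, isometries being known here through distances only. *)
Lemma hmeas_isometry_le (g h : R * R -> R * R) (P Q : set plane) (e : R) :
  measurable_fun setT (g : plane -> plane) ->
  (forall z, H z -> H (g z)) -> (forall z, H z -> H (h z)) ->
  (forall z w, H z -> H w -> cdist (g z) w = cdist z (h w)) ->
  measurable P -> measurable Q -> P `<=` H -> Q `<=` H -> 0 < e -> e <= 1 ->
  (forall z w, P z -> H w -> cdist (g z) w <= 1 + e -> Q w) ->
  (hmeas P <= hmeas Q)%E.
Proof.
move=> mg gH hH gh mP mQ PH QH e0 e1 PQ.
have /andP[a0 a1] := hball_area e0 e1.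
set a := hmeas (hball ipt e) in a0 a1.
have {}a0 : (0 < a)%E by apply: lt_le_trans a0; rewrite lte_fin divr_gt0.
have fa : a \is a fin_num by rewrite ge0_fin_numE ?(ltW a0)// (le_lt_trans a1) ?ltry.
pose S : set (plane * plane) :=
  [set zw | [/\ P zw.1, Q zw.2 & cdist (g zw.1) zw.2 <= 1 + e]].
have mS : measurable S.
  rewrite (_ : S = (P `*` Q) `&` [set zw | cdist (g zw.1) zw.2 <= 1 + e]); last first.
    by apply/seteqP; split => zw; [case|case=> -[]].
  apply: measurableI; first exact: measurableX.
  have := @measurable_fun_ler _ (plane * plane)%type R setT
    (fun zw => cdist (g zw.1) zw.2) (fun _ => 1 + e).
  move=> /(_ _ _ measurableT [set true] I); rewrite setTI => H1.
  apply: (eq_ind _ measurable (H1 _ _)).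
  - by apply: measurable_cdist => //; exact: measurableT_comp mg measurable_fst.
  - exact: measurable_cst.
  - by apply/seteqP; split => zw.
rewrite -(@lee_pmul2l _ a)//.
have indE (A : set plane) : measurable A -> hmeas A = (\int[hmeas]_z (\1_A z)%:E)%E.
  by move=> mA; rewrite integral_indic// setIT.
have -> : (a * hmeas P = (hmeas \x hmeas) S)%E.
  rewrite indE//.
  rewrite -ge0_integralZl//; [|exact/measurable_EFinP/measurable_indic|exact: ltW].
  apply: eq_integral => z _ /=; rewrite indicE; case: (pselect (P z)) => Pz; last first.
    rewrite memNset// mule0 (_ : xsection S z = set0) ?measure0//.
    by apply/seteqP; split => w //; rewrite /xsection /= inE => -[].
  rewrite mem_set// mule1 /a -(@hmeas_hballE _ (g z)); last exact/gH/PH.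
  congr (hmeas _); apply/seteqP; split => w; rewrite /xsection /= inE.
    by move=> [Hw gw]; split => //; apply: PQ gw.
  by move=> [_ Qw gw]; split => //; exact: QH.
have -> : (hmeas \x hmeas)%E S = (hmeas \x^ hmeas)%E S.
  by apply: product_measure_unique => // A B mA mB; exact: product_measure2E.
rewrite indE//.
rewrite -ge0_integralZl//; [|exact/measurable_EFinP/measurable_indic|exact: ltW].
apply: ge0_le_integral => //.
- exact: measurable_fun_ysection.
- by apply: measurable_funeM; exact/measurable_EFinP/measurable_indic.
move=> w _ /=; rewrite indicE; case: (pselect (Q w)) => Qw; last first.
  rewrite memNset// mule0 (_ : ysection S w = set0) ?measure0//.
  by apply/seteqP; split => z //; rewrite /ysection /= inE => -[].
rewrite mem_set// mule1 /a -(@hmeas_hballE _ (h w)); last exact/hH/QH.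
apply: le_measure; rewrite ?inE.
- exact: measurable_ysection.
- exact: measurable_hball.
move=> z; rewrite /ysection /= inE => -[/= Pz _ gw]; split; first exact: PH.
by rewrite cdistC -gh//; [exact: PH|exact: QH].
Qed.

(** The bound on the height turns the Euclidean margin [n.+1%:R^-1] into a
    hyperbolic one, uniform over the set; such sets are the [P] of the
    comparison above, for [Q] the open set [U]. *)
Definition inner (U : set (R * R)) (n : nat) : set plane :=
  [set w | [/\ H w, w.2 <= n%:R & forall z, ball z n.+1%:R^-1 w -> U z]].

Lemma measurable_inner U n : measurable (inner U n).
Proof.
rewrite (_ : inner U n = (H `&` [set w | w.2 <= n%:R]) `&`
    ~` \bigcup_(z in ~` U) (ball z n.+1%:R^-1)); last first.
  apply/seteqP; split => [w [Hw wn wU]|w [[Hw wn] wU]].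
    by split => // -[z Uz zw]; apply: Uz; exact: wU.
  split => // z zw; apply: contrapT => Uz; apply: wU; by exists z.
apply: measurableI.
  apply: measurableI; first exact: measurable_halfplane.
  have := @measurable_fun_ler _ plane R setT snd (fun _ => n%:R)
    measurable_snd (measurable_cst _) measurableT [set true] I.
  by rewrite setTI; congr measurable; apply/seteqP; split => w.
apply: measurableC; apply: open_measurable_plane; apply: bigcup_open => z _.
exact: ball_open.
Qed.

Lemma inner_cdist U n : exists e : R, [/\ 0 < e, e <= 1 &
  forall w z, inner U n w -> H z -> cdist w z <= 1 + e -> U z].
Proof.
pose m : R := n.+1%:R.
have m0 : 0 < m by rewrite ltr0n.
exists ((16 * m ^+ 4)^-1); split.
- by rewrite invr_gt0 mulr_gt0// exprn_gt0.
- rewrite invf_le1 ?mulr_gt0 ?exprn_gt0//.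
  have : 1 <= m ^+ 4 by rewrite exprn_ege1// ler1n.
  lra.
move=> w z [w0 wn wU] z0 wz; apply: wU.
have {}wz := cdist_near w0 z0 _ wz.
have e1 : (16 * m ^+ 4)^-1 <= 1.
  rewrite invf_le1 ?mulr_gt0 ?exprn_gt0//.
  have : 1 <= m ^+ 4 by rewrite exprn_ege1// ler1n.
  lra.
have {}wz : (w.1 - z.1) ^+ 2 + (w.2 - z.2) ^+ 2 <= 2^-1 * (m ^-1) ^+ 2.
  apply: le_trans (wz e1) _.
  apply: (@le_trans _ _ (8 * (16 * m ^+ 4)^-1 * m ^+ 2)).
    rewrite ler_pM2l ?mulr_gt0 ?invr_gt0 ?mulr_gt0 ?exprn_gt0//.
    rewrite ler_sqr ?nnegrE ?(ltW w0) ?(ltW m0)// (le_trans wn)//.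
    by rewrite ler_nat.
  by rewrite le_eqVlt; apply/orP; left; apply/eqP; field; rewrite gt_eqF.
have mi : 0 < m^-1 by rewrite invr_gt0.
have mi2 : 0 < m^-1 ^+ 2 by rewrite exprn_gt0.
have lt_norm (a : R) : a ^+ 2 <= 2^-1 * m^-1 ^+ 2 -> `|a| < m^-1.
  move=> h; rewrite -ltr_sqr ?nnegrE ?(ltW mi)// real_normK ?num_real//.
  by apply: le_lt_trans h _; rewrite gtr_pMl// invf_lt1// ltr1n.
have s1 := sqr_ge0 (w.1 - z.1); have s2 := sqr_ge0 (w.2 - z.2).
move: (2^-1 * _) wz lt_norm => q wz lt_norm.
by split; rewrite /ball/= distrC; apply: lt_norm; lra.
Qed.

Lemma inner_nd U : {homo inner U : n m / (n <= m)%N >-> (n <= m)%O}.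
Proof.
move=> n m nm; rewrite subsetEset => w [Hw wn wU]; split => //.
  by rewrite (le_trans wn)// ler_nat.
move=> z zw; apply: wU; apply: le_ball zw.
by rewrite lef_pV2 ?posrE ?ltr0n// ler_nat.
Qed.

Lemma inner_cover U : open U -> \bigcup_n inner U n = U `&` H.
Proof.
move=> oU; apply/seteqP; split => [w [n _ [Hw _ wU]]|w [Uw Hw]].
  by split => //; apply: wU; apply: ballxx; rewrite invr_gt0.
have /nbhs_ballP[e /= e0 eU] : nbhs w U by exact: open_nbhs_nbhs.
have eVw : 0 <= e^-1 + w.2 by rewrite addr_ge0// ltW// invr_gt0.
exists (Num.bound (e^-1 + w.2)) => //.
have := archi_boundP eVw; set n := Num.bound _ => nb.
have ei : 0 < e^-1 by rewrite invr_gt0.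
have w0 : 0 < w.2 by [].
split => //; first lra.
move=> z zw; apply: eU; apply: ball_sym; apply: le_ball zw.
rewrite invf_ple ?posrE//; apply: (@le_trans _ _ n%:R); first lra.
by rewrite ler_nat.
Qed.

Section Preserve.
Variables g h : R * R -> R * R.
Hypothesis mg : measurable_fun setT (g : plane -> plane).
Hypothesis mh : measurable_fun setT (h : plane -> plane).
Hypothesis gH : forall z, H z -> H (g z).
Hypothesis hH : forall z, H z -> H (h z).
Hypothesis gh : forall z w, H z -> H w -> cdist (g z) w = cdist z (h w).

Let mH : measurable (H : set plane) := @measurable_halfplane R.

Let mpre (A : set plane) : measurable A -> measurable (H `&` g @^-1` A : set plane).
Proof. by move=> mA; apply: measurableI => //; rewrite -[X in measurable X]setTI; exact: mg. Qed.

(** An open set is the increasing union of its [inner] parts, and these are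
    compared with it by [hmeas_isometry_le], for [g] and for its inverse [h]. *)
Lemma hmeas_preimage_open (U : set (R * R)) : open U -> U `<=` H ->
  hmeas (H `&` g @^-1` U) = hmeas U.
Proof.
move=> oU UH; have mU := open_measurable_plane oU.
have innerU n : inner U n `<=` U.
  by move=> w [_ _ wU]; apply: wU; apply: ballxx; rewrite invr_gt0.
have cvgU (F : nat -> set plane) (A : set plane) (b : \bar R) :
    (forall n, measurable (F n)) -> {homo F : n m / (n <= m)%N >-> (n <= m)%O} ->
    \bigcup_n F n = A -> (forall n, (hmeas (F n) <= b)%E) -> (hmeas A <= b)%E.
  move=> mF nF FA Fb.
  have cF : (hmeas \o F) x @[x --> \oo] --> hmeas (\bigcup_n F n).
    by apply: nondecreasing_cvg_mu => //; exact: bigcup_measurable.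
  rewrite -FA -(cvg_lim _ cF)//; apply: lime_le; first by apply/cvg_ex; eexists; exact: cF.
  by apply: nearW => n; exact: Fb.
apply/eqP; rewrite eq_le; apply/andP; split.
  apply: (cvgU (fun n => H `&` g @^-1` inner U n)) => [n|n m nm||n].
  - by apply: mpre; exact: measurable_inner.
  - rewrite subsetEset; apply: setIS => z.
    by have := inner_nd U nm; rewrite subsetEset; apply.
  - by rewrite -setI_bigcupr -preimage_bigcup inner_cover//; congr (_ `&` _ @^-1` _);
      exact: setIidl.
  have [e [e0 e1 eU]] := inner_cdist U n.
  apply: (@hmeas_isometry_le g h _ _ e) => //.
  - by apply: mpre; exact: measurable_inner.
  - by move=> z w [Hz gz] Hw gw; apply: eU gw.
apply: (cvgU (inner U)) => [n|n m||n].
- exact: measurable_inner.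
- exact: inner_nd.
- by rewrite inner_cover//; exact: setIidl.
have [e [e0 e1 eU]] := inner_cdist U n.
apply: (@hmeas_isometry_le h g _ _ e) => //.
- by move=> z w Hz Hw; rewrite cdistC -gh// cdistC.
- exact: measurable_inner.
- exact: mpre.
- by move=> z [].
- move=> z w Uz Hw hw; have Hz : H z by case: Uz.
  split => //=; apply: (eU z) => //; first exact: gH.
  by rewrite cdistC (gh Hw Hz) cdistC.
Qed.

Lemma hmeas_setIH (A : set plane) : measurable A -> hmeas (H `&` A) = hmeas A.
Proof.
move=> mA; have mHC := measurableC mH.
have z0 : hmeas (A `&` ~` H) = 0%E.
  apply/eqP; rewrite -measure_le0 -(@hmeas_halfplaneC R).
  by apply: le_measure; rewrite ?inE//; exact: measurableI.
rewrite -[in RHS](setIT A) -(setUv H) setIUr measureU//; [|exact: measurableI..|].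
  by rewrite [X in (_ + X)%E]z0 adde0 setIC.
by rewrite setIACA setICr setI0.
Qed.

Let strip (n : nat) : set plane :=
  `]- n%:R, n%:R[%classic `*` `]n.+1%:R^-1, n%:R[%classic.

Let mstrip n : measurable (strip n). Proof. exact: measurableX. Qed.

Let strip_nd : {homo strip : n m / (n <= m)%N >-> (n <= m)%O}.
Proof.
move=> n m nm; rewrite subsetEset => z [/=]; rewrite !in_itv/=.
have nm' : n%:R <= m%:R :> R by rewrite ler_nat.
have nmi : m.+1%:R^-1 <= n.+1%:R^-1 :> R by rewrite lef_pV2 ?posrE ?ltr0n// ler_nat.
move=> /andP[h1 h2] /andP[h3 h4]; split => /=; rewrite in_itv/=.
  by rewrite (lt_le_trans h2 nm') (le_lt_trans _ h1)// lerN2.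
by rewrite (lt_le_trans h4 nm') (le_lt_trans nmi h3).
Qed.

Let strip_cover : \bigcup_n strip n = H.
Proof.
apply/seteqP; split => [z [n _] [_ /=]|z].
  by rewrite in_itv/= => /andP[+ _]; apply: lt_trans; rewrite invr_gt0.
rewrite -{1}hbox_cover => -[n _] [/=]; rewrite !in_itv/= => /andP[h1 h2] /andP[h3 h4].
have n1 : n%:R < n.+1%:R :> R by rewrite ltr_nat.
have ni : n.+2%:R^-1 < n.+1%:R^-1 :> R by rewrite ltf_pV2 ?posrE ?ltr0n// ltr_nat.
exists n.+1 => //; split => /=; rewrite in_itv/=.
  by rewrite (le_lt_trans h2 n1) (lt_le_trans _ h1)// ltrN2.
by rewrite (le_lt_trans h4 n1) (lt_le_trans ni h3).
Qed.

Let hmeas_strip n : (hmeas (strip n) < +oo)%E.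
Proof.
have n0 : 0 < n.+1%:R^-1 :> R by rewrite invr_gt0.
apply: le_lt_trans (hmeas_box (- n%:R) n%:R n%:R n0).
apply: le_measure; rewrite ?inE//; first exact: measurableX.
by apply: setSX; apply: subset_itv_oo_cc.
Qed.

(** By uniqueness of measures agreeing on the open sets, in strips of finite
    area. *)
Lemma hmeas_preimage (A : set plane) : measurable A -> A `<=` H ->
  hmeas (g @^-1` A) = hmeas A.
Proof.
move=> mA AH.
have [pm pmE] : exists pm : {measure set plane -> \bar R}, forall B, pm B = hmeas (g @^-1` B).
  by exists (measure_function_pushforward__canonical__measure_function_Measure hmeas mg).
have mg' (B : set plane) : measurable B -> measurable (g @^-1` B : set plane).
  by move=> mB; rewrite -[X in measurable X]setTI; exact: mg.
have E n : hmeas (g @^-1` (A `&` strip n)) = hmeas (A `&` strip n).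
  pose m1 : {measure set plane -> \bar R} := mrestr pm (mstrip n).
  pose m2 : {measure set plane -> \bar R} := mrestr hmeas (mstrip n).
  have oS : open (strip n : set (R * R)).
    apply: openI; (apply: open_comp; last exact: interval_open) => z _.
      exact: cvg_fst.
    exact: cvg_snd.
  have SH : strip n `<=` H by move=> z Sz; rewrite -strip_cover; exists n.
  suff : m1 A = m2 A by rewrite /m1 /m2 /= /mrestr pmE.
  have U := @measure_unique _ R plane (@open (R * R)%type) (fun=> setT) (@plane_borel R).
  have U1 := U (@openI _) (fun=> @openT _).
  have cover : \bigcup_(_ : nat) [set: plane] = setT by apply: bigcup_const; exists 0%N.
  have U2 := U1 cover m1 m2.
  apply: U2 => //.
  - move=> V oV; rewrite /m1 /m2 /= /mrestr pmE.
    rewrite -hmeas_setIH; last first.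
      by apply: mg'; apply: measurableI => //; exact: open_measurable_plane.
    by apply: hmeas_preimage_open; [exact: openI|move=> z [_ /SH]].
  - move=> k; rewrite /m1 /= /mrestr pmE setTI -hmeas_setIH; last exact: mg'.
    by rewrite hmeas_preimage_open.
have AE : A = \bigcup_n (A `&` strip n) by rewrite -setI_bigcupr strip_cover; apply/esym/setIidl.
have c1 : hmeas (A `&` strip n) @[n --> \oo] --> hmeas A.
  rewrite [X in _ --> hmeas X]AE; apply: nondecreasing_cvg_mu => [n||n m nm].
  - exact: measurableI.
  - by rewrite -AE.
  - by rewrite subsetEset; apply: setIS; have := strip_nd nm; rewrite subsetEset.
have c2 : hmeas (g @^-1` (A `&` strip n)) @[n --> \oo] --> hmeas (g @^-1` A).
  rewrite [X in _ --> hmeas (_ @^-1` X)]AE preimage_bigcup.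
  apply: (@nondecreasing_cvg_mu _ _ _ hmeas (fun n => g @^-1` (A `&` strip n))) => [n||n m nm].
  - by apply: mg'; exact: measurableI.
  - by rewrite -preimage_bigcup -AE; exact: mg'.
  - rewrite subsetEset; apply: preimage_subset; apply: setIS.
    by have := strip_nd nm; rewrite subsetEset.
apply: (@cvg_unique _ (@ereal_hausdorff R) _ _ _ _ c2).
by rewrite /mkset (_ : (fun n => hmeas (g @^-1` _)) = (fun n => hmeas (A `&` strip n)))//; exact/funext.
Qed.

Lemma ge0_integral_isometry (f : plane -> \bar R) :
  (forall z, H (g z) -> H z) -> measurable_fun setT f -> (forall z, 0 <= f z)%E ->
  (\int[hmeas]_(z in H) f (g z) = \int[hmeas]_(z in H) f z)%E.
Proof.
move=> gHV mf f0.
pose g' : {mfun plane >-> plane} := HB.pack g (isMeasurableFun.Build _ _ _ _ _ mg).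
rewrite [RHS](eq_measure_integral (pushforward hmeas g')); last first.
  by move=> A mA AH; exact/esym/(hmeas_preimage mA AH).
rewrite ge0_integral_pushforward//; last exact: measurable_funTS.
by congr integral; apply/seteqP; split => z /=; [exact: gH|exact: gHV].
Qed.

End Preserve.
End Isometry.

(** * Sums over countable sets *)

Section IntegralEsum.
Context d (T : measurableType d) (R : realType) (I : choiceType).
Variables (B : set nat) (e : nat -> I) (S : set I) (BS : set_bij B S e).
Variables (D : set T) (mD : measurable D) (F : I -> T -> \bar R).
Hypothesis mF : forall i, S i -> measurable_fun D (F i).
Hypothesis F0 : forall i x, (0 <= F i x)%E.

Let f n x := if n \in B then F (e n) x else 0%E.

Let f0 n x : (0 <= f n x)%E. Proof. by rewrite /f; case: ifP. Qed.

Let mf n : measurable_fun D (f n).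
Proof.
rewrite /f; have [Bn|_] := boolP (n \in B); last exact: measurable_cst.
by apply: mF; case: BS => + _ _; apply; rewrite -inE.
Qed.

Let esumE x : (\esum_(i in S) F i x = \sum_(n <oo) f n x)%E.
Proof. by rewrite nneseries_esumT// (reindex_esum _ _ _ _ BS) esum_mkcond. Qed.

Lemma measurable_fun_esum : measurable_fun D (fun x => \esum_(i in S) F i x)%E.
Proof.
under eq_fun do rewrite esumE.
exact: (@ge0_emeasurable_sum _ _ _ D f xpredT).
Qed.

(** Tonelli's theorem for a countable index set, along an enumeration of it. *)
Lemma integral_esum (mu : {measure set T -> \bar R}) :
  (\int[mu]_(x in D) (\esum_(i in S) F i x) = \esum_(i in S) (\int[mu]_(x in D) F i x))%E.
Proof.
under eq_integral do rewrite esumE.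
rewrite integral_nneseries// nneseries_esumT; last by move=> n; exact: integral_ge0.
rewrite (reindex_esum _ _ _ _ BS) [RHS]esum_mkcond; apply: eq_esum => n _; rewrite /f.
by case: ifP => // _; rewrite integral0.
Qed.

End IntegralEsum.

(** * The action of isometries on the plane, and bisectors *)

HB.instance Definition _ (R : realType) := isPointed.Build (hyp R) (hyp_i R).

Section Action.
Variable R : realType.
Local Notation plane := (measurableTypeR R * measurableTypeR R)%type.
Local Notation leb := (@lebesgue_measure R).
Local Notation leb2 := (@leb2 R).
Local Notation hmeas := (@hmeas R).
Local Notation H := (@halfplane R).
Local Notation ipt := (@ipt R).
Let mH : measurable (H : set plane) := @measurable_halfplane R.

(** Isometries of the half-plane are extended by the identity outside it, to
    compose them with functions on the measurable plane. *)
Definition act (g : hyp R -> hyp R) (z : R * R) : R * R :=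
  if (insub z : option (hyp R)) is Some w then val (g w) else z.

Lemma act_val g (w : hyp R) : act g (val w) = val (g w).
Proof. by rewrite /act valK. Qed.

Lemma halfplane_val (z : R * R) : H z -> exists w : hyp R, val w = z.
Proof.
move=> Hz; have zH : z \in @halfplane R by rewrite inE.
by exists (Sub z zH : hyp R); rewrite SubK.
Qed.

Lemma open_halfplane : open H.
Proof.
rewrite (_ : H = snd @^-1` [set y : R | 0 < y])//; apply: open_comp; last exact: open_gt.
by move=> z _; exact: cvg_snd.
Qed.

Lemma act_out g z : ~ H z -> act g z = z.
Proof. by move=> Hz; rewrite /act insubF//; apply/negbTE; rewrite notin_setE. Qed.

Lemma act_halfplane g z : H z -> H (act g z).
Proof. by move=> /halfplane_val[w <-]; rewrite act_val; exact: hyp_gt0. Qed.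

Lemma act_halfplaneV g z : H (act g z) -> H z.
Proof. by move=> Hg; apply: contrapT => Hz; move: Hg; rewrite act_out. Qed.

(** The two metrics being locally comparable, an isometry of the hyperbolic one is
    continuous for the Euclidean topology. *)
Lemma continuous_act g z : (forall z w : hyp R, cdist (val (g z)) (val (g w)) = cdist (val z) (val w)) ->
  H z -> {for z, continuous (act g)}.
Proof.
move=> gd Hz; apply/cvgrPdist_lt => e e0.
have Hgz := act_halfplane g Hz.
pose d := Num.min 1 ((e / (act g z).2) ^+ 2 / 16).
have d0 : 0 < d by rewrite lt_min ltr01 divr_gt0// exprn_gt0// divr_gt0.
have cH : \forall w \near z, H w.
  by apply: open_nbhs_nbhs; split => //; exact: open_halfplane.
have cd : \forall w \near z, cdist z w < 1 + d.
  have : cdist z w @[w --> z] --> cdist z z.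
    rewrite /cdist; apply: cvgD; first exact: cvg_cst.
    apply: cvgM.
      by apply: cvgD; apply: cvgM; (apply: cvgB; [exact: cvg_cst|]); [exact: cvg_fst..|exact: cvg_snd|exact: cvg_snd].
    apply: cvgV; first by rewrite !mulf_neq0// gt_eqF.
    by apply: cvgM; [exact: cvg_cst|exact: cvg_snd].
  by move/(cvgr_lt _); apply; rewrite cdistzz ltrDl.
near=> w.
have Hw : H w by near: w.
have zw : cdist (act g z) (act g w) <= 1 + d.
  apply: ltW; have : cdist z w < 1 + d by near: w.
  by have [z' <-] := halfplane_val Hz; have [w' <-] := halfplane_val Hw; rewrite !act_val gd.
have d1 : d <= 1 by rewrite ge_min lexx.
have h := cdist_near Hgz (act_halfplane g Hw) d1 zw.
have {}h : ((act g z).1 - (act g w).1) ^+ 2 + ((act g z).2 - (act g w).2) ^+ 2 <= e ^+ 2 / 2.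
  apply: le_trans h _.
  have : d <= (e / (act g z).2) ^+ 2 / 16 by rewrite ge_min lexx orbT.
  have a0 : 0 < (act g z).2 ^+ 2 by rewrite exprn_gt0.
  rewrite -(ler_pM2r a0) => /(ler_wpM2l (ler0n R 8)).
  rewrite !mulrA => /le_trans; apply; rewrite le_eqVlt; apply/orP; left; apply/eqP; field.
  by rewrite gt_eqF.
have e2 : 0 < e ^+ 2 by rewrite exprn_gt0.
have lt_norm (a : R) : a ^+ 2 <= e ^+ 2 / 2 -> `|a| < e.
  move=> ae; rewrite -ltr_sqr ?nnegrE ?(ltW e0)// real_normK ?num_real//; lra.
have s1 := sqr_ge0 ((act g z).1 - (act g w).1).
have s2 := sqr_ge0 ((act g z).2 - (act g w).2).
rewrite prod_normE gt_max; apply/andP; split; apply: lt_norm => /=; lra.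
Unshelve. all: by end_near. Qed.

Lemma measurable_act g : (forall z w : hyp R, cdist (val (g z)) (val (g w)) = cdist (val z) (val w)) ->
  measurable_fun setT (act g : plane -> plane).
Proof.
move=> gd.
have split_fun (k : plane -> R) : (forall z, {for z, continuous (k : R * R -> R)}) ->
    measurable_fun setT (k : plane -> measurableTypeR R) ->
    measurable_fun setT (fun z : plane => k (act g z) : measurableTypeR R).
  move=> ck mk; rewrite -(setUv H); apply/measurable_funU => //; first exact: measurableC.
  split.
    apply: continuous_measurable_plane; first exact: open_halfplane.
    move=> z Hz; apply: (@continuous_comp _ _ _ (act g) k); last exact: ck.
    exact: continuous_act.
  apply: (eq_measurable_fun k) => [z|]; last exact: measurable_funTS.
  by rewrite inE => Hz; rewrite act_out.
rewrite (_ : act g = fun z => ((act g z).1, (act g z).2)); last first.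
  by apply/funext => z; rewrite -surjective_pairing.
have c1 z : {for z, continuous (fst : R * R -> R)} by exact: cvg_fst.
have c2 z : {for z, continuous (snd : R * R -> R)} by exact: cvg_snd.
exact: measurable_fun_pair (split_fun _ c1 measurable_fst) (split_fun _ c2 measurable_snd).
Qed.

Section NullBisector.
Variables p q : R * R.
Hypotheses (p0 : H p) (q0 : H q) (pq : p <> q).

Definition bisector : set plane := [set z | H z /\ cdist z p = cdist z q].

Lemma measurable_bisector : measurable bisector.
Proof.
apply: measurableI => //.
have := @measurable_fun_eqr _ plane R setT (fun z => cdist z p) (fun z => cdist z q).
move=> /(_ _ _ measurableT [set true] I); rewrite setTI => h.
apply: (eq_ind _ measurable (h _ _)).
- by apply: measurable_cdist => //; exact: measurable_cst.
- by apply: measurable_cdist => //; exact: measurable_cst.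
- by apply/seteqP; split => z /= /eqP.
Qed.

(** On a horizontal line the bisector is the zero set of a nonzero polynomial of
    degree at most 2. *)
Lemma countable_bisector_section b : countable [set a : R | bisector (a, b)].
Proof.
have [b0|b0] := ltP 0 b; last first.
  rewrite (_ : [set a | _] = set0); first exact: countable0.
  by apply/seteqP; split => a // [] /=; rewrite /halfplane/= ltNge b0.
have eqn a : bisector (a, b) ->
    q.2 * ((a - p.1) ^+ 2 + b ^+ 2 + p.2 ^+ 2) = p.2 * ((a - q.1) ^+ 2 + b ^+ 2 + q.2 ^+ 2).
  have b'0 : b != 0 by rewrite gt_eqF.
  have p'0 : p.2 != 0 by rewrite gt_eqF.
  have q'0 : q.2 != 0 by rewrite gt_eqF.
  move=> [_]; rewrite !cdistE//= => E.
  transitivity (((a - p.1) ^+ 2 + b ^+ 2 + p.2 ^+ 2) / (2 * b * p.2) * (2 * b * p.2 * q.2)).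
    by field; rewrite b'0 p'0.
  by rewrite E; field; rewrite b'0 q'0.
pose al := q.2 - p.2; pose be := 2 * (p.2 * q.1 - q.2 * p.1).
pose ga := q.2 * (p.1 ^+ 2 + b ^+ 2 + p.2 ^+ 2) - p.2 * (q.1 ^+ 2 + b ^+ 2 + q.2 ^+ 2).
have {}eqn a : bisector (a, b) -> al * a ^+ 2 + be * a + ga = 0.
  by move=> /eqn/eqP; rewrite -subr_eq0 => /eqP E; rewrite -[RHS]E /al /be /ga; ring.
apply: finite_set_countable.
have [al0|al0] := eqVneq al 0.
  have be0 : be != 0.
    move: al0 => /eqP; rewrite subr_eq0 => /eqP pq2.
    have qp : q.1 - p.1 != 0.
      rewrite subr_eq0; apply/eqP => pq1.
      by apply: pq; rewrite (surjective_pairing p) (surjective_pairing q) pq1 pq2.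
    by rewrite /be pq2 -mulrBr !mulf_neq0// gt_eqF.
  apply: (@sub_finite_set _ _ [set - ga / be]); last exact: finite_set1.
  move=> a /= /eqn; rewrite al0 mul0r add0r => /eqP; rewrite addr_eq0 => /eqP E.
  by rewrite -E mulrAC divff// mul1r.
pose de := (be / (2 * al)) ^+ 2 - ga / al.
apply: (@sub_finite_set _ _ [set - (be / (2 * al)) + Num.sqrt de; - (be / (2 * al)) - Num.sqrt de]);
  last exact: finite_set2.
move=> a /= /eqn E.
have E2 : (a + be / (2 * al)) ^+ 2 = de.
  apply/eqP; rewrite -subr_eq0; apply/eqP.
  transitivity ((al * a ^+ 2 + be * a + ga) / al); last by rewrite E mul0r.
  by rewrite /de; field.
have : (a + be / (2 * al)) ^+ 2 == Num.sqrt de ^+ 2.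
  by rewrite sqr_sqrtr ?E2// -E2 sqr_ge0.
rewrite eqf_sqr => /orP[] /eqP <-; [left|right].
  by rewrite addrC addrK.
by rewrite addrC addrK.
Qed.

(** By Fubini's theorem, from the horizontal sections. *)
Lemma hmeas_bisector : hmeas bisector = 0%E.
Proof.
have mB := measurable_bisector.
have leb2B : leb2 bisector = 0%E.
  have -> : leb2 bisector = (leb \x^ leb)%E bisector.
    by apply: product_measure_unique => // A C mA mC; exact: product_measure2E.
  apply: integral0_eq => b _ /=; apply: countable_lebesgue_measure0.
  apply: sub_countable (countable_bisector_section b); apply: subset_card_le => a.
  by rewrite /ysection /= inE.
rewrite /hmeas (@ge0_negligible_integral _ _ _ leb2 bisector bisector)//.
- by rewrite setDv integral_set0.
- by apply/measurable_funTS/measurable_EFinP; exact: measurable_hden.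
- by move=> z _; rewrite lee_fin hden_ge0.
Qed.
End NullBisector.
End Action.

(** * The Dirichlet tiling and unfolding *)

Lemma seq_has_min (R : realType) (T : eqType) (c : T -> R) (x : T) (s : seq T) :
  x \in s -> exists2 y, y \in s & forall z, z \in s -> c y <= c z.
Proof.
elim: s x => // a s IH x _.
have [->|[b bs]] : s = [::] \/ exists b, b \in s.
- by case: (s) => [|b t]; [left|right; exists b; rewrite mem_head].
- by exists a => [|z]; rewrite inE // => /eqP->.
have [y ys ymin] := IH b bs; have [ay|ya] := leP (c a) (c y).
  exists a => [|z]; rewrite ?mem_head// inE => /predU1P[->//|zs].
  exact: le_trans ay (ymin z zs).
exists y => [|z]; rewrite inE ?ys ?orbT// => /predU1P[->|]; [exact: ltW|exact: ymin].
Qed.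

Section Unfolding.
Variables (R : realType) (G : deck_group R).
Local Notation plane := (measurableTypeR R * measurableTypeR R)%type.
Local Notation hmeas := (@hmeas R).
Local Notation H := (@halfplane R).
Local Notation D := (dirichlet G).
Local Notation ipt := (@ipt R).
Let mH : measurable (H : set plane) := @measurable_halfplane R.

Lemma deck_enum : exists (B : set nat) (e : nat -> hyp R -> hyp R), set_bij B (deck G) e.
Proof.
have /countable_bijP[B] := deck_countable G.
by rewrite card_eq_sym => /card_set_bijP[e eB]; exists B, e.
Qed.

(** [deck_inv] only asserts the existence of an inverse; sums over the group are
    reindexed by this function. *)
Definition deck_inverse (g : hyp R -> hyp R) : hyp R -> hyp R :=
  if pselect (exists h, [/\ deck G h, cancel g h & cancel h g]) is left E
  then projT1 (cid E) else id.

Lemma deck_inverseP g : deck G g -> [/\ deck G (deck_inverse g), cancel g (deck_inverse g) & cancel (deck_inverse g) g].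
Proof. by move=> /deck_invE[h hP]; rewrite /deck_inverse; case: pselect => [E|[]]; [case: cid|exists h]. Qed.

Lemma deck_inverseK g : deck G g -> deck_inverse (deck_inverse g) = g.
Proof.
move=> Gg; have [Gh gh hg] := deck_inverseP Gg; have [_ _ hk] := deck_inverseP Gh.
by apply/funext => z; apply: (can_inj hg); rewrite hk gh.
Qed.

Lemma deck_inverse_bij : set_bij (deck G) (deck G) deck_inverse.
Proof.
split=> [g Gg|g h|g Gg]; first by case: (deck_inverseP Gg).
  by rewrite !inE => Gg Gh E; rewrite -(deck_inverseK Gg) -(deck_inverseK Gh) E.
by exists (deck_inverse g); [case: (deck_inverseP Gg)|rewrite deck_inverseK].
Qed.

Lemma esum_deck_inverse (a : (hyp R -> hyp R) -> \bar R) :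
  (\esum_(g in deck G) a g = \esum_(g in deck G) a (deck_inverse g))%E.
Proof. by rewrite (reindex_esum _ _ _ _ deck_inverse_bij). Qed.

Lemma measurable_deck g : deck G g -> measurable_fun setT (act g : plane -> plane).
Proof. by move=> Gg; apply: measurable_act => z w; exact: (cdist_deck z w Gg). Qed.

Lemma cdist_deck_inverse g z w : deck G g -> H z -> H w ->
  cdist (act g z) w = cdist z (act (deck_inverse g) w).
Proof.
move=> Gg /halfplane_val[z' <-] /halfplane_val[w' <-]; rewrite !act_val.
have [Gh _ hg] := deck_inverseP Gg.
by rewrite -{1}(hg w') (cdist_deck _ _ Gg).
Qed.

Lemma actK g z : deck G g -> act (deck_inverse g) (act g z) = z.
Proof.
move=> Gg; have [_ gh _] := deck_inverseP Gg; have [Hz|Hz] := pselect (H z).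
  by have [w <-] := halfplane_val Hz; rewrite !act_val gh.
by rewrite !act_out.
Qed.

Lemma ge0_integral_deck g (f : plane -> \bar R) : deck G g ->
  measurable_fun setT f -> (forall z, 0 <= f z)%E ->
  (\int[hmeas]_(z in H) f (act g z) = \int[hmeas]_(z in H) f z)%E.
Proof.
move=> Gg mf f0; have [Gh _ _] := deck_inverseP Gg.
apply: (@ge0_integral_isometry R (act g) (act (deck_inverse g))) => //.
- exact: measurable_deck.
- exact: measurable_deck.
- by move=> z; exact: act_halfplane.
- by move=> z; exact: act_halfplane.
- by move=> z w Hz Hw; exact: cdist_deck_inverse.
- by move=> z; exact: act_halfplaneV.
Qed.

Lemma ipt_halfplane : H ipt. Proof. exact: ltr01. Qed.

(** Moving the group element to the other argument of the distance turns the
    condition into one comparing [z] with the orbit of the centre. *)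
Lemma dirichletP z : D z <-> H z /\ forall g, deck G g -> cdist z ipt <= cdist z (act g ipt).
Proof.
have E g (w : hyp R) : deck G g -> cdist (val w) (act (deck_inverse g) ipt) = cdist (val (g w)) ipt.
  by move=> Gg; rewrite -act_val -cdist_deck_inverse//; [exact: hyp_gt0|exact: ipt_halfplane].
split => [[w wD <-]|[Hz zD]].
  split; first exact: hyp_gt0.
  move=> g Gg; have [Gh _ _] := deck_inverseP Gg; have := wD _ Gh.
  by rewrite le_hdist -(E _ w Gh) deck_inverseK.
have [w wz] := halfplane_val Hz; exists w => // g Gg.
have [Gh _ _] := deck_inverseP Gg.
by rewrite le_hdist -(E _ w Gg) wz; exact: zD.
Qed.

Lemma measurable_dirichlet : measurable (D : set plane).
Proof.
have [B [e eB]] := deck_enum.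
pose F n : set plane := [set z | cdist z ipt <= cdist z (act (e n) ipt)].
rewrite (_ : D = H `&` \bigcap_(n in B) F n); last first.
  apply/seteqP; split => z; rewrite dirichletP.
    by move=> [Hz zD]; split => // n Bn; apply: zD; case: eB => + _ _; exact.
  by move=> [Hz zF]; split => // g Gg; case: eB => _ _ /(_ g Gg)[n Bn <-]; exact: zF.
apply: measurableI => //; apply: bigcap_measurableType => n Bn.
have := @measurable_fun_ler _ plane R setT (fun z => cdist z ipt) (fun z => cdist z (act (e n) ipt)).
move=> /(_ _ _ measurableT [set true] I); rewrite setTI => h.
apply: (eq_ind _ measurable (h _ _)).
- by apply: measurable_cdist => //; exact: measurable_cst.
- by apply: measurable_cdist => //; exact: measurable_cst.
- by apply/seteqP; split => z.
Qed.

(** The points having two nearest points in the orbit of the centre. *)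
Definition ties : set plane :=
  \bigcup_(gh in [set gh | [/\ deck G gh.1, deck G gh.2 & gh.1 <> gh.2]])
    bisector (act gh.1 ipt) (act gh.2 ipt).

(** As the group acts freely, distinct elements take the centre to distinct
    points, whose bisector is null. *)
Lemma negligible_ties : hmeas.-negligible ties.
Proof.
have [B [e eB]] := deck_enum; have [eG einj esurj] := eB.
pose F n m : set plane := if `[< [/\ B n, B m & e n <> e m] >] then
  bisector (act (e n) ipt) (act (e m) ipt) else set0.
apply: (@negligibleS _ _ _ hmeas (\bigcup_n \bigcup_m F n m)).
  move=> z [[g h] /= [Gg Gh gh] zb].
  have [n Bn en] := esurj _ Gg; have [m Bm em] := esurj _ Gh.
  exists n => //; exists m => //; rewrite /F; case: asboolP => [_|]; first by rewrite en em.
  by case; split => //; rewrite en em.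
apply: negligible_bigcup => n; apply: negligible_bigcup => m; rewrite /F.
case: asboolP => [[Bn Bm nm]|_]; last exact: negligible_set0.
have Hn : H (act (e n) ipt) by apply: act_halfplane; exact: ipt_halfplane.
have Hm : H (act (e m) ipt) by apply: act_halfplane; exact: ipt_halfplane.
apply/negligibleP; first exact: measurable_bisector.
apply: hmeas_bisector => //.
have [w wi] := halfplane_val ipt_halfplane; rewrite -wi !act_val => /val_inj E.
apply: nm; have Gn := eG _ Bn; have [Gh gh hg] := deck_inverseP (eG _ Bm).
have /deck_free : deck G (deck_inverse (e m) \o e n) by exact: deck_comp.
move=> /(_ w) /= ; rewrite E gh => /(_ erefl) /(congr1 (fun k => e m \o k)) {}E.
by apply/funext => v; have := congr1 (fun k => k v) E; rewrite /= hg.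
Qed.

(** By local finiteness some point of the orbit of the centre is nearest to [w],
    and outside [ties] only one is. The inverse of the element giving this point
    is the one that brings [w] into the domain. *)
Lemma dirichlet_tiling w : H w -> ~ ties w ->
  exists2 g0, deck G g0 & forall g, deck G g -> (D (act g w) <-> g = g0).
Proof.
move=> Hw wT; pose c g := cdist w (act g ipt).
have [w' ww'] := halfplane_val Hw; have [i ii] := halfplane_val ipt_halfplane.
pose A := [set g | deck G g /\ c g <= c id].
have fA : finite_set A.
  apply: sub_finite_set (deck_locally_finite G w' i (c id)) => g [Gg gc]; split => //.
  by rewrite ww' -act_val ii.
have idA : id \in fset_set A by rewrite in_fset_set// inE; split => //; exact: deck_id.
have [g0 + g0min] := seq_has_min c idA; rewrite in_fset_set// inE => -[Gg0 g0id].
have {}g0min h : deck G h -> c g0 <= c h.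
  move=> Gh; have [hid|/ltW idh] := leP (c h) (c id).
    by apply: g0min; rewrite in_fset_set// inE.
  exact: le_trans g0id idh.
have DE g : deck G g -> D (act (deck_inverse g) w) <-> forall h, deck G h -> c g <= c h.
  move=> Gg; have [Gk gk kg] := deck_inverseP Gg; rewrite dirichletP.
  have E : cdist (act (deck_inverse g) w) ipt = c g.
    by rewrite cdist_deck_inverse// ?deck_inverseK//; exact: ipt_halfplane.
  have E2 h : cdist (act (deck_inverse g) w) (act h ipt) = c (g \o h).
    rewrite cdist_deck_inverse// ?deck_inverseK//; last by apply: act_halfplane; exact: ipt_halfplane.
    by rewrite /c -ii !act_val.
  split => [[_ h1] h Gh|h1].
    rewrite -E (_ : h = g \o (deck_inverse g \o h)); last by apply/funext => v /=; rewrite kg.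
    by rewrite -E2; apply: h1; exact: deck_comp.
  split; first exact: act_halfplane.
  by move=> h Gh; rewrite E E2; apply: h1; exact: deck_comp.
have [Gi _ _] := deck_inverseP Gg0; exists (deck_inverse g0) => // g Gg.
split => [Dg|->]; last exact/DE.
have [Gi' _ _] := deck_inverseP Gg.
rewrite -(deck_inverseK Gg) in Dg *; congr deck_inverse.
have gmin := (DE _ Gi').1 Dg; apply: contrapT => gg0.
apply: wT; exists (deck_inverse g, g0) => //=; split => //.
by apply/eqP; rewrite eq_le gmin// g0min.
Qed.

(** Up to a null set the translates of the domain cover the plane once, and they
    have the same area. *)
Lemma integral_unfold (F : plane -> \bar R) : measurable_fun setT F ->
  (forall z, 0 <= F z)%E ->
  (\int[hmeas]_(z in D) (\esum_(g in deck G) F (act g z)) = \int[hmeas]_(z in H) F z)%E.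
Proof.
move=> mF F0; have [B [e eB]] := deck_enum.
have mFg g : deck G g -> measurable_fun setT (fun z => F (act g z)).
  by move=> Gg; apply: measurableT_comp mF _; exact: measurable_deck.
have mD := measurable_dirichlet.
have DH : D `<=` H by move=> z /dirichletP[].
have m1 g : deck G g -> measurable_fun setT (fun z : plane => (\1_D (act g z))%:E : \bar R).
  move=> Gg; apply/measurable_EFinP; apply: measurableT_comp (measurable_deck Gg).
  exact: measurable_indic.
rewrite (integral_esum eB) => //; last by move=> g Gg; apply: measurable_funTS; exact: mFg.
transitivity (\esum_(g in deck G) (\int[hmeas]_(w in H) (F w * (\1_D (act (deck_inverse g) w))%:E)))%E.
  apply: eq_esum => g Gg; have [Gh gh hg] := deck_inverseP Gg.
  rewrite -(@ge0_integral_deck g (fun w => F w * (\1_D (act (deck_inverse g) w))%:E)%E)//.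
  - rewrite -[in LHS](setIidr DH) integral_mkcondr; apply: eq_integral => z Hz.
    rewrite actK// patchE indicE; case: ifP => _; by rewrite ?mule1 ?mule0.
  - by apply: emeasurable_funM => //; exact: m1.
  - by move=> z; rewrite mule_ge0// lee_fin.
rewrite -(esum_deck_inverse (fun g => \int[hmeas]_(w in H) (F w * (\1_D (act g w))%:E)))%E.
rewrite -(integral_esum eB) => //; first last.
- by move=> g z; rewrite mule_ge0// lee_fin.
- by move=> g Gg; apply: measurable_funTS; apply: emeasurable_funM => //; exact: m1.
apply: ge0_ae_eq_integral => //.
- apply: (measurable_fun_esum eB) => //.
  + by move=> g Gg; apply: measurable_funTS; apply: emeasurable_funM => //; exact: m1.
  + by move=> g z; rewrite mule_ge0// lee_fin.
- exact: measurable_funTS.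
- by move=> z _; apply: esum_ge0 => g _; rewrite mule_ge0// lee_fin.
apply: negligibleS negligible_ties => z /= zN; apply: contrapT => zT; apply: zN => Hz.
have [g0 Gg0 gU] := dirichlet_tiling Hz zT.
rewrite (esumID [set g0]); last by move=> g _; rewrite mule_ge0// lee_fin.
rewrite setIidr; last by move=> _ ->.
rewrite esum_set1; last by rewrite mule_ge0// lee_fin.
rewrite indicE mem_set ?mule1; last exact/(gU _ Gg0).
rewrite esum1 ?adde0// => g [Gg /= gg0].
by rewrite indicE memNset ?mule0// => /(gU _ Gg).
Qed.

End Unfolding.

(** * Truncated powers and integration by parts on a segment *)

Section Calculus.
Variable R : realType.
Implicit Types (f g : R -> R) (s a b : R).

Lemma is_derive_mul f g s a b : is_derive s 1 f a -> is_derive s 1 g b ->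
  is_derive s 1 (fun x => f x * g x) (f s * b + g s * a).
Proof. by move=> fa gb; exact: is_deriveM. Qed.

Lemma is_derive_add f g s a b : is_derive s 1 f a -> is_derive s 1 g b ->
  is_derive s 1 (fun x => f x + g x) (a + b).
Proof. by move=> fa gb; exact: is_deriveD. Qed.

Lemma is_derive_sub f g s a b : is_derive s 1 f a -> is_derive s 1 g b ->
  is_derive s 1 (fun x => f x - g x) (a - b).
Proof. by move=> fa gb; exact: is_deriveB. Qed.

Lemma is_derive_continuous f s a : is_derive s 1 f a -> {for s, continuous f}.
Proof. by move=> fa; apply/differentiable_continuous/derivable1_diffP. Qed.

(** Truncated powers, and integrals depending on a parameter, come with Taylor
    estimates rather than with formulas that the rules of calculus apply to. *)
Lemma is_derive_quadratic f s a (C e : R) : 0 < e ->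
  (forall h, `|h| < e -> `|f (s + h) - f s - h * a| <= C * h ^+ 2) ->
  is_derive s 1 f a.
Proof.
move=> e0 fC.
have C0 : 0 <= C.
  have : 0 <= C * (e / 2) ^+ 2.
    by apply: le_trans (normr_ge0 _) (fC _ _); rewrite ger0_norm; lra.
  by rewrite pmulr_lge0// exprn_gt0// divr_gt0.
have cv : (fun h => h^-1 *: ((f \o shift s) (h *: (1 : R)) - f s)) @ 0^' --> a.
  apply/cvgrPdist_le => r r0.
  near=> h.
  have h0 : h != 0 by near: h; exact: nbhs_dnbhs_neq.
  have he : `|h| < e by near: h; apply: dnbhs0_lt.
  have hr : `|h| <= r / (C + 1).
    by near: h; apply: dnbhs0_le; rewrite divr_gt0// ltr_wpDl.
  have h'0 : 0 < `|h| by rewrite normr_gt0.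
  rewrite /= -[h *: 1]/(h * 1) mulr1 [h + s]addrC.
  have -> : a - h^-1 *: (f (s + h) - f s) = - (h^-1 * (f (s + h) - f s - h * a)).
    by rewrite -[_ *: _]/(_ * _); field.
  rewrite normrN normrM normfV ler_pdivrMl//.
  apply: le_trans (fC _ he) _.
  rewrite -[h ^+ 2]real_normK ?num_real// expr2 mulrCA ler_pM2l//.
  apply: le_trans (_ : (C + 1) * `|h| <= _); first by rewrite ler_wpM2r// lerDl.
  by rewrite mulrC -ler_pdivlMr// ltr_wpDl.
by apply: DeriveDef; [apply/cvg_ex; exists a|exact/cvg_lim].
Unshelve. all: by end_near. Qed.

Definition pospart s : R := Num.max s 0.

Lemma pospart_ge0 s : 0 <= pospart s. Proof. by rewrite le_max lexx orbT. Qed.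

Lemma pospart_le0 s : s <= 0 -> pospart s = 0. Proof. by move=> s0; rewrite /pospart max_r. Qed.

Lemma pospart_ge s : s <= pospart s. Proof. by rewrite le_max lexx. Qed.

Lemma pospart_mul s : s * pospart s = pospart s ^+ 2.
Proof. by rewrite /pospart; case: (leP s 0) => // s0; rewrite expr0n/= mulr0. Qed.

Lemma pospart_sqr_taylor s h :
  `|pospart (s + h) ^+ 2 - pospart s ^+ 2 - h * (2 * pospart s)| <= h ^+ 2.
Proof.
rewrite /pospart; case: (leP s 0) => s0; case: (leP (s + h) 0) => sh0.
- by rewrite expr0n/= !mulr0 !subr0 normr0 sqr_ge0.
- rewrite expr0n/= !mulr0 !subr0 ger0_norm ?sqr_ge0// ler_sqr ?nnegrE; lra.
- rewrite expr0n/= ler_norml.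
  have q1 : 0 <= s * (- h - s) by apply: mulr_ge0; lra.
  have q2 : 0 <= s * - h by apply: mulr_ge0; lra.
  have q3 : 0 <= (s + h) ^+ 2 by exact: sqr_ge0.
  have q4 := sqr_ge0 h.
  rewrite sqrrD in q3; apply/andP; split; lra.
- by rewrite (_ : _ - _ = h ^+ 2) ?ger0_norm ?sqr_ge0//; ring.
Qed.

Lemma pospart_cube_taylor s h : `|h| <= 1 ->
  `|pospart (s + h) ^+ 3 - pospart s ^+ 3 - h * (3 * pospart s ^+ 2)| <=
  (3 * `|s| + 1) * h ^+ 2.
Proof.
move=> h1.
have hh : `|h| * h ^+ 2 <= h ^+ 2 by rewrite ler_piMl ?sqr_ge0.
have hn : h <= `|h| by exact: ler_norm.
have hn' : - h <= `|h| by rewrite -normrN; exact: ler_norm.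
have h2 := sqr_ge0 h.
have c3 : h * h ^+ 2 <= h ^+ 2 by apply: le_trans hh; rewrite ler_wpM2r.
have c3' : - (h * h ^+ 2) <= h ^+ 2 by apply: le_trans hh; rewrite -mulNr ler_wpM2r.
rewrite /pospart; case: (leP s 0) => s0; case: (leP (s + h) 0) => sh0.
- rewrite !expr0n/= !mulr0 !subr0 normr0 mulr_ge0// addr_ge0// mulr_ge0//.
- rewrite !expr0n/= !mulr0 !subr0 ger0_norm ?exprn_ge0 ?(ltW sh0)//.
  apply: (@le_trans _ _ (h ^+ 3)).
    by rewrite ler_pXn2r ?nnegrE//; lra.
  have : 0 <= 3 * `|s| * h ^+ 2 by rewrite mulr_ge0// mulr_ge0.
  rewrite exprS; lra.
- have sn : `|s| = s by rewrite gtr0_norm.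
  rewrite expr0n/= sn ler_norml.
  have q1 : s ^+ 2 <= h ^+ 2 by rewrite -[h ^+ 2]sqrrN ler_sqr ?nnegrE; lra.
  have q2 : 0 <= s * (- h - s) by apply: mulr_ge0; lra.
  have q3 : 0 <= s * (s * (- h - s)) by apply: mulr_ge0; lra.
  have q4 : 0 <= s * (h ^+ 2 - s ^+ 2) by apply: mulr_ge0; lra.
  have q5 : 0 <= s * ((- h) * (- h - s)) by apply: mulr_ge0; [lra|apply: mulr_ge0; lra].
  have q6 : 0 <= s * h ^+ 2 by rewrite mulr_ge0// ltW.
  have q7 : 0 <= s ^+ 3 by rewrite exprn_ge0// ltW.
  apply/andP; split; lra.
- rewrite (gtr0_norm s0) [X in `|X| <= _](_ : _ = 3 * s * h ^+ 2 + h * h ^+ 2); last by ring.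
  have : 0 <= 3 * s * h ^+ 2 by rewrite mulr_ge0// mulr_ge0// ltW.
  rewrite ler_norml; lra.
Qed.

Lemma is_derive_pospart2 s : is_derive s 1 (fun s => pospart s ^+ 2) (2 * pospart s).
Proof.
apply: (@is_derive_quadratic _ _ _ 1 1) => // h _.
by rewrite mul1r; exact: pospart_sqr_taylor.
Qed.

Lemma is_derive_pospart3 s : is_derive s 1 (fun s => pospart s ^+ 3) (3 * pospart s ^+ 2).
Proof.
apply: (@is_derive_quadratic _ _ _ (3 * `|s| + 1) 1) => // h h1.
exact/pospart_cube_taylor/ltW.
Qed.

Lemma continuous_pospart : continuous pospart.
Proof.
move=> s; rewrite /pospart.
rewrite (_ : (fun s => _) = (fun s : R => (s + `|s|) / 2)); last first.
  by apply/funext => t; case: (leP t 0) => t0;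
    [rewrite ler0_norm// subrr mul0r|rewrite gtr0_norm//; lra].
apply: cvgM; last exact: cvg_cst.
by apply: cvgD => //; exact: norm_continuous.
Qed.

(** The integrand is the derivative of [- 3 U p^2 T' - p^3 U'] with
    [p = pospart (c - T)], and [p] vanishes at both ends. *)
Lemma green_segment (U U' U'' T T' T'' : R -> R) (c A0 A1 : R) : A0 < A1 ->
  (forall s, A0 <= s <= A1 -> is_derive s 1 U (U' s)) ->
  (forall s, A0 <= s <= A1 -> is_derive s 1 U' (U'' s)) ->
  (forall s, A0 <= s <= A1 -> is_derive s 1 T (T' s)) ->
  (forall s, A0 <= s <= A1 -> is_derive s 1 T' (T'' s)) ->
  (forall s, A0 <= s <= A1 -> {for s, continuous U''}) ->
  (forall s, A0 <= s <= A1 -> {for s, continuous T''}) ->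
  c <= T A0 -> c <= T A1 ->
  (\int[@lebesgue_measure R]_(s in `[A0, A1])
    (U s * (6 * pospart (c - T s) * T' s ^+ 2 - 3 * pospart (c - T s) ^+ 2 * T'' s)
     - pospart (c - T s) ^+ 3 * U'' s)%:E = 0)%E.
Proof.
move=> A01 dU dU' dT dT' cU cT c0 c1.
pose p s := pospart (c - T s).
pose F s := U s * (- (3 * p s ^+ 2) * T' s) - p s ^+ 3 * U' s.
pose Fd s := U s * (6 * p s * T' s ^+ 2 - 3 * p s ^+ 2 * T'' s) - p s ^+ 3 * U'' s.
have dc s : A0 <= s <= A1 -> is_derive s 1 (fun s => c - T s) (- T' s).
  move=> sA; have := is_derive_sub (is_derive_cst c s 1) (dT s sA).
  by rewrite sub0r.
have dp2 s : A0 <= s <= A1 -> is_derive s 1 (fun s => p s ^+ 2) (2 * p s * - T' s).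
  by move=> sA; exact: is_derive1_comp (is_derive_pospart2 _) (dc s sA).
have dp3 s : A0 <= s <= A1 -> is_derive s 1 (fun s => p s ^+ 3) (3 * p s ^+ 2 * - T' s).
  by move=> sA; exact: is_derive1_comp (is_derive_pospart3 _) (dc s sA).
have dF s : A0 <= s <= A1 -> is_derive s 1 F (Fd s).
  move=> sA; rewrite /F.
  have d1 : is_derive s 1 (fun s => - (3 * p s ^+ 2) * T' s)
      (- (3 * p s ^+ 2) * T'' s + T' s * (-3 * (2 * p s * - T' s))).
    apply: is_derive_mul (dT' s sA).
    rewrite (_ : (fun x => _) = (fun x => -3 * p x ^+ 2)); last first.
      by apply/funext => x; rewrite mulNr.
    by apply: is_derive_eq (is_derive_mul (is_derive_cst _ _ _) (dp2 s sA)) _; rewrite mulr0 addr0.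
  apply: is_derive_eq (is_derive_sub (is_derive_mul (dU s sA) d1)
    (is_derive_mul (dp3 s sA) (dU' s sA))) _.
  by rewrite /Fd; ring.
have cp s : A0 <= s <= A1 -> {for s, continuous p}.
  move=> sA; apply: (@continuous_comp _ _ _ (fun s => c - T s) pospart).
    exact: is_derive_continuous (dc s sA).
  exact: continuous_pospart.
have inI s : s \in `]A0, A1[ -> A0 <= s <= A1.
  by rewrite in_itv/= => /andP[h1 h2]; rewrite !ltW.
have A0I : A0 <= A0 <= A1 by rewrite lexx ltW.
have A1I : A0 <= A1 <= A1 by rewrite lexx ltW.
rewrite (@continuous_FTC2 _ Fd F A0 A1 A01).
- have FE s : c <= T s -> F s = 0.
    by move=> cs; rewrite /F /p pospart_le0 ?subr_le0//; ring.
  by rewrite !FE// subee.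
- apply: continuous_in_subspaceT => s; rewrite inE /= in_itv/= => sA.
  apply: cvgB; apply: cvgM.
  + exact: is_derive_continuous (dU s sA).
  + apply: cvgB; apply: cvgM.
    * by apply: cvgM; [exact: cvg_cst|exact: cp].
    * by apply: cvgM; exact: is_derive_continuous (dT' s sA).
    * by apply: cvgM; [exact: cvg_cst|exact: is_derive_continuous (dp2 s sA)].
    * exact: cT.
  + exact: is_derive_continuous (dp3 s sA).
  + exact: cU.
- split => [s /inI sA||].
  + by case: (dF s sA).
  + by apply: cvg_at_right_filter; exact: is_derive_continuous (dF _ A0I).
  + by apply: cvg_at_left_filter; exact: is_derive_continuous (dF _ A1I).
- by move=> s /inI sA; rewrite derive1E; case: (dF s sA).
Qed.

End Calculus.

(** * Functions of two variables on boxes *)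

Section PlaneCalculus.
Variable R : realType.
Local Notation plane := (measurableTypeR R * measurableTypeR R)%type.
Local Notation leb := (@lebesgue_measure R).
Local Notation leb2 := (@leb2 R).
Local Notation hmeas := (@hmeas R).
Local Notation H := (@halfplane R).
Implicit Types (u f : R * R -> R) (z w : R * R).

Lemma is_derive_fst u a b : derivable u (a, b) (1, 0) ->
  is_derive a (1 : R) (fun s => u (s, b)) ('D_(1, 0) u (a, b)).
Proof.
move=> du.
have E : (fun h => h^-1 *: ((u \o shift (a, b)) (h *: (1, 0)) - u (a, b))) =
    (fun h : R => h^-1 *: (((fun s => u (s, b)) \o shift a) (h *: (1 : R)) - u (a, b))).
  apply/funext => h /=; congr (_ *: (u _ - _)).
  by rewrite /shift /=; congr pair; rewrite /= ?[h *: 0]mulr0 ?add0r.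
by apply: DeriveDef; rewrite /derivable /derive -E.
Qed.

Lemma is_derive_snd u a b : derivable u (a, b) (0, 1) ->
  is_derive b (1 : R) (fun s => u (a, s)) ('D_(0, 1) u (a, b)).
Proof.
move=> du.
have E : (fun h => h^-1 *: ((u \o shift (a, b)) (h *: (0, 1)) - u (a, b))) =
    (fun h : R => h^-1 *: (((fun s => u (a, s)) \o shift b) (h *: (1 : R)) - u (a, b))).
  apply/funext => h /=; congr (_ *: (u _ - _)).
  by rewrite /shift /=; congr pair; rewrite /= ?[h *: 0]mulr0 ?add0r.
by apply: DeriveDef; rewrite /derivable /derive -E.
Qed.

Definition continuousH f := forall z, H z -> {for z, continuous f}.

Lemma halfplane_ball z : H z -> exists2 d, 0 < d & forall w, ball z d w -> H w.
Proof.
move=> Hz; have /nbhs_ballP[d d0 dH] : nbhs z H.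
  by apply: open_nbhs_nbhs; split => //; exact: open_halfplane.
by exists d.
Qed.

(** The mean value theorem in the first variable, where the derivative is locally
    bounded, and continuity in the second one. *)
Lemma C1_continuous u : C1 u -> continuousH u.
Proof.
move=> cu [a b] Hz; apply/cvgrPdist_lt => e e0.
have [_ dy cx _] := cu _ Hz.
have [d1 d10 d1H] := halfplane_ball Hz.
have [d2 d20 d2M] : exists2 d, 0 < d & forall w, ball (a, b) d w ->
    `|'D_(1, 0) u w| < `|'D_(1, 0) u (a, b)| + 1.
  have : \forall w \near (a, b), `|'D_(1, 0) u w| < `|'D_(1, 0) u (a, b)| + 1.
    have : `|'D_(1, 0) u w| @[w --> (a, b)] --> `|'D_(1, 0) u (a, b)| by apply: cvg_norm; exact: cx.
    by move/(cvgr_lt _); apply; rewrite ltrDl.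
  by move=> /nbhs_ballP[d /= d0 dP]; exists d.
set M := `|_| + 1 in d2M; have M0 : 0 < M by rewrite ltr_wpDl.
have cy : {for b, continuous (fun s => u (a, s))}.
  exact: is_derive_continuous (is_derive_snd dy).
have [d3 d30 d3e] : exists2 d, 0 < d & forall s, ball b d s -> `|u (a, b) - u (a, s)| < e / 2.
  have /cvgrPdist_lt/(_ (e / 2)) : u (a, s) @[s --> b] --> u (a, b) by exact: cy.
  by rewrite divr_gt0// => /(_ isT)/nbhs_ballP[d /= d0 dP]; exists d.
have eM : 0 < e / 2 / M by rewrite !divr_gt0.
pose d := Num.min (Num.min d1 d2) (Num.min d3 (e / 2 / M)).
have d0 : 0 < d by rewrite !lt_min d10 d20 d30.
have : nbhs (a, b) (ball (a, b) d) by exact: nbhsx_ballx.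
apply: filterS => -[a' b'] [/= aa bb].
have [aad1 aad2 aad3 aade] : [/\ `|a - a'| < d1, `|a - a'| < d2, `|a - a'| < d3 & `|a - a'| < e / 2 / M].
  by move: aa; rewrite /ball/= !lt_min => /andP[/andP[-> ->] /andP[-> ->]].
have [bbd1 bbd2 bbd3] : [/\ `|b - b'| < d1, `|b - b'| < d2 & `|b - b'| < d3].
  by move: bb; rewrite /ball/= !lt_min => /andP[/andP[-> ->] /andP[-> _]].
have key (s s' : R) : s <= s' -> (forall r : R, s <= r <= s' -> `|a - r| <= `|a - a'|) ->
    `|u (s', b') - u (s, b')| <= M * (s' - s).
  move=> ss rr.
  have inb (r : R) : s <= r <= s' -> ball (a, b) d1 (r, b') /\ ball (a, b) d2 (r, b').
    move=> /rr h; split; (split; rewrite /ball/=; last by []); exact: le_lt_trans h _.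
  have dr (r : R) : s <= r <= s' -> is_derive r 1 (fun r => u (r, b')) ('D_(1, 0) u (r, b')).
    move=> rs; have [/d1H Hr _] := inb r rs; have [dx _ _ _] := cu _ Hr; exact: is_derive_fst.
  have [||r rs ->] := @MVT_segment _ (fun r => u (r, b')) (fun r => 'D_(1, 0) u (r, b')) _ _ ss.
  - by move=> r; rewrite in_itv/= => /andP[r1 r2]; apply: dr; rewrite !ltW.
  - apply: derivable_within_continuous => r; rewrite in_itv/= => rs.
    by case: (dr r rs).
  rewrite in_itv/= in rs; rewrite normrM (@ger0_norm _ (s' - s)) ?subr_ge0//.
  by rewrite ler_wpM2r ?subr_ge0//; apply/ltW/d2M; case: (inb r rs).
have {key} h1 : `|u (a, b') - u (a', b')| < e / 2.
  apply: (@le_lt_trans _ _ (M * `|a - a'|)); last by rewrite mulrC -ltr_pdivlMr.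
  have [aa'|a'a] := leP a a'.
    rewrite distrC (distrC a a') [X in _ <= _ * X]ger0_norm ?subr_ge0//; apply: key => // r /andP[r1 r2].
    by rewrite ler0_norm ?subr_le0// ler0_norm ?subr_le0//; lra.
  rewrite [X in _ <= _ * X]ger0_norm ?subr_ge0 ?(ltW a'a)//; apply: key => [|r /andP[r1 r2]]; first exact: ltW.
  by rewrite ger0_norm ?subr_ge0// ger0_norm ?subr_ge0//; lra.
have h2 := d3e _ bbd3.
rewrite (_ : u (a, b) - u (a', b') = (u (a, b) - u (a, b')) + (u (a, b') - u (a', b'))); last by ring.
by rewrite (le_lt_trans (ler_normD _ _))//; lra.
Qed.

Lemma continuous_cdist z0 z : z0.2 != 0 -> z.2 != 0 -> {for z, continuous (cdist z0)}.
Proof.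
move=> z00 zz0; rewrite /continuous_at /cdist; apply: cvgD; first exact: cvg_cst.
apply: cvgM.
  apply: cvgD; apply: cvgM; (apply: cvgB; first exact: cvg_cst);
    by [exact: cvg_fst|exact: cvg_snd].
apply: cvgV; first by rewrite !mulf_neq0.
by apply: cvgM; [exact: cvg_cst|exact: cvg_snd].
Qed.

Lemma measurable_continuousH f : continuousH f ->
  measurable_fun (H : set plane) (f : plane -> measurableTypeR R).
Proof. by move=> cf; apply: continuous_measurable_plane => //; exact: open_halfplane. Qed.

Section Box.
Variables (a0 a1 b0 b1 : R).
Hypotheses (b00 : 0 < b0).
Definition cbox : set (R * R) := `[a0, a1]%classic `*` `[b0, b1]%classic.

Lemma cbox_halfplane : cbox `<=` H.
Proof. by move=> z [_ /=]; rewrite in_itv/= => /andP[+ _]; exact: lt_le_trans. Qed.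

Lemma measurable_cbox : measurable (cbox : set plane).
Proof. exact: measurableX. Qed.

Lemma continuousH_bounded f : continuousH f -> exists M, forall z, cbox z -> `|f z| <= M.
Proof.
move=> cf; have cB : compact cbox by apply: compact_setX; exact: segment_compact.
have /compact_bounded[M [_ MP]] : compact (f @` cbox).
  apply: continuous_compact => //; apply: continuous_in_subspaceT => z.
  by rewrite inE => /cbox_halfplane; exact: cf.
by exists (M + 1) => z zB; apply: (MP (M + 1)); [rewrite ltrDl|exists z].
Qed.

Lemma leb2_cbox : (leb2 cbox < +oo)%E.
Proof.
have -> : leb2 cbox = (leb `[a0, a1]%classic * leb `[b0, b1]%classic)%E by exact: product_measure1E.
have fin (x y : R) : (leb `[x, y] < +oo)%E.
  by rewrite lebesgue_measure_itv/=; case: ifP => _; rewrite ?ltry// -EFinD ltry.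
by rewrite lte_mul_pinfty ?fin// ge0_fin_numE ?fin.
Qed.

Lemma continuousH_integrable f (mu : {measure set plane -> \bar R}) :
  (mu cbox < +oo)%E -> continuousH f -> mu.-integrable cbox (EFin \o f).
Proof.
move=> mufin cf; apply: measurable_bounded_integrable => //.
- exact: measurable_cbox.
- apply: measurable_funS (measurable_continuousH cf); first exact: measurable_halfplane.
  exact: cbox_halfplane.
- have [M MP] := continuousH_bounded cf; exists M; split; first exact: num_real.
  by move=> N MN z zB; apply: le_trans (MP z zB) _; exact: ltW.
Qed.

Lemma integral_cbox_fst f : continuousH f ->
  (forall b, b0 <= b <= b1 -> (\int[leb]_(a in `[a0, a1]) (f (a, b))%:E = 0)%E) ->
  (\int[leb2]_(z in cbox) (f z)%:E = 0)%E.
Proof.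
move=> cf f0; have := continuousH_integrable leb2_cbox cf.
rewrite integrable_mkcond; last exact: measurable_cbox.
move=> intf; rewrite integral_mkcond -(@integral21_prod_meas1 _ _ _ _ R leb leb _ intf).
apply: integral0_eq => b _; rewrite /fubini_G.
have [bB|bB] := boolP (b0 <= b <= b1); last first.
  apply: integral0_eq => a _; rewrite patchE memNset// => -[_ /=].
  by rewrite in_itv/= (negbTE bB).
rewrite -[RHS](f0 b bB) [RHS]integral_mkcond; apply: eq_integral => a _.
rewrite !patchE; congr (if _ then _ else _).
by apply/idP/idP; rewrite !inE /cbox /= !in_itv/= ?bB; [case|].
Qed.

Lemma integral_cbox_snd f : continuousH f ->
  (forall a, a0 <= a <= a1 -> (\int[leb]_(b in `[b0, b1]) (f (a, b))%:E = 0)%E) ->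
  (\int[leb2]_(z in cbox) (f z)%:E = 0)%E.
Proof.
move=> cf f0; have := continuousH_integrable leb2_cbox cf.
rewrite integrable_mkcond; last exact: measurable_cbox.
move=> intf; rewrite integral_mkcond -(@integral12_prod_meas1 _ _ _ _ R leb leb _ intf).
apply: integral0_eq => a _; rewrite /fubini_F.
have [aB|aB] := boolP (a0 <= a <= a1); last first.
  apply: integral0_eq => b _; rewrite patchE memNset// => -[/= + _].
  by rewrite in_itv/= (negbTE aB).
rewrite -[RHS](f0 a aB) [RHS]integral_mkcond; apply: eq_integral => b _.
rewrite !patchE; congr (if _ then _ else _).
by apply/idP/idP; rewrite !inE /cbox /= !in_itv/= ?aB; [case|].
Qed.

End Box.
End PlaneCalculus.

(** * The radial differential equation *)

Section RadialODE.
Variable R : realType.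
Variables (V1 V2 V3 : R -> R) (K0 K q : R).
Hypothesis dV3 : forall c : R, is_derive c 1 V3 (3 * V2 c).
Hypothesis dV2 : forall c : R, is_derive c 1 V2 (2 * V1 c).
Hypothesis ode : forall c, 1 < c ->
  6 * (c ^+ 2 - 1) * V1 c - 18 * c * V2 c + K0 * V3 c = 0.
Hypotheses (V21 : V2 1 = 0) (V31 : V3 1 = 0).
Hypotheses (K00 : 0 <= K0) (K0K : K0 <= K) (K_gt0 : 0 < K) (q0 : 0 <= q).

(** [V1], [V2], [V3] stand for the integrals of an eigenfunction against the
    first three powers of [pospart (c - cdist x z)], or for combinations of such
    integrals at the same frequency. The equation becomes
    [P' = - (K0 / 3) V3 / (c ^+ 2 - 1) ^+ 4] for the quotient [P] below, and
    [V3] is an integral of [V2], so that [P] is controlled by its size near the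
    singular point [c = 1]. *)
Definition radial_quot (c : R) : R := V2 c / (c ^+ 2 - 1) ^+ 3.
Local Notation P := radial_quot.

Hypothesis Pq : forall e : R, 0 < e -> exists2 d : R, 0 < d &
  forall c, 1 < c -> c < 1 + d -> `|P c| <= q + e.

Let sqr_gt1 (c : R) : 1 < c -> 0 < c ^+ 2 - 1.
Proof. by move=> c1; rewrite subr_gt0 exprn_egt1. Qed.

Lemma is_derive_radial_quot (c : R) : 1 < c ->
  is_derive c 1 P (- (K0 / 3) * V3 c / (c ^+ 2 - 1) ^+ 4).
Proof.
move=> c1; have cn := lt0r_neq0 (sqr_gt1 c1).
have d1 : is_derive c 1 (fun s : R => s ^+ 2 - 1) (2 * c).
  apply: (@is_derive_quadratic _ _ _ _ 1 1) => // h _.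
  by rewrite mul1r (_ : _ - _ = h ^+ 2) ?ger0_norm ?sqr_ge0//; ring.
have d3 : is_derive c 1 (fun s : R => (s ^+ 2 - 1) ^+ 3) (3 * (c ^+ 2 - 1) ^+ 2 * (2 * c)).
  apply: is_derive_eq (is_derive_mul d1 (is_derive_mul d1 d1)) _; ring.
have dV : is_derive c 1 (fun s : R => ((s ^+ 2 - 1) ^+ 3)^-1)
    (- ((c ^+ 2 - 1) ^+ 3) ^- 2 *: (3 * (c ^+ 2 - 1) ^+ 2 * (2 * c))).
  by apply: is_deriveV; rewrite expf_neq0.
apply: is_derive_eq (is_derive_mul (dV2 c) dV) _.
have E : K0 * V3 c = 18 * c * V2 c - 6 * (c ^+ 2 - 1) * V1 c.
  by have := ode c1; lra.
rewrite (_ : - (K0 / 3) * V3 c = - (K0 * V3 c) / 3); last by field.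
by rewrite E -[_ *: _]/(_ * _); field.
Qed.

Section Step.
Variables (M C : R).
Hypothesis M0 : 0 < M.
Hypothesis PM : forall c, 1 < c -> c <= C -> `|P c| <= M * expR (K * c).

(** [V3] is the integral of [3 V2], and the bound on [P] increases with [c]. *)
Lemma radial_ode_V3 c : 1 < c -> c <= C ->
  `|V3 c| <= 3 * (c - 1) * (c ^+ 2 - 1) ^+ 3 * (M * expR (K * c)).
Proof.
move=> c1 cC.
have [|s] := @MVT_segment _ V3 (fun s => 3 * V2 s) _ _ (ltW c1) (fun s _ => dV3 s).
  by apply: derivable_within_continuous => s _; case: (dV3 s).
rewrite in_itv/= V31 subr0 => /andP[s1 sc] ->.
rewrite normrM (@ger0_norm _ (c - 1)) ?subr_ge0 ?(ltW c1)//.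
rewrite [leRHS](_ : _ = 3 * ((c ^+ 2 - 1) ^+ 3 * (M * expR (K * c))) * (c - 1)); last by ring.
rewrite ler_pM2r ?subr_gt0// normrM ger0_norm// ler_pM2l//.
have e0 : 0 < M * expR (K * c) by rewrite mulr_gt0// expR_gt0.
have [->|s1'] := eqVneq s 1.
  by rewrite V21 normr0 mulr_ge0 ?(ltW e0)// exprn_ge0// ltW// sqr_gt1.
have {}s1 : 1 < s by rewrite lt_neqAle eq_sym s1'.
have s2 := sqr_gt1 s1; have c2 := sqr_gt1 c1.
have -> : V2 s = P s * (s ^+ 2 - 1) ^+ 3.
  by rewrite /radial_quot divfK// expf_neq0// gt_eqF.
rewrite normrM [leRHS]mulrC (@ger0_norm _ ((s ^+ 2 - 1) ^+ 3)) ?exprn_ge0 ?(ltW s2)//.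
apply: ler_pM => //; first by rewrite exprn_ge0// ltW.
  apply: le_trans (PM s1 (le_trans sc cC)) _.
  by rewrite ler_pM2l// ler_expR ler_pM2l.
rewrite ler_pXn2r ?nnegrE ?(ltW s2) ?(ltW c2)// lerD2r ler_sqr ?nnegrE//; lra.
Qed.

(** As [c ^+ 2 - 1 >= 2 (c - 1)], a bound [M expR (K c)] on [P] bounds its
    variation with half the constant; this halving is what can be iterated. *)
Lemma radial_quot_step c' c : 1 < c' -> c' < c -> c <= C ->
  `|P c - P c'| <= M / 2 * (expR (K * c) - expR (K * c')).
Proof.
move=> c'1 c'c cC.
pose g s := M / 2 * expR (K * s).
have dg s : is_derive s (1 : R) g (M / 2 * (K * expR (K * s))).
  apply: is_derive_eq (is_derive_mul (is_derive_cst (M / 2) s 1)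
    (is_derive1_comp (is_derive_expR (K * s)) (is_derive_mul (is_derive_cst K s 1) (is_derive_id s 1)))) _.
  by rewrite /cst /=; ring.
have gn s : 0 < M / 2 * (K * expR (K * s)) by rewrite !mulr_gt0// expR_gt0.
have inI s : s \in `]c', c[ -> c' < s < c by rewrite in_itv.
have [||s sI||s /inI/andP[s1 s2]] := @cauchy_MVT _ P
    (fun s => - (K0 / 3) * V3 s / (s ^+ 2 - 1) ^+ 4) g (fun s => M / 2 * (K * expR (K * s))) c' c c'c.
- apply: derivable_within_continuous => s; rewrite in_itv/= => /andP[s1 _].
  by case: (is_derive_radial_quot (lt_le_trans c'1 s1)).
- by apply: derivable_within_continuous => s _; case: (dg s).
- by move: sI => /inI/andP[s1 _]; apply: is_derive_radial_quot; exact: lt_trans s1.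
- by move=> s _; rewrite gt_eqF.
have {}s1 := lt_trans c'1 s1.
have ss := sqr_gt1 s1.
have gc : 0 < g c - g c'.
  by rewrite subr_gt0 /g ltr_pM2l ?divr_gt0// ltr_expR ltr_pM2l.
have gE : M / 2 * (expR (K * c) - expR (K * c')) = g c - g c' by rewrite /g mulrBr.
rewrite gE.
move=> E.
have -> : P c - P c' = (P c - P c') / (g c - g c') * (g c - g c').
  by rewrite divfK// gt_eqF.
rewrite -E normrM (@gtr0_norm _ (g c - g c'))// ger_pMl//.
rewrite normrM normfV (gtr0_norm (gn s)) ler_pdivrMr// mul1r.
have V3s := radial_ode_V3 s1 (le_trans (ltW s2) cC).
have K3 : `|- (K0 / 3)| = K0 / 3 by rewrite normrN ger0_norm// divr_ge0.
have s4 : 0 < (s ^+ 2 - 1) ^+ 4 by rewrite exprn_gt0.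
rewrite normrM normrM K3 normfV (gtr0_norm s4) ler_pdivrMr//.
apply: le_trans (ler_wpM2l _ V3s) _; first by rewrite divr_ge0.
have e0 : 0 < M * expR (K * s) by rewrite mulr_gt0// expR_gt0.
have -> : K0 / 3 * (3 * (s - 1) * (s ^+ 2 - 1) ^+ 3 * (M * expR (K * s))) =
   (K0 * (s - 1)) * ((s ^+ 2 - 1) ^+ 3 * (M * expR (K * s))) by field.
have -> : M / 2 * (K * expR (K * s)) * (s ^+ 2 - 1) ^+ 4 =
   (K / 2 * (s ^+ 2 - 1)) * ((s ^+ 2 - 1) ^+ 3 * (M * expR (K * s))) by field.
rewrite ler_pM2r; last by rewrite mulr_gt0// exprn_gt0.
have -> : K / 2 * (s ^+ 2 - 1) = K * (s - 1) + K / 2 * (s - 1) ^+ 2 by field.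
have h : 0 <= K / 2 * (s - 1) ^+ 2 by rewrite mulr_ge0 ?sqr_ge0 ?divr_ge0 ?(ltW K_gt0).
rewrite (ler_wpDr h)//.
  by rewrite ler_wpM2r// subr_ge0 ltW.
Qed.

Lemma radial_quot_bound_step c : 1 < c -> c <= C ->
  `|P c| <= (q + M / 2) * expR (K * c).
Proof.
move=> c1 cC; apply/ler_addgt0Pr => e e0.
have [d d0 dP] := Pq e0.
pose c' := Num.min ((1 + c) / 2) (1 + d / 2).
have c'1 : 1 < c' by rewrite lt_min; apply/andP; split; lra.
have c'c : c' < c by rewrite gt_min; apply/orP; left; lra.
have c'd : c' < 1 + d by rewrite gt_min; apply/orP; right; lra.
have h1 := dP _ c'1 c'd; have h2 := radial_quot_step c'1 c'c cC.
have h3 : 1 <= expR (K * c).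
  by rewrite -expR0 ler_expR mulr_ge0 ?(ltW K_gt0)//; lra.
have h4 : q * 1 <= q * expR (K * c) by rewrite ler_wpM2l.
have h5 : 0 <= M / 2 * expR (K * c') by rewrite !mulr_ge0 ?expR_ge0// ltW.
have h6 : `|P c| <= `|P c'| + `|P c - P c'|.
  by apply: le_trans (ler_normD _ _); rewrite addrC subrK.
lra.
Qed.

End Step.

(** Near [c = 1] by [Pq], and by compactness elsewhere. *)
Lemma radial_quot_bounded C : exists2 M, 0 < M & forall c, 1 < c -> c <= C -> `|P c| <= M.
Proof.
have [d d0 dP] := Pq ltr01.
have cP : compact (P @` `[1 + d / 2, C]%classic).
  apply: continuous_compact; last exact: segment_compact.
  apply: derivable_within_continuous => s; rewrite in_itv/= => /andP[s1 _].
  have {}s1 : 1 < s by apply: lt_le_trans s1; lra.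
  by case: (is_derive_radial_quot s1).
have /compact_bounded[N [_ NP]] := cP.
have N1 : 0 <= `|N| + 1 by rewrite addr_ge0.
exists (q + 1 + (`|N| + 1)) => [|c c1 cC]; first by rewrite ltr_wpDr// ltr_wpDl.
have [cd|dc] := ltP c (1 + d).
  by apply: le_trans (dP c c1 cd) _; rewrite lerDl.
apply: (@le_trans _ _ (`|N| + 1)); last by rewrite lerDr addr_ge0.
apply: (NP (`|N| + 1)); first by rewrite ltr_pwDr// ler_norm.
by exists c => //; rewrite /= in_itv/= cC andbT; lra.
Qed.

(** Each step replaces the constant [m] by [q + m / 2], whose fixed point is
    [2 q]. *)
Lemma radial_quot_bound c : 1 < c -> `|P c| <= 2 * q * expR (K * c).
Proof.
move=> c1; have [M M0 MP] := radial_quot_bounded c.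
have step n : forall s, 1 < s -> s <= c -> `|P s| <= (2 * q + M / 2 ^+ n) * expR (K * s).
  elim: n => [|n IH] s s1 sc.
    have h3 : 1 <= expR (K * s).
      by rewrite -expR0 ler_expR mulr_ge0 ?(ltW K_gt0)//; lra.
    apply: le_trans (MP s s1 sc) _; rewrite expr0 divr1.
    have : M * 1 <= M * expR (K * s) by rewrite ler_pM2l.
    have : 0 <= q * expR (K * s) by rewrite mulr_ge0// expR_ge0.
    lra.
  have Mn : 0 < 2 * q + M / 2 ^+ n by rewrite ltr_wpDl ?mulr_ge0// divr_gt0// exprn_gt0.
  have -> : 2 * q + M / 2 ^+ n.+1 = q + (2 * q + M / 2 ^+ n) / 2.
    by rewrite exprS; field; rewrite expf_neq0.
  exact: (radial_quot_bound_step Mn IH s1 sc).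
apply/ler_addgt0Pr => e e0.
have ME : 0 < M * expR (K * c) by rewrite mulr_gt0// expR_gt0.
have [n nE] : exists n : nat, M * expR (K * c) / e <= 2 ^+ n.
  exists (Num.bound (M * expR (K * c) / e)).
  apply/ltW; apply: lt_trans (archi_boundP _) _; first by rewrite divr_ge0// ltW.
  by rewrite -natrX ltr_nat ltn_expl.
apply: le_trans (step n c c1 (lexx _)) _.
rewrite mulrDl lerD2l mulrAC ler_pdivrMr ?exprn_gt0//.
by rewrite [leRHS]mulrC -ler_pdivrMr.
Qed.

Lemma radial_quot_variation c' c : 0 < q -> 1 < c' -> c' < c ->
  `|P c - P c'| <= q * (expR (K * c) - expR (K * c')).
Proof.
move=> q_gt0 c'1 c'c.
have q2 : 0 < 2 * q by rewrite mulr_gt0.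
have := @radial_quot_step (2 * q) c q2 _ c' c c'1 c'c (lexx _).
rewrite (_ : 2 * q / 2 = q); last by field.
by apply => s s1 _; exact: radial_quot_bound.
Qed.

End RadialODE.

(** * Radial moments of a function around a point *)

Section Moments.
Variable R : realType.
Local Notation plane := (measurableTypeR R * measurableTypeR R)%type.
Local Notation leb := (@lebesgue_measure R).
Local Notation leb2 := (@leb2 R).
Local Notation hmeas := (@hmeas R).
Local Notation H := (@halfplane R).
Implicit Types (u f : R * R -> R) (z w : R * R).

(** Its powers are the radial kernels used throughout. They have compact support,
    and each is the derivative of the next in the radius [c], up to a constant. *)
Definition hbump (c : R) z0 z : R := pospart (c - cdist z0 z).

(** A compact box whose interior contains the ball of radius [c], so that
    [hbump c z0] vanishes on its sides. *)
Definition ballbox (c : R) z0 : set (R * R) :=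
  cbox (z0.1 - 2 * (c + 1) * z0.2) (z0.1 + 2 * (c + 1) * z0.2)
    (z0.2 / (2 * (c + 1))) (2 * (c + 1) * z0.2).

Section Centre.
Variable z0 : R * R.
Hypothesis Hz0 : H z0.
Let z00 : 0 < z0.2 := Hz0.

Lemma ball_in_ballbox c z : H z -> cdist z0 z < c ->
  [/\ z0.1 - 2 * (c + 1) * z0.2 < z.1, z.1 < z0.1 + 2 * (c + 1) * z0.2,
      z0.2 / (2 * (c + 1)) < z.2 & z.2 < 2 * (c + 1) * z0.2].
Proof.
move=> Hz zc; have c1 : 1 < c by apply: le_lt_trans zc; exact: cdist_ge1.
have [h1 h2 h3] := cdist_box z00 Hz (ltW zc).
have cc : 2 * c * z0.2 < 2 * (c + 1) * z0.2 by rewrite ltr_pM2r//; lra.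
have c0 : 0 <= 2 * c * z0.2 by rewrite mulr_ge0 ?(ltW z00)//; lra.
have h4 : `|z0.1 - z.1| <= 2 * c * z0.2.
  by rewrite -ler_sqr ?nnegrE// real_normK ?num_real.
move: h4; rewrite ler_norml => /andP[h4 h5].
split; [lra|lra| |exact: le_lt_trans cc].
have Hz' : 0 < z.2 by [].
rewrite ltr_pdivrMr; last lra.
by apply: le_lt_trans h2 _; rewrite mulrC ltr_pM2l//; lra.
Qed.

Lemma ballbox_pos c : 1 <= c -> 0 < z0.2 / (2 * (c + 1)).
Proof. by move=> c1; rewrite divr_gt0//; lra. Qed.

Lemma ballbox_halfplane c : 1 <= c -> ballbox c z0 `<=` H.
Proof. by move=> c1; apply: cbox_halfplane; exact: ballbox_pos. Qed.

Lemma bump_out c c' z : 1 <= c' -> c <= c' -> H z -> ~ ballbox c' z0 z -> hbump c z0 z = 0.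
Proof.
move=> c'1 cc Hz zB; apply: pospart_le0; rewrite subr_le0.
rewrite leNgt; apply/negP => zc; apply: zB.
have [h1 h2 h3 h4] := ball_in_ballbox Hz (lt_le_trans zc cc).
by split; rewrite /= in_itv/= !ltW.
Qed.

Lemma continuousH_bump c : continuousH (hbump c z0).
Proof.
move=> z Hz; rewrite -[hbump c z0]/(@pospart R \o (fun z => c - cdist z0 z)).
apply: continuous_comp.
  apply: cvgB; first exact: cvg_cst.
  by apply: continuous_cdist; rewrite gt_eqF.
exact: continuous_pospart.
Qed.

Lemma continuousH_bumpM c k u : continuousH u -> continuousH (fun z => u z * hbump c z0 z ^+ k).
Proof.
move=> cu z Hz; apply: cvgM; first exact: cu.
by apply: (@continuous_comp _ _ _ (hbump c z0) (fun s => s ^+ k));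
  [exact: continuousH_bump|exact: exprn_continuous].
Qed.

Lemma hmeas_ballbox c : 1 <= c -> (hmeas (ballbox c z0) < +oo)%E.
Proof. by move=> c1; apply: hmeas_box; exact: ballbox_pos. Qed.

Lemma measurable_ballbox c : measurable (ballbox c z0 : set plane).
Proof. exact: measurable_cbox. Qed.

Definition moment u c k : R := \int[hmeas]_(z in H) (u z * hbump c z0 z ^+ k).

Lemma bump_restrict u c c' k : 1 <= c' -> c <= c' -> (0 < k)%N ->
  (fun z => u z * hbump c z0 z ^+ k) \_ H = (fun z => u z * hbump c z0 z ^+ k) \_ (ballbox c' z0).
Proof.
move=> c1 cc k0; apply/funext => z; rewrite !patchE.
have [zB|zB] := pselect (ballbox c' z0 z).
  by rewrite !mem_set//; exact: ballbox_halfplane zB.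
rewrite (memNset zB); case: ifPn => // /[!inE] Hz.
by rewrite (bump_out c1 cc Hz zB) expr0n eqn0Ngt k0 mulr0.
Qed.

Lemma momentE u c c' k : 1 <= c' -> c <= c' -> (0 < k)%N ->
  moment u c k = \int[hmeas]_(z in ballbox c' z0) (u z * hbump c z0 z ^+ k).
Proof.
by move=> c1 cc k0; rewrite /moment Rintegral_mkcond (bump_restrict _ c1 cc k0) -Rintegral_mkcond.
Qed.

Lemma integrable_bump u c c' k : 1 <= c' -> continuousH u ->
  hmeas.-integrable (ballbox c' z0) (EFin \o (fun z => u z * hbump c z0 z ^+ k)).
Proof.
move=> c1 cu; apply: continuousH_integrable.
- exact: ballbox_pos.
- exact: hmeas_ballbox.
- exact: continuousH_bumpM.
Qed.

Lemma integrable_bumpH u c k : continuousH u -> (0 < k)%N ->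
  hmeas.-integrable H (EFin \o (fun z => u z * hbump c z0 z ^+ k)).
Proof.
move=> cu k0; pose c' := Num.max 1 c.
have c1 : 1 <= c' by rewrite le_max lexx.
have cc : c <= c' by rewrite le_max lexx orbT.
apply/integrable_mkcond; first exact: measurable_halfplane.
rewrite (_ : _ \_ H = (EFin \o (fun z => u z * hbump c z0 z ^+ k)) \_ (ballbox c' z0)).
  by apply/(integrable_mkcond _ _).1; [exact: measurable_ballbox|exact: integrable_bump].
by rewrite !restrict_EFin (bump_restrict u c1 cc k0).
Qed.

Lemma Rintegral_ballbox_le f c M : 1 <= c -> continuousH f ->
  (forall z, ballbox c z0 z -> `|f z| <= M) ->
  `|\int[hmeas]_(z in ballbox c z0) f z| <= M * fine (hmeas (ballbox c z0)).
Proof.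
move=> c1 cf fM.
have intf (h : R * R -> R) : continuousH h -> hmeas.-integrable (ballbox c z0) (EFin \o h).
  by move=> ch; apply: continuousH_integrable => //; [exact: ballbox_pos|exact: hmeas_ballbox].
apply: le_trans (le_normr_Rintegral _ (intf _ cf)) _; first exact: measurable_ballbox.
rewrite -Rintegral_cst; last exact: measurable_ballbox.
apply: le_Rintegral => //; first exact: measurable_ballbox.
- by apply: intf => z Hz; apply: cvg_norm; exact: cf.
- by apply: intf => z Hz; exact: cvg_cst.
Qed.

(** Differentiation under the integral sign, by the Taylor expansion of the
    truncated powers. *)
Lemma is_derive_moment u (k : nat) (r : R -> R) :
  continuousH u -> (0 < k)%N ->
  continuous r -> (forall s h, `|h| <= 1 ->
    `|pospart (s + h) ^+ k.+1 - pospart s ^+ k.+1 - h * (k.+1%:R * pospart s ^+ k)| <= r s * h ^+ 2) ->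
  forall c, is_derive c (1 : R) (fun c => moment u c k.+1) (k.+1%:R * moment u c k).
Proof.
move=> cu k0 cr taylor c; pose C := Num.max 1 (c + 1).
have C1 : 1 <= C by rewrite le_max lexx.
have cC : c + 1 <= C by rewrite le_max lexx orbT.
have cf : continuousH (fun z => u z * r (c - cdist z0 z)).
  move=> z Hz; apply: cvgM; first exact: cu.
  rewrite -[fun w => _]/(r \o (fun z => c - cdist z0 z)).
  apply: continuous_comp; last exact: cr.
  apply: cvgB; first exact: cvg_cst.
  by apply: continuous_cdist; rewrite gt_eqF.
have [M MP] : exists M, forall z, ballbox C z0 z -> `|u z * r (c - cdist z0 z)| <= M.
  by apply: continuousH_bounded cf; exact: ballbox_pos.
have mB := measurable_ballbox C.
apply: (@is_derive_quadratic _ _ _ _ (M * fine (hmeas (ballbox C z0))) 1) => // h h1.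
have hh : c + h <= C by have := ler_norm h; lra.
have c'C : c <= C by lra.
rewrite (@momentE u (c + h) C)// (@momentE u c C k.+1)// (@momentE u c C k)//.
rewrite mulrA -RintegralZl//; last exact: integrable_bump.
rewrite -RintegralB//; [|exact: integrable_bump|exact: integrable_bump].
rewrite -RintegralB//; first last.
- have := integrableZl mB (h * k.+1%:R) (integrable_bump c k C1 cu).
  by apply: eq_integrable => // z _; rewrite /= EFinM.
- by have := integrableB mB (integrable_bump (c + h) k.+1 C1 cu) (integrable_bump c k.+1 C1 cu).
rewrite mulrAC; apply: Rintegral_ballbox_le => //.
  move=> z Hz; apply: cvgB; first apply: cvgB; first exact: continuousH_bumpM.
    exact: continuousH_bumpM.
  by apply: cvgM; [exact: cvg_cst|exact: continuousH_bumpM].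
move=> z zB.
have -> : u z * hbump (c + h) z0 z ^+ k.+1 - u z * hbump c z0 z ^+ k.+1 - h * k.+1%:R * (u z * hbump c z0 z ^+ k)
  = u z * (pospart (c - cdist z0 z + h) ^+ k.+1 - pospart (c - cdist z0 z) ^+ k.+1
     - h * (k.+1%:R * pospart (c - cdist z0 z) ^+ k)).
  by rewrite /hbump [c - _ + h]addrAC; ring.
rewrite normrM; apply: le_trans (ler_wpM2l (normr_ge0 _) (taylor _ _ (ltW h1))) _.
rewrite mulrA ler_wpM2r ?sqr_ge0//; apply: le_trans (MP z zB).
by rewrite normrM ler_wpM2l// ler_norm.
Qed.

Lemma is_derive_moment2 u c : continuousH u ->
  is_derive c (1 : R) (fun c => moment u c 2) (2 * moment u c 1).
Proof.
move=> cu; apply: (@is_derive_moment u 1 (fun=> 1)) => //; first by move=> s; exact: cvg_cst.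
by move=> s h _; rewrite mul1r expr1; exact: pospart_sqr_taylor.
Qed.

Lemma is_derive_moment3 u c : continuousH u ->
  is_derive c (1 : R) (fun c => moment u c 3) (3 * moment u c 2).
Proof.
move=> cu; apply: (@is_derive_moment u 2 (fun s => 3 * `|s| + 1)) => //.
  move=> s; apply: cvgD; last exact: cvg_cst.
  by apply: cvgM; [exact: cvg_cst|exact: norm_continuous].
by move=> s h h1; exact: pospart_cube_taylor.
Qed.

Lemma moment1_eq0 u k : (0 < k)%N -> moment u 1 k = 0.
Proof.
move=> k0; rewrite /moment (@eq_Rintegral _ _ _ _ _ (cst 0)).
  by rewrite Rintegral_cst ?mul0r//; exact: measurable_halfplane.
move=> z /[!inE] Hz; rewrite /hbump pospart_le0 ?expr0n ?eqn0Ngt ?k0 ?mulr0//.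
by rewrite subr_le0 cdist_ge1.
Qed.

End Centre.

Lemma continuousH_cst (a : R) : continuousH (fun=> a).
Proof. by move=> z _; exact: cvg_cst. Qed.

Lemma continuousH_add u v : continuousH u -> continuousH v -> continuousH (fun z => u z + v z).
Proof. by move=> cu cv z Hz; apply: cvgD; [exact: cu|exact: cv]. Qed.

Lemma continuousH_sub u v : continuousH u -> continuousH v -> continuousH (fun z => u z - v z).
Proof. by move=> cu cv z Hz; apply: cvgB; [exact: cu|exact: cv]. Qed.

Lemma continuousH_mul u v : continuousH u -> continuousH v -> continuousH (fun z => u z * v z).
Proof. by move=> cu cv z Hz; apply: cvgM; [exact: cu|exact: cv]. Qed.

Lemma continuousH_inv u : (forall z, H z -> u z != 0) -> continuousH u ->
  continuousH (fun z => (u z)^-1).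
Proof. by move=> u0 cu z Hz; apply: cvgV; [exact: u0|exact: cu]. Qed.

Lemma continuousH_exp u k : continuousH u -> continuousH (fun z => u z ^+ k).
Proof.
move=> cu; elim: k => [|k IH]; first exact: continuousH_cst.
by under eq_fun do rewrite exprS; exact: continuousH_mul.
Qed.

Lemma continuousH_fst : continuousH (fst : R * R -> R). Proof. by move=> z _; exact: cvg_fst. Qed.
Lemma continuousH_snd : continuousH (snd : R * R -> R). Proof. by move=> z _; exact: cvg_snd. Qed.

Lemma continuousH_cdist z0 : H z0 -> continuousH (cdist z0).
Proof. by move=> Hz0 z Hz; apply: continuous_cdist; rewrite gt_eqF. Qed.

Lemma halfplane_neq0 z : H z -> z.2 != 0. Proof. by move=> Hz; rewrite gt_eqF. Qed.

End Moments.

(** * Green's identity for the moments of an eigenfunction *)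

Section Green.
Variable R : realType.
Local Notation plane := (measurableTypeR R * measurableTypeR R)%type.
Local Notation leb2 := (@leb2 R).
Local Notation hmeas := (@hmeas R).
Local Notation H := (@halfplane R).
Implicit Types (u f : R * R -> R) (z w : R * R).

Lemma continuous_pairl (b : R) : continuous (fun s : R => (s, b)).
Proof.
move=> s; apply: (@cvg_pair _ _ _ _ (nbhs s) (nbhs b) _ _ _ (fun s : R => s) (fun=> b)).
  exact: cvg_id.
exact: cvg_cst.
Qed.

Lemma continuous_pairr (a : R) : continuous (fun s : R => (a, s)).
Proof.
move=> s; apply: (@cvg_pair _ _ _ _ (nbhs a) (nbhs s) _ _ _ (fun=> a) (fun s : R => s)).
  exact: cvg_cst.
exact: cvg_id.
Qed.

Section Partials.
Variable z0 : R * R.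
Hypothesis Hz0 : H z0.
Let z00 : z0.2 != 0. Proof. exact: halfplane_neq0. Qed.

(** The first and second partial derivatives of [cdist z0]. *)
Definition cdx z := (z.1 - z0.1) / (z0.2 * z.2).
Definition cdxx z := (z0.2 * z.2)^-1.
Definition cdy z := z0.2^-1 - cdist z0 z / z.2.
Definition cdyy z := - (z0.2 * z.2)^-1 + 2 * cdist z0 z / z.2 ^+ 2.

Lemma is_derive_cdist_fst (a b : R) : 0 < b ->
  is_derive a (1 : R) (fun s => cdist z0 (s, b)) (cdx (a, b)).
Proof.
move=> b0; apply: (@is_derive_quadratic _ _ _ _ `|(2 * z0.2 * b)^-1| 1) => // h _.
rewrite -[h ^+ 2]ger0_norm ?sqr_ge0// -normrM le_eqVlt; apply/orP; left; apply/eqP.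
by congr `|_|; rewrite /cdx /cdist /=; field; rewrite z00 gt_eqF.
Qed.

Lemma is_derive_cdx (a b : R) : 0 < b ->
  is_derive a (1 : R) (fun s => cdx (s, b)) (cdxx (a, b)).
Proof.
move=> b0; apply: (@is_derive_quadratic _ _ _ _ 0 1) => // h _.
rewrite mul0r normr_le0; apply/eqP; rewrite /cdx /cdxx /=; field.
by rewrite z00 gt_eqF.
Qed.

Lemma is_derive_cdist_snd (a b : R) : 0 < b ->
  is_derive b (1 : R) (fun s => cdist z0 (a, s)) (cdy (a, b)).
Proof.
move=> b0; have bn : b != 0 by rewrite gt_eqF.
have dN : is_derive b (1 : R) (fun s => (z0.1 - a) ^+ 2 + (z0.2 - s) ^+ 2) (- 2 * (z0.2 - b)).
  apply: (@is_derive_quadratic _ _ _ _ 1 1) => // h _.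
  by rewrite mul1r [X in `|X| <= _](_ : _ = h ^+ 2) ?ger0_norm ?sqr_ge0//; ring.
have dD : is_derive b (1 : R) (fun s => 2 * z0.2 * s) (2 * z0.2).
  apply: (@is_derive_quadratic _ _ _ _ 0 1) => // h _.
  by rewrite mul0r normr_le0; apply/eqP; ring.
have D0 : 2 * z0.2 * b != 0 by rewrite !mulf_neq0.
have d := is_derive_add (is_derive_cst (1 : R) b 1) (is_derive_mul dN (is_deriveV D0 dD)).
rewrite (_ : (fun s => cdist z0 (a, s)) =
  fun s => cst 1 s + ((z0.1 - a) ^+ 2 + (z0.2 - s) ^+ 2) * (2 * z0.2 * s)^-1)//.
apply: is_derive_eq d _.
rewrite -[_ *: _]/(_ * _) /cdy /cdist /=; field.
by rewrite z00 bn.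
Qed.

Lemma is_derive_cdy (a b : R) : 0 < b ->
  is_derive b (1 : R) (fun s => cdy (a, s)) (cdyy (a, b)).
Proof.
move=> b0; have bn : b != 0 by rewrite gt_eqF.
apply: is_derive_eq (is_derive_sub (is_derive_cst z0.2^-1 b 1)
  (is_derive_mul (is_derive_cdist_snd a b0) (is_deriveV bn (is_derive_id b 1)))) _.
rewrite -[_ *: _]/(_ * _) /cdyy /cdy /=; field.
by rewrite z00 bn.
Qed.

Lemma continuousH_cdx : continuousH cdx.
Proof.
apply: continuousH_mul; first by apply: continuousH_sub; [exact: continuousH_fst|exact: continuousH_cst].
apply: continuousH_inv; first by move=> z Hz; rewrite mulf_neq0// halfplane_neq0.
by apply: continuousH_mul; [exact: continuousH_cst|exact: continuousH_snd].
Qed.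

Lemma continuousH_cdxx : continuousH cdxx.
Proof.
apply: continuousH_inv; first by move=> z Hz; rewrite mulf_neq0// halfplane_neq0.
by apply: continuousH_mul; [exact: continuousH_cst|exact: continuousH_snd].
Qed.

Lemma continuousH_cdy : continuousH cdy.
Proof.
apply: continuousH_sub; first exact: continuousH_cst.
apply: continuousH_mul; first exact: continuousH_cdist.
by apply: continuousH_inv; [exact: halfplane_neq0|exact: continuousH_snd].
Qed.

Lemma continuousH_cdyy : continuousH cdyy.
Proof.
apply: continuousH_add.
  by move=> z Hz; apply: cvgN; exact: continuousH_cdxx.
apply: continuousH_mul; first by apply: continuousH_mul; [exact: continuousH_cst|exact: continuousH_cdist].
apply: continuousH_inv; first by move=> z Hz; rewrite expf_neq0// halfplane_neq0.
by apply: continuousH_exp; exact: continuousH_snd.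
Qed.

(** For [t] the hyperbolic cosine of the distance to a point, the hyperbolic
    metric gives [|grad t|^2 = t^2 - 1], and [Delta t = 2 t] in the next lemma. *)
Lemma cdist_gradient z : H z -> z.2 ^+ 2 * (cdx z ^+ 2 + cdy z ^+ 2) = cdist z0 z ^+ 2 - 1.
Proof. by move=> /halfplane_neq0 zn; rewrite /cdx /cdy /cdist; field; rewrite z00 zn. Qed.

Lemma cdist_laplacian z : H z -> z.2 ^+ 2 * (cdxx z + cdyy z) = 2 * cdist z0 z.
Proof. by move=> /halfplane_neq0 zn; rewrite /cdxx /cdyy; field; rewrite z00 zn. Qed.

(** The integrand is [u Delta (p^3) - p^3 Delta u] for [p = hbump c z0], expanded
    with the gradient and the Laplacian of [cdist z0] and with
    [p * cdist z0 = c p - p^2]. Its two halves, second derivatives in one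
    coordinate, are integrated by [green_segment] along the lines of the box. *)
Lemma green_bump u (la c : R) : C2 u ->
  (forall z, H z -> hlaplacian u z = - la ^+ 2 * u z) -> 1 <= c ->
  \int[hmeas]_(z in ballbox c z0)
    (6 * (c ^+ 2 - 1) * (u z * hbump c z0 z ^+ 1) - 18 * c * (u z * hbump c z0 z ^+ 2)
     + (12 + la ^+ 2) * (u z * hbump c z0 z ^+ 3)) = 0.
Proof.
move=> [cu cux cuy] hu c1.
have cuu := C1_continuous cu.
pose ux := 'D_(1, 0) u; pose uy := 'D_(0, 1) u.
pose uxx := 'D_(1, 0) ux; pose uyy := 'D_(0, 1) uy.
have cuxx : continuousH uxx by move=> z Hz; have [_ _ h _] := cux z Hz; exact: h.
have cuyy : continuousH uyy by move=> z Hz; have [_ _ _ h] := cuy z Hz; exact: h.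
pose p := hbump c z0.
have cp k : continuousH (fun z => p z ^+ k) by apply: continuousH_exp; exact: continuousH_bump.
pose gx z := u z * (6 * p z * cdx z ^+ 2 - 3 * p z ^+ 2 * cdxx z) - p z ^+ 3 * uxx z.
pose gy z := u z * (6 * p z * cdy z ^+ 2 - 3 * p z ^+ 2 * cdyy z) - p z ^+ 3 * uyy z.
have cgx : continuousH gx.
  apply: continuousH_sub; apply: continuousH_mul => //.
  apply: continuousH_sub; apply: continuousH_mul.
  - by apply: continuousH_mul; [exact: continuousH_cst|exact: continuousH_bump].
  - by apply: continuousH_exp; exact: continuousH_cdx.
  - by apply: continuousH_mul; [exact: continuousH_cst|exact: cp].
  - exact: continuousH_cdxx.
have cgy : continuousH gy.
  apply: continuousH_sub; apply: continuousH_mul => //.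
  apply: continuousH_sub; apply: continuousH_mul.
  - by apply: continuousH_mul; [exact: continuousH_cst|exact: continuousH_bump].
  - by apply: continuousH_exp; exact: continuousH_cdy.
  - by apply: continuousH_mul; [exact: continuousH_cst|exact: cp].
  - exact: continuousH_cdyy.
have Bpos := ballbox_pos Hz0 c1.
have z02 : 0 < z0.2 by [].
set A0 := z0.1 - 2 * (c + 1) * z0.2; set A1 := z0.1 + 2 * (c + 1) * z0.2.
set B0 := z0.2 / (2 * (c + 1)) in Bpos; set B1 := 2 * (c + 1) * z0.2.
have r0 : 0 < 2 * (c + 1) * z0.2 by rewrite !mulr_gt0//; lra.
have A01 : A0 < A1 by rewrite /A0 /A1; lra.
have B01 : B0 < B1.
  rewrite /B0 /B1 ltr_pdivrMr; last lra.
  rewrite mulrAC -[ltLHS]mul1r ltr_pM2r//.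
  have : 2 * 2 <= (2 * (c + 1)) * (2 * (c + 1)) by apply: ler_pM => //; lra.
  lra.
have outx z : H z -> z.1 = A0 \/ z.1 = A1 -> c <= cdist z0 z.
  move=> Hz zA; rewrite leNgt; apply/negP => /(ball_in_ballbox Hz0 Hz)[].
  by rewrite -/A0 -/A1; case: zA => ->; rewrite ltxx.
have outy z : H z -> z.2 = B0 \/ z.2 = B1 -> c <= cdist z0 z.
  move=> Hz zB; rewrite leNgt; apply/negP => /(ball_in_ballbox Hz0 Hz)[_ _].
  by rewrite -/B0 -/B1; case: zB => ->; rewrite ltxx.
have Ix : (\int[leb2]_(z in ballbox c z0) (gx z)%:E = 0)%E.
  apply: integral_cbox_fst => //.
  move=> b /andP[bB _]; have b0 : 0 < b by exact: lt_le_trans bB.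
  have Hb s : H (s, b) by [].
  have d1 (s : R) : A0 <= s <= A1 -> is_derive s (1 : R) (fun s => u (s, b)) (ux (s, b)).
    by move=> _; apply: is_derive_fst; have [h _ _ _] := cu _ (Hb s); exact: h.
  have d2 (s : R) : A0 <= s <= A1 -> is_derive s (1 : R) (fun s => ux (s, b)) (uxx (s, b)).
    by move=> _; apply: is_derive_fst; have [h _ _ _] := cux _ (Hb s); exact: h.
  have d3 (s : R) : A0 <= s <= A1 -> is_derive s (1 : R) (fun s => cdist z0 (s, b)) (cdx (s, b)).
    by move=> _; exact: is_derive_cdist_fst.
  have d4 (s : R) : A0 <= s <= A1 -> is_derive s (1 : R) (fun s => cdx (s, b)) (cdxx (s, b)).
    by move=> _; exact: is_derive_cdx.
  have d5 (s : R) : A0 <= s <= A1 -> {for s, continuous (fun s => uxx (s, b))}.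
    move=> _; apply: (@continuous_comp _ _ _ (fun s : R => (s, b)) uxx); last exact: cuxx (Hb s).
    exact: continuous_pairl.
  have d6 (s : R) : A0 <= s <= A1 -> {for s, continuous (fun s => cdxx (s, b))}.
    by move=> _; exact: (@cst_continuous _ _ ((z0.2 * b)^-1) s).
  have o0 : c <= cdist z0 (A0, b) by apply: outx => //; left.
  have o1 : c <= cdist z0 (A1, b) by apply: outx => //; right.
  rewrite -[RHS](green_segment A01 d1 d2 d3 d4 d5 d6 o0 o1).
  by apply: eq_integral => s _.
have Iy : (\int[leb2]_(z in ballbox c z0) (gy z)%:E = 0)%E.
  apply: integral_cbox_snd => //.
  move=> a _.
  have Hb s : B0 <= s <= B1 -> H (a, s) by move=> /andP[+ _]; exact: lt_le_trans.
  have B0I : B0 <= B0 <= B1 by rewrite lexx ltW.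
  have B1I : B0 <= B1 <= B1 by rewrite lexx ltW.
  have d1 (s : R) : B0 <= s <= B1 -> is_derive s (1 : R) (fun s => u (a, s)) (uy (a, s)).
    by move=> sB; apply: is_derive_snd; have [_ h _ _] := cu _ (Hb s sB); exact: h.
  have d2 (s : R) : B0 <= s <= B1 -> is_derive s (1 : R) (fun s => uy (a, s)) (uyy (a, s)).
    by move=> sB; apply: is_derive_snd; have [_ h _ _] := cuy _ (Hb s sB); exact: h.
  have d3 (s : R) : B0 <= s <= B1 -> is_derive s (1 : R) (fun s => cdist z0 (a, s)) (cdy (a, s)).
    by move=> sB; apply: is_derive_cdist_snd; exact: Hb sB.
  have d4 (s : R) : B0 <= s <= B1 -> is_derive s (1 : R) (fun s => cdy (a, s)) (cdyy (a, s)).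
    by move=> sB; apply: is_derive_cdy; exact: Hb sB.
  have d5 (s : R) : B0 <= s <= B1 -> {for s, continuous (fun s => uyy (a, s))}.
    move=> sB; apply: (@continuous_comp _ _ _ (fun s : R => (a, s)) uyy); last exact: cuyy (Hb s sB).
    exact: continuous_pairr.
  have d6 (s : R) : B0 <= s <= B1 -> {for s, continuous (fun s => cdyy (a, s))}.
    move=> sB; apply: (@continuous_comp _ _ _ (fun s : R => (a, s)) cdyy); last exact: continuousH_cdyy (Hb s sB).
    exact: continuous_pairr.
  have o0 : c <= cdist z0 (a, B0) by apply: outy; [exact: Hb|left].
  have o1 : c <= cdist z0 (a, B1) by apply: outy; [exact: Hb|right].
  rewrite -[RHS](green_segment B01 d1 d2 d3 d4 d5 d6 o0 o1).
  by apply: eq_integral => s _.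
have mB := measurable_ballbox z0 c.
have intg f : continuousH f -> leb2.-integrable (ballbox c z0) (EFin \o f).
  by move=> cf; apply: continuousH_integrable => //; exact: leb2_cbox.
rewrite /Rintegral integral_hmeas//; last first.
  apply/measurable_EFinP; apply: measurable_funS (measurable_continuousH _).
  - exact: measurable_halfplane.
  - exact: ballbox_halfplane.
  - by apply: continuousH_add; [apply: continuousH_sub|];
      (apply: continuousH_mul; [exact: continuousH_cst|exact: continuousH_bumpM]).
transitivity (fine (\int[leb2]_(z in ballbox c z0) ((gx z)%:E + (gy z)%:E)))%E.
  congr fine; apply: eq_integral => z /[!inE] zB; have Hz := ballbox_halfplane Hz0 c1 zB.
  rewrite -EFinM -EFinD; congr _%:E.
  have zn := halfplane_neq0 Hz.
  have e1 := cdist_gradient Hz; have e2 := cdist_laplacian Hz.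
  have e3 : z.2 ^+ 2 * (uxx z + uyy z) = - la ^+ 2 * u z by exact: hu.
  have e4 : p z * cdist z0 z = c * p z - p z ^+ 2.
    by rewrite -(pospart_mul (c - cdist z0 z)) -/(hbump c z0 z) -/p; ring.
  have -> : gx z + gy z = (u z * (6 * p z * (z.2 ^+ 2 * (cdx z ^+ 2 + cdy z ^+ 2))
     - 3 * p z ^+ 2 * (z.2 ^+ 2 * (cdxx z + cdyy z))) - p z ^+ 3 * (z.2 ^+ 2 * (uxx z + uyy z)))
     / z.2 ^+ 2 by rewrite /gx /gy; field.
  rewrite e1 e2 e3 /hden (_ : 0 < z.2 = true); last exact: Hz.
  congr (_ / _); rewrite -/p.
  have -> : 6 * p z * (cdist z0 z ^+ 2 - 1) - 3 * p z ^+ 2 * (2 * cdist z0 z) =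
     6 * (p z * cdist z0 z) * cdist z0 z - 6 * p z - 6 * p z * (p z * cdist z0 z) by ring.
  rewrite e4.
  have -> : 6 * (c * p z - p z ^+ 2) * cdist z0 z = 6 * (c - p z) * (p z * cdist z0 z) by ring.
  by rewrite e4; ring.
rewrite integralD//; [|exact: intg|exact: intg].
exact: (congr1 fine (etrans (congr2 adde Ix Iy) (adde0 0%E))).
Qed.

(** As the moments are successive derivatives of one another in the radius, this
    is a linear differential equation, with a singular point at [c = 1]. *)
Lemma moment_relation u (la c : R) : C2 u ->
  (forall z, H z -> hlaplacian u z = - la ^+ 2 * u z) -> 1 <= c ->
  6 * (c ^+ 2 - 1) * moment z0 u c 1 - 18 * c * moment z0 u c 2
   + (12 + la ^+ 2) * moment z0 u c 3 = 0.
Proof.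
move=> c2u hu c1; have cu : continuousH u by apply: C1_continuous; case: c2u.
have mB := measurable_ballbox z0 c.
rewrite -[RHS](green_bump c2u hu c1) !(@momentE _ _ Hz0 u c c)//.
have intM k a : hmeas.-integrable (ballbox c z0) (EFin \o (fun z => a * (u z * hbump c z0 z ^+ k))).
  have := integrableZl mB a (integrable_bump Hz0 c k c1 cu).
  by apply: eq_integrable => // z _; rewrite /= EFinM.
rewrite RintegralD//; last first.
  have := integrableB mB (intM 1%N (6 * (c ^+ 2 - 1))) (intM 2%N (18 * c)).
  by apply: eq_integrable => // z _.
by rewrite RintegralB// !RintegralZl//; exact: integrable_bump.
Qed.

End Partials.
End Green.

(** * Radial kernels act on eigenfunctions by scalars *)

Section Local.
Variable R : realType.
Local Notation plane := (measurableTypeR R * measurableTypeR R)%type.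
Local Notation hmeas := (@hmeas R).
Local Notation H := (@halfplane R).
Local Notation ipt := (@ipt R).
Implicit Types (u v : R * R -> R) (x y z : R * R).

(** The normalisation of the second moments: they are compared with their value
    for the constant function 1, which is the same around all points. *)
Definition bump_mass (c : R) : R := moment ipt (fun=> 1) c 2.

Lemma measurable_pospart_pow (c : R) k :
  measurable_fun setT ((fun t => (pospart (c - t) ^+ k)%:E) : measurableTypeR R -> \bar R).
Proof.
apply/measurable_EFinP; apply: continuous_measurable_fun => t.
apply: (@continuous_comp _ _ _ (fun t => pospart (c - t)) (fun s => s ^+ k)); last exact: exprn_continuous.
apply: (@continuous_comp _ _ _ (fun t => c - t) (@pospart R)); last exact: continuous_pospart.
by apply: cvgB; [exact: cvg_cst|exact: cvg_id].
Qed.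

Lemma moment_radial x c k : H x -> moment x (fun=> 1) c k = moment ipt (fun=> 1) c k.
Proof.
move=> Hx; rewrite /moment /Rintegral; congr fine.
under eq_integral do rewrite mul1r; under [in RHS]eq_integral do rewrite mul1r.
apply: (ge0_integral_radial Hx (measurable_pospart_pow c k)) => t.
by rewrite lee_fin exprn_ge0 ?pospart_ge0.
Qed.

Lemma integral_hball_cst (a e : R) : 0 <= a ->
  (\int[hmeas]_(z in H) (a * \1_(hball ipt e) z)%:E = a%:E * hmeas (hball ipt e))%E.
Proof.
move=> a0; have mB := @measurable_hball R ipt e; have mH := @measurable_halfplane R.
under eq_integral do rewrite EFinM.
rewrite ge0_integralZl//; last by apply/measurable_EFinP; exact: measurable_indic.
by rewrite integral_indic// (_ : _ `&` _ = hball ipt e)//; apply/setIidl => z [].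
Qed.

(** [hbump c] is at most [c - 1], and at least half of it on the ball
    [hball ipt ((c - 1) / 2)]. *)
Lemma mass_bounds (c : R) : 1 < c -> c <= 2 ->
  (c - 1) ^+ 3 / 16 <= bump_mass c <= 512 * (c - 1) ^+ 3.
Proof.
move=> c1 c2; have mH := @measurable_halfplane R.
pose I := (\int[hmeas]_(z in H) (pospart (c - cdist ipt z) ^+ 2)%:E)%E.
have EI : bump_mass c = fine I.
  by rewrite /bump_mass /moment /Rintegral; congr fine; apply: eq_integral => z _; rewrite mul1r.
have mp : measurable_fun (H : set plane) (fun z : plane => (pospart (c - cdist ipt z) ^+ 2)%:E).
  apply: (measurableT_comp (f := fun t : measurableTypeR R => (pospart (c - t) ^+ 2)%:E)).
    exact: measurable_pospart_pow.
  exact: measurable_cdistr.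
have mi (a e : R) : measurable_fun (H : set plane) (fun z : plane => (a * \1_(hball ipt e) z)%:E).
  apply/measurable_EFinP/measurable_funM; first exact: measurable_cst.
  by apply: measurable_indic; exact: measurable_hball.
have up : (I <= (512 * (c - 1) ^+ 3)%:E)%E.
  have h : (I <= ((c - 1) ^+ 2)%:E * hmeas (hball ipt (c - 1)))%E.
    rewrite -integral_hball_cst ?sqr_ge0//; apply: ge0_le_integral => //.
    - by move=> z _; rewrite lee_fin sqr_ge0.
    - move=> z Hz; rewrite lee_fin indicE.
      have [zB|zB] := boolP (z \in hball ipt (c - 1)).
        rewrite mulr1 lerXn2r ?nnegrE ?pospart_ge0 ?subr_ge0 ?(ltW c1)//.
        have h1 := @cdist_ge1 R ipt z ltr01 Hz.
        by rewrite ge_max subr_ge0 (ltW c1) andbT lerB.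
      rewrite mulr0 pospart_le0 ?expr0n//.
      move/negP: zB; rewrite inE => zB; rewrite subr_le0 leNgt; apply/negP => zc; apply: zB.
      by split => //; rewrite addrC subrK ltW.
  apply: le_trans h _; have [||_ h] := andP (@hball_area R (c - 1) _ _); [lra|lra|].
  rewrite (_ : 512 * (c - 1) ^+ 3 = (c - 1) ^+ 2 * (512 * (c - 1))); last by ring.
  by rewrite (EFinM ((c - 1) ^+ 2)); apply: lee_wpmul2l => //; rewrite lee_fin sqr_ge0.
have e0 : 0 < (c - 1) / 2 by lra.
have lo : (((c - 1) ^+ 3 / 16)%:E <= I)%E.
  have h : ((((c - 1) / 2) ^+ 2)%:E * hmeas (hball ipt ((c - 1) / 2)) <= I)%E.
    rewrite -integral_hball_cst ?sqr_ge0//; apply: ge0_le_integral => //.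
    - by move=> z _; rewrite lee_fin mulr_ge0// sqr_ge0.
    - move=> z Hz; rewrite lee_fin indicE.
      have [zB|zB] := boolP (z \in hball ipt ((c - 1) / 2)); last by rewrite mulr0 sqr_ge0.
      move: zB; rewrite inE => -[_ zB].
      rewrite mulr1 lerXn2r ?nnegrE ?pospart_ge0 ?(ltW e0)//.
      by apply: le_trans (pospart_ge _); lra.
  apply: le_trans h; have [||h _] := andP (@hball_area R ((c - 1) / 2) _ _); [lra|lra|].
  rewrite (_ : (c - 1) ^+ 3 / 16 = ((c - 1) / 2) ^+ 2 * ((c - 1) / 2 / 2)); last by field.
  by rewrite (EFinM (((c - 1) / 2) ^+ 2)); apply: lee_wpmul2l => //; rewrite lee_fin sqr_ge0.
have Ifin : I \is a fin_num.
  rewrite ge0_fin_numE; first exact: le_lt_trans up (ltry _).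
  by apply: integral_ge0 => z _; rewrite lee_fin sqr_ge0.
by rewrite EI -!lee_fin fineK// lo up.
Qed.

(** Small balls see only the value of a continuous function at their centre. *)
Lemma moment_near u x (e : R) : continuousH u -> H x -> 0 < e -> exists2 d, 0 < d &
  forall c, 1 < c -> c < 1 + d -> `|moment x u c 2 - u x * bump_mass c| <= e * bump_mass c.
Proof.
move=> cu Hx e0; have x20 : 0 < x.2 := Hx.
have := cu x Hx; move=> /cvgrPdist_le /(_ _ e0) /nbhs_ballP[r /= r0 rP].
pose s := r / x.2; have s0 : 0 < s by rewrite divr_gt0.
pose d := Num.min 1 (s ^+ 2 / 16).
exists d; first by rewrite lt_min ltr01 divr_gt0// exprn_gt0.
move=> c c1; rewrite /d -ltrBlDl lt_min => /andP[cd1 cds].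
have cu1 : continuousH (fun=> 1 : R) by move=> z _; exact: cvg_cst.
have mH := @measurable_halfplane R.
have k2 : (0 < 2)%N by [].
have i1 := integrable_bumpH Hx c cu k2.
have i2 := integrable_bumpH Hx c cu1 k2.
have iZ a : hmeas.-integrable H (EFin \o (fun z => a * (1 * hbump c x z ^+ 2))).
  by have := integrableZl mH a i2; apply: eq_integrable => // z _; rewrite /= EFinM.
rewrite /bump_mass -(moment_radial c 2 Hx) /moment -!RintegralZl// -RintegralB//.
apply: le_trans (le_normr_Rintegral mH _) _.
  by have := integrableB mH i1 (iZ (u x)); apply: eq_integrable.
apply: le_Rintegral => //.
  by have := integrable_norm (integrableB mH i1 (iZ (u x))).
move=> z Hz; rewrite !mul1r -mulrBl normrM (ger0_norm (sqr_ge0 (hbump c x z))).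
have [zc|zc] := leP c (cdist x z).
  by rewrite /hbump pospart_le0 ?subr_le0// expr0n !mulr0.
rewrite ler_wpM2r ?sqr_ge0// distrC; apply: rP.
have h := @cdist_near R (c - 1) x z x20 Hz (ltW cd1) _.
have {}h : (x.1 - z.1) ^+ 2 + (x.2 - z.2) ^+ 2 <= 8 * (c - 1) * x.2 ^+ 2 by apply: h; lra.
have rE : r ^+ 2 = s ^+ 2 * x.2 ^+ 2 by rewrite -exprMn /s divfK// gt_eqF.
have h2 : 8 * (c - 1) * x.2 ^+ 2 < r ^+ 2.
  rewrite rE ltr_pM2r ?exprn_gt0//.
  have : 0 < s ^+ 2 by rewrite exprn_gt0.
  lra.
have sq1 := sqr_ge0 (x.1 - z.1); have sq2 := sqr_ge0 (x.2 - z.2).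
have lt_norm (t : R) : t ^+ 2 < r ^+ 2 -> `|t| < r.
  by move=> tr; rewrite -ltr_sqr ?nnegrE ?(ltW r0)// real_normK ?num_real.
split; rewrite /ball /=; apply: lt_norm; lra.
Qed.

Definition eigenH (la : R) u : Prop :=
  C2 u /\ forall z, H z -> hlaplacian u z = - la ^+ 2 * u z.

Lemma eigenH_continuous la u : eigenH la u -> continuousH u.
Proof. by move=> [[cu _ _] _]; exact: C1_continuous. Qed.

Lemma sqr_sub1_ge (c : R) : 1 < c -> 0 < (c - 1) ^+ 3 /\ 8 * (c - 1) ^+ 3 <= (c ^+ 2 - 1) ^+ 3.
Proof.
move=> c1; have h : 0 < (c - 1) ^+ 3 by rewrite exprn_gt0//; lra.
split => //; rewrite (_ : c ^+ 2 - 1 = (c - 1) * (c + 1)); last by ring.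
rewrite exprMn mulrC ler_pM2l// (_ : 8 = 2 ^+ 3); last by ring.
by rewrite lerXn2r ?nnegrE//; lra.
Qed.

(** The constants 64 here and 32 * 27 in [moment_quot_lower] come from
    [mass_bounds] and from [8 (c - 1)^3 <= (c^2 - 1)^3 <= 27 (c - 1)^3]
    for [1 < c <= 2]. *)
Lemma moment_quot_near u x (e : R) : continuousH u -> H x -> 0 < e -> exists2 d, 0 < d &
  forall c, 1 < c -> c < 1 + d ->
    `|moment x u c 2 / (c ^+ 2 - 1) ^+ 3| <= 64 * `|u x| + e.
Proof.
move=> cu Hx e0; have e1 : 0 < e / 64 by rewrite divr_gt0.
have [d d0 dP] := moment_near cu Hx e1; exists (Num.min 1 d); first by rewrite lt_min ltr01.
move=> c c1; rewrite -ltrBlDl lt_min => /andP[cd1 cds].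
have {}dP : `|moment x u c 2 - u x * bump_mass c| <= e / 64 * bump_mass c by apply: dP => //; lra.
have c2 : c <= 2 by lra.
have /andP[m1 m2] := mass_bounds c1 c2.
have [q0 q8] := sqr_sub1_ge c1.
have mass0 : 0 <= bump_mass c by apply: le_trans m1; rewrite divr_ge0// ltW.
have Q0 : 0 < (c ^+ 2 - 1) ^+ 3 by lra.
rewrite normrM normfV (gtr0_norm Q0) ler_pdivrMr//.
have h1 : `|moment x u c 2| <= (`|u x| + e / 64) * bump_mass c.
  have := ler_normD (moment x u c 2 - u x * bump_mass c) (u x * bump_mass c).
  rewrite subrK normrM (ger0_norm mass0) => h; apply: le_trans h _; lra.
apply: le_trans h1 _.
have h2 : bump_mass c <= 64 * (c ^+ 2 - 1) ^+ 3 by lra.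
rewrite (_ : 64 * `|u x| + e = (`|u x| + e / 64) * 64); last by field.
rewrite -mulrA ler_wpM2l// addr_ge0//; lra.
Qed.

(** The difference of the two sides satisfies the radial equation and is
    negligible at small radii, hence vanishes. *)
Lemma moment_unique (la c : R) u v x y : eigenH la u -> eigenH la v -> H x -> H y -> 1 < c ->
  moment x u c 2 * v y = moment y v c 2 * u x.
Proof.
move=> eu ev Hx Hy c1.
have cu := eigenH_continuous eu; have cv := eigenH_continuous ev.
pose V k c := moment x u c k * v y - moment y v c k * u x.
have dV (k : nat) (a : R) : (forall c : R, is_derive c (1 : R) (fun c => moment x u c k.+1) (a * moment x u c k)) ->
    (forall c : R, is_derive c (1 : R) (fun c => moment y v c k.+1) (a * moment y v c k)) ->
    forall c : R, is_derive c (1 : R) (V k.+1) (a * V k c).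
  move=> h1 h2 s; have := is_derive_sub (is_derive_mul (h1 s) (is_derive_cst (v y) s 1))
    (is_derive_mul (h2 s) (is_derive_cst (u x) s 1)).
  by move=> h; apply: is_derive_eq h _; rewrite /V /cst; ring.
have d3 (s : R) : is_derive s (1 : R) (V 3) (3 * V 2 s).
  by apply: dV => t; apply: is_derive_moment3.
have d2 (s : R) : is_derive s (1 : R) (V 2) (2 * V 1%N s).
  by apply: dV => t; apply: is_derive_moment2.
have ode (s : R) : 1 < s -> 6 * (s ^+ 2 - 1) * V 1%N s - 18 * s * V 2 s + (12 + la ^+ 2) * V 3 s = 0.
  move=> s1; have := moment_relation Hx eu.1 eu.2 (ltW s1).
  have := moment_relation Hy ev.1 ev.2 (ltW s1); rewrite /V => h1 h2.
  transitivity (0 * v y - 0 * u x); last by ring.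
  by rewrite -{1}h2 -h1; ring.
have V1 k : (0 < k)%N -> V k 1 = 0 by move=> k0; rewrite /V !moment1_eq0// !mul0r subr0.
have K0 : 0 < 12 + la ^+ 2 by rewrite ltr_wpDr// sqr_ge0.
have Pq (e : R) : 0 < e -> exists2 d : R, 0 < d &
    forall c, 1 < c -> c < 1 + d -> `|radial_quot (V 2) c| <= 0 + e.
  move=> e0; pose N := `|v y| + `|u x| + 1.
  have N0 : 0 < N by rewrite ltr_wpDl// addr_ge0.
  have e1 : 0 < e / (64 * N) by rewrite divr_gt0// mulr_gt0.
  have [d dd dP] := moment_near cu Hx e1; have [d' dd' dP'] := moment_near cv Hy e1.
  exists (Num.min 1 (Num.min d d')); first by rewrite !lt_min ltr01 dd.
  move=> s s1; rewrite -ltrBlDl !lt_min => /and3P[sd1 sd2 sd3].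
  have {}dP : `|moment x u s 2 - u x * bump_mass s| <= e / (64 * N) * bump_mass s by apply: dP => //; lra.
  have {}dP' : `|moment y v s 2 - v y * bump_mass s| <= e / (64 * N) * bump_mass s by apply: dP' => //; lra.
  have s2 : s <= 2 by lra.
  have /andP[m1 m2] := mass_bounds s1 s2.
  have [q0 q8] := sqr_sub1_ge s1.
  have Q0 : 0 < (s ^+ 2 - 1) ^+ 3 by lra.
  rewrite /radial_quot normrM normfV (gtr0_norm Q0) ler_pdivrMr// add0r.
  have -> : V 2 s = (moment x u s 2 - u x * bump_mass s) * v y - (moment y v s 2 - v y * bump_mass s) * u x.
    by rewrite /V; ring.
  apply: le_trans (ler_normB _ _) _; rewrite !normrM.
  have a1 := ler_wpM2r (normr_ge0 (v y)) dP; have a2 := ler_wpM2r (normr_ge0 (u x)) dP'.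
  have mass0 : 0 < bump_mass s by apply: lt_le_trans m1; rewrite divr_gt0.
  have a3 : e / (64 * N) * bump_mass s * (`|v y| + `|u x|) <= e / (64 * N) * bump_mass s * N.
    by apply: ler_wpM2l; [rewrite mulr_ge0// ltW|rewrite /N lerDl].
  have a4 : e / (64 * N) * bump_mass s * N = e / 64 * bump_mass s by field; rewrite gt_eqF.
  have a5 : e * bump_mass s <= e * (64 * (s ^+ 2 - 1) ^+ 3) by rewrite ler_pM2l//; lra.
  lra.
have k2 : (0 < 2)%N by []. have k3 : (0 < 3)%N by [].
have := @radial_quot_bound R (V 1%N) (V 2) (V 3) (12 + la ^+ 2) (12 + la ^+ 2) 0 d3 d2 ode
  (V1 2%N k2) (V1 3%N k3) (ltW K0) (lexx _) K0 (lexx _) Pq c c1.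
rewrite mulr0 mul0r normr_le0 /radial_quot mulf_eq0 invr_eq0 expf_eq0/= => /orP[|].
  by rewrite subr_eq0 => /eqP.
by rewrite gt_eqF// subr_gt0 exprn_egt1.
Qed.

(** By [moment_unique] the ratio of the moment to the value at the centre depends
    on the frequency only: radial kernels act on eigenfunctions by scalars. *)
Lemma moment_multiplier (c : R) : 1 < c -> exists h : R -> R, forall la u x,
  eigenH la u -> H x -> moment x u c 2 = h la * u x.
Proof.
move=> c1.
suff h la : exists a, forall u x, eigenH la u -> H x -> moment x u c 2 = a * u x.
  by exists (fun la => projT1 (cid (h la))) => la; exact: (projT2 (cid (h la))).
have [[[u x] [eu Hx ux]]|no] := pselect (exists p : (R * R -> R) * (R * R), [/\ eigenH la p.1, H p.2 & p.1 p.2 != 0]).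
  exists (moment x u c 2 / u x) => v y ev Hy /=.
  have := moment_unique eu ev Hx Hy c1; rewrite /= in ux *.
  by move=> h; rewrite mulrAC h mulfK.
exists 0 => u x eu Hx; rewrite mul0r.
have u0 z : H z -> u z = 0.
  by move=> Hz; apply/eqP/negPn/negP => uz; apply: no; exists (u, z).
rewrite /moment (@eq_Rintegral _ _ _ _ _ (cst 0)).
  by rewrite Rintegral_cst ?mul0r//; exact: measurable_halfplane.
by move=> z /[!inE] Hz; rewrite u0 ?mul0r.
Qed.

Lemma moment_quot_lower u x : continuousH u -> H x -> exists2 d, 0 < d &
  forall c, 1 < c -> c < 1 + d -> c <= 2 ->
    `|u x| <= 32 * 27 * `|moment x u c 2 / (c ^+ 2 - 1) ^+ 3|.
Proof.
move=> cu Hx; have [->|ux] := eqVneq (u x) 0.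
  by exists 1 => // c _ _ _; rewrite normr0 mulr_ge0 ?mulr_ge0.
have ux0 : 0 < `|u x| by rewrite normr_gt0.
have e0 : 0 < `|u x| / 2 by rewrite divr_gt0.
have [d d0 dP] := moment_near cu Hx e0; exists d => // c c1 cd c2.
have h1 := dP c c1 cd; have /andP[m1 _] := mass_bounds c1 c2.
have [q0 q8] := sqr_sub1_ge c1.
have Q0 : 0 < (c ^+ 2 - 1) ^+ 3 by apply: lt_le_trans q8; rewrite mulr_gt0.
have mass0 : 0 < bump_mass c by apply: lt_le_trans m1; rewrite divr_gt0.
have h2 : `|u x| / 2 * bump_mass c <= `|moment x u c 2|.
  have := ler_normB (moment x u c 2) (moment x u c 2 - u x * bump_mass c).
  rewrite subKr normrM (gtr0_norm mass0) => h; clear -h h1; lra.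
have h3 : (c ^+ 2 - 1) ^+ 3 <= 27 * (c - 1) ^+ 3.
  rewrite (_ : c ^+ 2 - 1 = (c - 1) * (c + 1)); last by ring.
  rewrite exprMn mulrC ler_pM2r// (_ : 27 = 3 ^+ 3); last by ring.
  by rewrite lerXn2r ?nnegrE//; clear -c1 c2; lra.
have h4 : (c ^+ 2 - 1) ^+ 3 <= 27 * 16 * bump_mass c by clear -m1 h3; lra.
rewrite normrM normfV (gtr0_norm Q0) mulrA ler_pdivlMr//.
apply: le_trans (ler_wpM2l (ltW ux0) h4) _; clear -h2; lra.
Qed.

(** At small radii the normalised moment is close to a positive multiple of
    [u x], and it varies slowly, at a rate that is uniform over the frequencies
    up to [l]. *)
Lemma moment_lower_bound (l : R) : exists c : R, 1 < c /\ exists2 k, 0 < k &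
  forall la u x, `|la| <= l -> eigenH la u -> H x -> k * `|u x| <= `|moment x u c 2|.
Proof.
pose K := 12 + l ^+ 2; have K0 : 0 < K by rewrite ltr_wpDr// sqr_ge0.
(* 2 k is the constant of moment_quot_lower; the radius is chosen such that the
   variation of the normalised moment up to c is at most half of this bound. *)
pose k : R := (32 * 54)^-1.
have k0 : 0 < k by rewrite invr_gt0 mulr_gt0.
have kE : k * (32 * 54) = 1 by rewrite mulVf// mulf_neq0.
have [c c1 cK] : exists2 c : R, 1 < c & 64 * (expR (K * c) - expR K) <= k.
  have : {for 1, continuous (fun c : R => expR (K * c))}.
    apply: (@continuous_comp _ _ _ (fun c : R => K * c) (@expR R)); last exact: continuous_expR.
    by apply: cvgM; [exact: cvg_cst|exact: cvg_id].
  have p0 : 0 < k / 64 by rewrite divr_gt0.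
  move=> /cvgrPdist_le /(_ _ p0) /nbhs_ballP[r /= r0 rP].
  exists (1 + r / 2); first by rewrite ltrDl divr_gt0.
  have := rP (1 + r / 2); rewrite mulr1 distrC => h.
  have {}h : `|expR (K * (1 + r / 2)) - expR K| <= k / 64.
    by apply: h; rewrite /ball /= opprD addNKr normrN gtr0_norm//; lra.
  have {}h := le_trans (ler_norm _) h; clear -h; lra.
have Q0 : 0 < (c ^+ 2 - 1) ^+ 3 by rewrite exprn_gt0// subr_gt0 exprn_egt1.
exists c; split => //; exists (k * (c ^+ 2 - 1) ^+ 3); first by rewrite mulr_gt0.
move=> la u x lal eu Hx; have cu := eigenH_continuous eu.
have [->|ux] := eqVneq (u x) 0; first by rewrite normr0 mulr0.
have ux0 : 0 < `|u x| by rewrite normr_gt0.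
have KK : 12 + la ^+ 2 <= K.
  rewrite /K lerD2l -[la ^+ 2]real_normK ?num_real// lerXn2r ?nnegrE//.
  exact: le_trans lal.
have K00 : 0 <= 12 + la ^+ 2 by rewrite addr_ge0// sqr_ge0.
have q0 : 0 < 64 * `|u x| by rewrite mulr_gt0.
have k2 : (0 < 2)%N by [].
have k3 : (0 < 3)%N by [].
pose P := radial_quot (fun c => moment x u c 2).
have var := @radial_quot_variation R (moment x u ^~ 1%N) (moment x u ^~ 2) (moment x u ^~ 3)
  (12 + la ^+ 2) K (64 * `|u x|)
  (fun s => is_derive_moment3 Hx s cu) (fun s => is_derive_moment2 Hx s cu)
  (fun s s1 => moment_relation Hx eu.1 eu.2 (ltW s1)) (moment1_eq0 Hx u k2) (moment1_eq0 Hx u k3)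
  K00 KK K0 (ltW q0) (fun e e0 => moment_quot_near cu Hx e0).
have [d d0 dP] := moment_quot_lower cu Hx.
have [s [s1 sc sd s2]] : exists s : R, [/\ 1 < s, s < c, s < 1 + d & s <= 2].
  exists (1 + Num.min (Num.min ((c - 1) / 2) (d / 2)) 1).
  have m0 : 0 < Num.min (Num.min ((c - 1) / 2) (d / 2)) 1.
    by rewrite !lt_min ltr01 !divr_gt0// subr_gt0.
  have m1 : Num.min (Num.min ((c - 1) / 2) (d / 2)) 1 <= (c - 1) / 2 by rewrite !ge_min lexx.
  have m2 : Num.min (Num.min ((c - 1) / 2) (d / 2)) 1 <= d / 2 by rewrite !ge_min lexx orbT.
  have m3 : Num.min (Num.min ((c - 1) / 2) (d / 2)) 1 <= 1 by rewrite ge_min lexx orbT.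
  by clear -m0 m1 m2 m3 c1 d0; split; lra.
have h4 : 2 * k * `|u x| <= `|P s|.
  have kk2 : 0 <= 2 * k by rewrite mulr_ge0// ltW.
  apply: le_trans (ler_wpM2l kk2 (dP s s1 sd s2)) _; rewrite -/(P s).
  rewrite (_ : 2 * k * _ = k * (32 * 54) * `|P s|); last by ring.
  by rewrite kE mul1r.
have h5 := var s c q0 s1 sc.
have h6 : expR K <= expR (K * s) by rewrite ler_expR ler_peMr// ltW.
have h7 : 64 * `|u x| * (expR (K * c) - expR (K * s)) <= k * `|u x|.
  rewrite mulrAC ler_pM2r//; clear -h6 cK; lra.
have h8 : k * `|u x| <= `|P c|.
  have := ler_normB (P c) (P c - P s); rewrite subKr => h.
  have {}h5 : `|P c - P s| <= 64 * `|u x| * (expR (K * c) - expR (K * s)) by exact: h5.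
  clear -h h4 h5 h7; lra.
move: h8; rewrite /P /radial_quot normrM normfV (gtr0_norm Q0) ler_pdivlMr//.
by rewrite mulrAC.
Qed.

End Local.

(** * Sums of nonnegative families *)

Section Esum.
Variables (R : realType) (T : choiceType).
Implicit Types (S A : set T) (a : T -> \bar R).

Lemma esum_mull S a (c : R) : 0 <= c -> (forall i, 0 <= a i)%E ->
  (\esum_(i in S) (c%:E * a i) = c%:E * \esum_(i in S) a i)%E.
Proof.
have le (b : T -> \bar R) (k : R) : 0 <= k -> (forall i, 0 <= b i)%E ->
    (\esum_(i in S) (k%:E * b i) <= k%:E * \esum_(i in S) b i)%E.
  move=> k0 b0; apply: ub_ereal_sup => _ [X [Xfin XS] <-].
  rewrite -ge0_mule_fsumr//.
  apply: lee_wpmul2l; first by rewrite lee_fin.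
  by apply: ereal_sup_ubound; exists X.
rewrite le_eqVlt => /predU1P[<-|c0] a0.
  by rewrite mul0e esum1// => i _; rewrite mul0e.
apply/eqP; rewrite eq_le le ?(ltW c0)//=.
have -> : (\esum_(i in S) a i = \esum_(i in S) (c^-1%:E * (c%:E * a i)))%E.
  by apply: eq_esum => i _; rewrite muleA -EFinM mulVf ?gt_eqF// mul1e.
apply: (@le_trans _ _ (c%:E * (c^-1%:E * \esum_(i in S) (c%:E * a i)))%E).
  apply: lee_wpmul2l; first by rewrite lee_fin ltW.
  apply: le; first by rewrite invr_ge0 ltW.
  by move=> i; rewrite mule_ge0// lee_fin ltW.
by rewrite muleA -EFinM mulfV ?gt_eqF// mul1e.
Qed.

Lemma esum_support S A a : (forall i, S i -> 0 <= a i)%E ->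
  (forall i, S i -> ~ A i -> a i = 0%E) ->
  (\esum_(i in S) a i = \esum_(i in S `&` A) a i)%E.
Proof.
move=> a0 a1; rewrite (@esumID _ _ A)// [X in (_ + X)%E]esum1 ?adde0//.
by move=> i [/a1]; exact.
Qed.

Lemma esum_finite_lty S a : finite_set S ->
  (forall i, S i -> 0 <= a i < +oo)%E -> (\esum_(i in S) a i < +oo)%E.
Proof.
move=> fS aS; rewrite esum_fset//; last by move=> i /[!inE] /aS/andP[].
rewrite fsbig_finite//= big_seq; apply: lte_sum_pinfty => i.
by rewrite in_fset_set// inE => /aS/andP[].
Qed.

End Esum.

(** * Periodized radial kernels *)

Section Periodic.
Variables (R : realType) (G : deck_group R).
Local Notation plane := (measurableTypeR R * measurableTypeR R)%type.
Local Notation hmeas := (@hmeas R).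
Local Notation H := (@halfplane R).
Local Notation D := (@dirichlet R G).
Implicit Types (x z w : R * R) (phi psi : R -> R).

Definition profile phi (C : R) : Prop :=
  [/\ continuous phi, forall t, 0 <= phi t & forall t, C <= t -> phi t = 0].

(** The sum over the deck group of the translates of the radial kernel around
    [x]: it is the lift of a function on the surface. *)
Definition periodized phi x z : \bar R := (\esum_(g in deck G) (phi (cdist x (act g z)))%:E)%E.

Lemma profile_add phi psi C C' : profile phi C -> profile psi C' ->
  profile (fun t => phi t + psi t) (Num.max C C').
Proof.
move=> [c1 p1 s1] [c2 p2 s2]; split => [t|t|t].
- by apply: cvgD; [exact: c1|exact: c2].
- by rewrite addr_ge0.
- by rewrite ge_max => /andP[h1 h2]; rewrite s1// s2// addr0.
Qed.

Lemma measurable_radial phi C x g : profile phi C -> deck G g ->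
  measurable_fun setT (fun z : plane => (phi (cdist x (act g z)))%:E).
Proof.
move=> [c _ _] Gg; apply/measurable_EFinP.
apply: (measurableT_comp (f := (phi : measurableTypeR R -> measurableTypeR R))).
  exact: continuous_measurable_fun.
by apply: measurable_cdist; [exact: measurable_cst|exact: measurable_deck Gg].
Qed.

Lemma measurable_radial_id phi C x : profile phi C ->
  measurable_fun setT (fun z : plane => (phi (cdist x z))%:E).
Proof.
move=> [c _ _]; apply/measurable_EFinP.
apply: (measurableT_comp (f := (phi : measurableTypeR R -> measurableTypeR R))).
  exact: continuous_measurable_fun.
exact: measurable_cdistr.
Qed.

Lemma periodic_ge0 phi C x z : profile phi C -> (0 <= periodized phi x z)%E.
Proof. by move=> [_ p _]; apply: esum_ge0 => g _; rewrite lee_fin. Qed.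

Lemma periodic_lty phi C x z : profile phi C -> H x -> H z -> (periodized phi x z < +oo)%E.
Proof.
move=> [_ p s] /halfplane_val[x' <-] /halfplane_val[z' <-].
rewrite /periodized (@esum_support _ _ _ [set g | cdist (val x') (val (g z')) <= C]).
- apply: esum_finite_lty => [|g _]; last by rewrite lee_fin p ltry.
  exact: (deck_locally_finite G x' z' C).
- by move=> g _; rewrite lee_fin.
- move=> g _ /= gC; rewrite act_val s//; apply: ltW.
  by rewrite ltNge; apply/negP.
Qed.

Lemma periodic_fin phi C x z : profile phi C -> H x -> H z -> periodized phi x z \is a fin_num.
Proof.
by move=> p Hx Hz; rewrite ge0_fin_numE ?(periodic_ge0 _ _ p)// (periodic_lty p).
Qed.

Lemma periodic_add phi psi C C' x z : profile phi C -> profile psi C' ->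
  periodized (fun t => phi t + psi t) x z = (periodized phi x z + periodized psi x z)%E.
Proof.
move=> [_ p1 _] [_ p2 _]; rewrite -esumD; last 2 first.
- by move=> g _; rewrite lee_fin.
- by move=> g _; rewrite lee_fin.
by apply: eq_esum => g _; rewrite EFinD.
Qed.

Lemma deck_comp_bij h : deck G h -> set_bij (deck G) (deck G) (fun g => g \o h).
Proof.
move=> Gh; have [k Gk [hk kh]] := deck_inv Gh; split => [g Gg|g g' _ _ E|g Gg].
- exact: deck_comp.
- by apply/funext => z; rewrite -(kh z); exact: (congr1 (fun f => f (k z)) E).
- exists (g \o k); first exact: deck_comp.
  by apply/funext => z /=; rewrite hk.
Qed.

Lemma act_comp g h z : act g (act h z) = act (g \o h) z.
Proof.
have [/halfplane_val[w <-]|Hz] := pselect (H z); first by rewrite !act_val.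
by rewrite !act_out.
Qed.

Lemma periodic_act phi x h z : deck G h -> periodized phi x (act h z) = periodized phi x z.
Proof.
move=> Gh; rewrite /periodized [RHS](reindex_esum _ _ _ _ (deck_comp_bij Gh)).
by apply: eq_esum => g _; rewrite act_comp.
Qed.

Lemma measurable_periodic phi C x : profile phi C ->
  measurable_fun setT (periodized phi x : plane -> \bar R).
Proof.
move=> p; have [B [e eB]] := deck_enum G.
apply: (measurable_fun_esum eB) => //.
  by move=> g Gg; exact: measurable_radial p Gg.
by move=> g z; rewrite lee_fin; case: p.
Qed.

Lemma dirichlet_halfplane z : D z -> H z.
Proof. by rewrite dirichletP => -[]. Qed.

(** Unfolding: against an invariant function the periodized kernel integrates over
    the fundamental domain as the radial kernel does over the plane. *)
Lemma integral_periodic phi C x (F : plane -> \bar R) : profile phi C ->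
  measurable_fun setT F -> (forall z, 0 <= F z)%E ->
  (forall z, D z -> F z \is a fin_num) ->
  (forall g z, deck G g -> H z -> F (act g z) = F z) ->
  (\int[hmeas]_(z in D) (periodized phi x z * F z) =
   \int[hmeas]_(z in H) ((phi (cdist x z))%:E * F z))%E.
Proof.
move=> p mF F0 Ffin Fact.
rewrite -(@integral_unfold R G (fun z => (phi (cdist x z))%:E * F z)%E); last 2 first.
- by apply: emeasurable_funM => //; exact: measurable_radial_id p.
- by move=> z; rewrite mule_ge0// lee_fin; case: p.
apply: eq_integral => z /[!inE] zD; have Hz := dirichlet_halfplane zD.
rewrite -(fineK (Ffin z zD)) muleC -esum_mull; last 2 first.
- exact: fine_ge0.
- by move=> g; rewrite lee_fin; case: p.
by apply: eq_esum => g Gg; rewrite Fact// muleC fineK// Ffin.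
Qed.

(** Positive and negative parts of an invariant function are invariant. *)
Lemma integral_periodic_signed phi C x (u : R * R -> R) : profile phi C -> H x ->
  measurable_fun setT (u : plane -> measurableTypeR R) ->
  (forall g z, deck G g -> H z -> u (act g z) = u z) ->
  (\int[hmeas]_(z in D) (fine (periodized phi x z) * u z)%:E =
   \int[hmeas]_(z in H) (u z * phi (cdist x z))%:E)%E.
Proof.
move=> p Hx mu uact; rewrite integralE [RHS]integralE.
have part (f : R -> R) : measurable_fun setT (f : measurableTypeR R -> measurableTypeR R) ->
   (forall t, 0 <= f t) ->
   (\int[hmeas]_(z in D) (fine (periodized phi x z) * f (u z))%:E =
    \int[hmeas]_(z in H) (f (u z) * phi (cdist x z))%:E)%E.
  move=> mf f0.
  transitivity (\int[hmeas]_(z in D) (periodized phi x z * (f (u z))%:E))%E.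
    apply: eq_integral => z /[!inE] /dirichlet_halfplane Hz.
    by rewrite EFinM fineK// (periodic_fin p).
  rewrite (integral_periodic (F := fun z => (f (u z))%:E) x p)//.
  - by apply: eq_integral => z _; rewrite mulrC EFinM.
  - apply/measurable_EFinP; exact: (measurableT_comp mf mu).
  - by move=> z; rewrite lee_fin.
  - by move=> g z Gg Hz; rewrite uact.
have per0 z : 0 <= fine (periodized phi x z) by apply/fine_ge0/(periodic_ge0 _ _ p).
have phi0 t : 0 <= phi t by case: p.
congr (_ - _)%E.
  transitivity (\int[hmeas]_(z in D) (fine (periodized phi x z) * Num.max (u z) 0)%:E)%E.
    by apply: eq_integral => z _; rewrite funeposE -EFin_max maxr_pMr// mulr0.
  rewrite (part (fun t => Num.max t 0)).
  - by apply: eq_integral => z _; rewrite funeposE -EFin_max maxr_pMl// mul0r.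
  - by apply: measurable_maxr.
  - by move=> t; rewrite le_max lexx orbT.
transitivity (\int[hmeas]_(z in D) (fine (periodized phi x z) * Num.max (- u z) 0)%:E)%E.
  by apply: eq_integral => z _; rewrite funenegE -EFinN -EFin_max maxr_pMr// mulr0 mulrN.
rewrite (part (fun t => Num.max (- t) 0)).
- by apply: eq_integral => z _; rewrite funenegE -EFinN -EFin_max maxr_pMl// mul0r mulNr.
- by apply: measurable_maxr; [exact: measurable_funN|exact: measurable_cst].
- by move=> t; rewrite le_max lexx orbT.
Qed.

(** Unfolding the product of two periodized kernels around [x] leaves one such
    integral for each translate of [x]. *)
Definition overlap phi psi x g : \bar R :=
  (\int[hmeas]_(z in H) (phi (cdist x z) * psi (cdist (act g x) z))%:E)%E.

Lemma overlap_ge0 phi psi C C' x g : profile phi C -> profile psi C' -> (0 <= overlap phi psi x g)%E.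
Proof. by move=> [_ p _] [_ q _]; apply: integral_ge0 => z _; rewrite lee_fin mulr_ge0. Qed.

Lemma integral_periodic2 phi psi C C' x : profile phi C -> profile psi C' -> H x ->
  (\int[hmeas]_(z in D) (periodized phi x z * periodized psi x z) =
   \esum_(g in deck G) overlap phi psi x g)%E.
Proof.
move=> p q Hx; have mH := @measurable_halfplane R.
rewrite (integral_periodic x p); first last.
- by move=> g z Gg _; exact: periodic_act.
- by move=> z /dirichlet_halfplane; exact: (periodic_fin q).
- by move=> z; exact: (periodic_ge0 _ _ q).
- exact: measurable_periodic q.
have [B [e eB]] := deck_enum G.
have phi0 t : 0 <= phi t by case: p.
have psi0 t : 0 <= psi t by case: q.
have mphi := measurable_radial_id x p.
transitivity (\int[hmeas]_(z in H)
    (\esum_(g in deck G) (phi (cdist x z) * psi (cdist x (act g z)))%:E))%E.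
  apply: eq_integral => z _; rewrite /periodized -esum_mull//; last by move=> g; rewrite lee_fin.
rewrite (integral_esum eB)//; last 2 first.
- move=> g Gg; apply: (measurable_funS measurableT) => //.
  under eq_fun do rewrite EFinM.
  by apply: emeasurable_funM => //; exact: measurable_radial q Gg.
- by move=> g z; rewrite lee_fin mulr_ge0.
rewrite [LHS]esum_deck_inverse; apply: eq_esum => g Gg.
apply: eq_integral => z /[!inE] Hz; congr (_ * psi _)%:E.
by rewrite -(cdist_deck_inverse Gg Hx Hz).
Qed.

(** A crude triangle inequality, to bound the distance between the centres of two
    overlapping kernels. *)
Lemma cdist_triangle (C : R) x z w : H x -> H z -> H w -> cdist x z <= C -> cdist w z <= C ->
  cdist x w <= 1 + 8 * C * (C - 1).
Proof.
move=> Hx Hz Hw xz wz.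
have x0 : 0 < x.2 := Hx. have z0 : 0 < z.2 := Hz. have w0 : 0 < w.2 := Hw.
have [h1 h2 _] := cdist_box x0 z0 xz; have [h3 h4 _] := cdist_box w0 z0 wz.
have C1 : 1 <= C by apply: le_trans xz; exact: cdist_ge1.
have e1 : (x.1 - z.1) ^+ 2 + (x.2 - z.2) ^+ 2 = 2 * (cdist x z - 1) * (x.2 * z.2).
  by rewrite /cdist; field; rewrite !gt_eqF.
have e2 : (w.1 - z.1) ^+ 2 + (w.2 - z.2) ^+ 2 = 2 * (cdist w z - 1) * (w.2 * z.2).
  by rewrite /cdist; field; rewrite !gt_eqF.
have par (a b c : R) : (a - c) ^+ 2 <= 2 * (a - b) ^+ 2 + 2 * (c - b) ^+ 2.
  have := sqr_ge0 ((a - b) + (c - b)); lra.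
have p1 := par x.1 z.1 w.1; have p2 := par x.2 z.2 w.2.
have xw : 0 < x.2 * w.2 by rewrite mulr_gt0.
rewrite /cdist lerD2l ler_pdivrMr; last by rewrite !mulr_gt0.
have b1 : 2 * (cdist x z - 1) * (x.2 * z.2) <= 2 * (C - 1) * (x.2 * (2 * C * w.2)).
  apply: ler_pM => //.
  - by rewrite mulr_ge0// subr_ge0 cdist_ge1.
  - by rewrite mulr_ge0// ltW.
  - by rewrite ler_pM2l// lerB.
  - by rewrite ler_pM2l.
have b2 : 2 * (cdist w z - 1) * (w.2 * z.2) <= 2 * (C - 1) * (w.2 * (2 * C * x.2)).
  apply: ler_pM => //.
  - by rewrite mulr_ge0// subr_ge0 cdist_ge1.
  - by rewrite mulr_ge0// ltW.
  - by rewrite ler_pM2l// lerB.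
  - by rewrite ler_pM2l.
have -> : 8 * C * (C - 1) * (2 * x.2 * w.2) =
  2 * (2 * (C - 1) * (x.2 * (2 * C * w.2))) + 2 * (2 * (C - 1) * (w.2 * (2 * C * x.2))) by ring.
lra.
Qed.

(** Finitely many translates contribute, each the integral of a continuous
    function over a compact box. *)
Lemma overlap_lty phi psi C C' x : profile phi C -> profile psi C' -> H x ->
  (\esum_(g in deck G) overlap phi psi x g < +oo)%E.
Proof.
move=> p q Hx; have mH := @measurable_halfplane R.
have [cp p0 ps] := p; have [cq q0 qs] := q.
have [x' xx'] := halfplane_val Hx.
pose M := Num.max 1 (Num.max C C').
have M1 : 1 <= M by rewrite le_max lexx.
have CM : C <= M by rewrite !le_max lexx orbT.
have C'M : C' <= M by rewrite !le_max lexx !orbT.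
rewrite (@esum_support _ _ _ [set g | cdist (val x') (val (g x')) <= 1 + 8 * M * (M - 1)]).
- apply: esum_finite_lty => [|g [Gg _]].
    exact: (deck_locally_finite G x' x' (1 + 8 * M * (M - 1))).
  rewrite (overlap_ge0 _ _ p q)//=.
  have Hg : H (act g x) by exact: act_halfplane.
  have c1 : continuousH (fun z => phi (cdist x z) * psi (cdist (act g x) z)).
    apply: continuousH_mul => z Hz.
      apply: (@continuous_comp _ _ _ (cdist x) phi); last exact: cp.
      exact: continuousH_cdist.
    apply: (@continuous_comp _ _ _ (cdist (act g x)) psi); last exact: cq.
    exact: continuousH_cdist.
  have iB : hmeas.-integrable (ballbox M x)
      (EFin \o (fun z => phi (cdist x z) * psi (cdist (act g x) z))).
    apply: continuousH_integrable => //; first exact: ballbox_pos.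
    exact: hmeas_ballbox.
  have -> : overlap phi psi x g =
      (\int[hmeas]_(z in ballbox M x) (phi (cdist x z) * psi (cdist (act g x) z))%:E)%E.
    rewrite /overlap integral_mkcond [RHS]integral_mkcond; congr integral.
    apply/funext => z; rewrite !patchE.
    have [zB|zB] := pselect (ballbox M x z).
      by rewrite !mem_set//; exact: ballbox_halfplane zB.
    rewrite (memNset zB); case: ifPn => // /[!inE] Hz.
    rewrite ps ?mul0r//; apply: le_trans CM _; rewrite leNgt; apply/negP => zM; apply: zB.
    by have [h1 h2 h3 h4] := ball_in_ballbox Hx Hz zM; split; rewrite /= in_itv/= !ltW.
  have := integrable_lty (measurable_ballbox x M) iB.
  exact.
- by move=> g _; exact: (overlap_ge0 _ _ p q).
- move=> g Gg /= gM; apply: integral0_eq => z Hz.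
  have Hg : H (act g x) by exact: act_halfplane.
  have [zC|zC] := leP C (cdist x z); first by rewrite ps// mul0r.
  have [zC'|zC'] := leP C' (cdist (act g x) z); first by rewrite qs// mulr0.
  exfalso; apply: gM; rewrite -[val (g x')]act_val xx'; have -> : sval x' = x := xx'.
  apply: (@cdist_triangle M x z (act g x)) => //; apply: ltW.
    exact: lt_le_trans CM.
  exact: lt_le_trans C'M.
Qed.

End Periodic.

(** * Square integrable functions on the surface and Parseval's identity *)

Section Hilbert.
Variables (R : realType) (G : deck_group R).
Local Notation plane := (measurableTypeR R * measurableTypeR R)%type.
Local Notation hmeas := (@hmeas R).
Local Notation leb2 := (@leb2 R).
Local Notation H := (@halfplane R).
Local Notation D := (@dirichlet R G).
Local Notation S := (surface G).
Implicit Types (a b p : R * R -> R) (f e h : S -> R[i]).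

Let mD := @measurable_dirichlet R G.
Let mH := @measurable_halfplane R.
Let DH : D `<=` H. Proof. by move=> z; exact: dirichlet_halfplane. Qed.

(** Functions on the surface are handled through the real and imaginary parts of
    their lifts, measurable on the half-plane and square integrable on the
    fundamental domain. *)
Definition sqint a : Prop :=
  measurable_fun (H : set plane) (a : plane -> measurableTypeR R) /\
  hmeas.-integrable D (fun z => (a z ^+ 2)%:E).

Definition dot a b : R := \int[hmeas]_(z in D) (a z * b z).

Lemma sqint_measurable a : sqint a -> measurable_fun (D : set plane) (a : plane -> measurableTypeR R).
Proof. by move=> [ma _]; exact: measurable_funS ma. Qed.

Lemma sqint_integrable a b : sqint a -> sqint b ->
  hmeas.-integrable D (EFin \o (fun z => a z * b z)).
Proof.
move=> sa sb; have ma := sqint_measurable sa; have mb := sqint_measurable sb.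
apply: (le_integrable mD _ _ (integrableD mD sa.2 sb.2)).
  exact/measurable_EFinP/measurable_funM.
move=> z _ /=; rewrite lee_fin [leRHS]ger0_norm ?addr_ge0 ?sqr_ge0//.
rewrite ler_norml; have := sqr_ge0 (a z + b z); have := sqr_ge0 (a z - b z).
by move=> h1 h2; apply/andP; split; have := sqr_ge0 (a z); have := sqr_ge0 (b z); lra.
Qed.

Lemma sqint_lin a b (c : R) : sqint a -> sqint b -> sqint (fun z => a z + c * b z).
Proof.
move=> sa sb; have ab := sqint_integrable sa sb; split.
  apply: measurable_funD; first exact: sa.1.
  by apply: measurable_funM; [exact: measurable_cst|exact: sb.1].
have := integrableD mD sa.2 (integrableD mD (integrableZl mD (2 * c) ab) (integrableZl mD (c ^+ 2) sb.2)).
apply: eq_integrable => // z _ /=.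
by rewrite -!EFinM -!EFinD; congr _%:E; ring.
Qed.

Lemma dotC a b : dot a b = dot b a.
Proof. by apply: eq_Rintegral => z _; rewrite mulrC. Qed.

Lemma dot_lin a b p (c : R) : sqint a -> sqint b -> sqint p ->
  dot (fun z => a z + c * b z) p = dot a p + c * dot b p.
Proof.
move=> sa sb sp; have ap := sqint_integrable sa sp; have bp := sqint_integrable sb sp.
rewrite /dot -RintegralZl// -RintegralD//.
  by apply: eq_Rintegral => z _; ring.
by have := integrableZl mD c bp; apply: eq_integrable => // z _; rewrite /= EFinM.
Qed.

Lemma integral_dirichlet a : measurable_fun (D : set plane) (a : plane -> measurableTypeR R) ->
  (\int[leb2]_(z in D) (a z / z.2 ^+ 2)%:E = \int[hmeas]_(z in D) (a z)%:E)%E.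
Proof.
move=> ma; rewrite integral_hmeas//; last exact/measurable_EFinP.
apply: eq_integral => z /[!inE] zD; rewrite -EFinM /hden.
by have -> : 0 < z.2 by exact: DH.
Qed.

Lemma Rintegral_dirichlet a : measurable_fun (D : set plane) (a : plane -> measurableTypeR R) ->
  \int[leb2]_(z in D) (a z / z.2 ^+ 2) = \int[hmeas]_(z in D) a z.
Proof. by move=> ma; rewrite /Rintegral -integral_dirichlet. Qed.

Definition re f (z : R * R) : R := complex.Re (pullback f z).
Definition im f (z : R * R) : R := complex.Im (pullback f z).

Lemma normc_sqr (z : R[i]) : Normc.normc z ^+ 2 = complex.Re z ^+ 2 + complex.Im z ^+ 2.
Proof. by case: z => a b; rewrite /= sqr_sqrtr// addr_ge0// sqr_ge0. Qed.

Lemma sqnormL2_re_im f : measurable_fun (H : set plane) (re f : plane -> measurableTypeR R) ->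
  measurable_fun (H : set plane) (im f : plane -> measurableTypeR R) ->
  sqnormL2 f = (\int[hmeas]_(z in D) (re f z ^+ 2 + im f z ^+ 2)%:E)%E.
Proof.
move=> m1 m2; rewrite /sqnormL2 -integral_dirichlet.
  by apply: eq_integral => z _; rewrite normc_sqr.
by apply: measurable_funD; apply: measurable_funX; apply: (measurable_funS mH DH).
Qed.

Lemma L2_sqint f : L2 f <-> sqint (re f) /\ sqint (im f).
Proof.
split=> [[m1 m2 fin]|[[m1 s1] [m2 s2]]]; last first.
  split => //; rewrite sqnormL2_re_im//.
  have := integrable_lty mD (integrableD mD s1 s2); apply: le_lt_trans.
  by rewrite le_eqVlt; apply/orP; left; apply/eqP; apply: eq_integral => z _; rewrite EFinD.
have {}m1 : measurable_fun (H : set plane) (re f : plane -> measurableTypeR R) by exact: m1.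
have {}m2 : measurable_fun (H : set plane) (im f : plane -> measurableTypeR R) by exact: m2.
have n1 := measurable_funS mH DH m1; have n2 := measurable_funS mH DH m2.
move: fin; rewrite sqnormL2_re_im// => fin.
have intD : hmeas.-integrable D (fun z => (re f z ^+ 2 + im f z ^+ 2)%:E).
  apply/integrableP; split.
    by apply/measurable_EFinP; apply: measurable_funD; exact: measurable_funX.
  apply: le_lt_trans fin; rewrite le_eqVlt; apply/orP; left; apply/eqP.
  by apply: eq_integral => z _; rewrite gee0_abs// lee_fin addr_ge0// sqr_ge0.
split; split => //; apply: (le_integrable mD _ _ intD).
- by apply/measurable_EFinP; exact: measurable_funX.
- move=> z _; rewrite /= lee_fin !ger0_norm ?sqr_ge0 ?addr_ge0 ?sqr_ge0//.
  by rewrite lerDl sqr_ge0.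
- by apply/measurable_EFinP; exact: measurable_funX.
- move=> z _; rewrite /= lee_fin !ger0_norm ?sqr_ge0 ?addr_ge0 ?sqr_ge0//.
  by rewrite lerDr sqr_ge0.
Qed.

Lemma sqnormL2_dot f : L2 f -> sqnormL2 f = (dot (re f) (re f) + dot (im f) (im f))%:E.
Proof.
move=> /L2_sqint[s1 s2]; rewrite sqnormL2_re_im; [|exact: s1.1|exact: s2.1].
have i1 := sqint_integrable s1 s1; have i2 := sqint_integrable s2 s2.
rewrite EFinD /dot /Rintegral !fineK; [|exact: integrable_fin_num i2|exact: integrable_fin_num i1].
by rewrite -integralD//; apply: eq_integral => z _.
Qed.

Lemma innerL2_dot f h : L2 f -> L2 h ->
  innerL2 f h = ((dot (re f) (re h) + dot (im f) (im h)) +i*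
                 (dot (im f) (re h) - dot (re f) (im h)))%C.
Proof.
move=> /L2_sqint[s1 s2] /L2_sqint[t1 t2]; rewrite /innerL2.
have pE z : (pullback f z * (pullback h z)^*)%C =
  ((re f z * re h z + im f z * im h z) +i* (im f z * re h z - re f z * im h z))%C.
  rewrite /re /im; case: (pullback f z) => a b; case: (pullback h z) => c d /=.
  by apply/eqP; rewrite eq_complex /=; apply/andP; split; apply/eqP; ring.
have m1 := sqint_measurable s1; have m2 := sqint_measurable s2.
have n1 := sqint_measurable t1; have n2 := sqint_measurable t2.
have i11 := sqint_integrable s1 t1; have i22 := sqint_integrable s2 t2.
have i21 := sqint_integrable s2 t1; have i12 := sqint_integrable s1 t2.
congr (_ +i* _)%C.
  rewrite /dot -RintegralD// -Rintegral_dirichlet.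
    by apply: eq_Rintegral => z _; rewrite pE.
  by apply: measurable_funD; exact: measurable_funM.
rewrite /dot -RintegralB// -Rintegral_dirichlet.
  by apply: eq_Rintegral => z _; rewrite pE.
by apply: measurable_funB; exact: measurable_funM.
Qed.

Lemma pullback_sub f e (c : R[i]) z :
  pullback (fun x => f x - c * e x) z = pullback f z - c * pullback e z.
Proof. by rewrite /pullback; case: insub => [w|] //; rewrite mulr0 subr0. Qed.

Lemma re_sub f e (c : R[i]) : re (fun x => f x - c * e x) =
  fun z => (re f z + (- complex.Re c) * re e z) + complex.Im c * im e z.
Proof.
apply/funext => z; rewrite /re /im pullback_sub.
by case: (pullback f z) => a b; case: (pullback e z) => u v; case: c => s t /=; ring.
Qed.

Lemma im_sub f e (c : R[i]) : im (fun x => f x - c * e x) =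
  fun z => (im f z + (- complex.Re c) * im e z) + (- complex.Im c) * re e z.
Proof.
apply/funext => z; rewrite /re /im pullback_sub.
by case: (pullback f z) => a b; case: (pullback e z) => u v; case: c => s t /=; ring.
Qed.

Section Step.
Variables (f e : S -> R[i]) (c : R[i]).
Hypotheses (f2 : L2 f) (e2 : L2 e).
Let g x := f x - c * e x.
Let fr := (L2_sqint f).1 f2 : sqint (re f) /\ sqint (im f).
Let er := (L2_sqint e).1 e2 : sqint (re e) /\ sqint (im e).

Lemma L2_sub : L2 g.
Proof.
have [fr' fi] := fr; have [er' ei] := er.
by apply/L2_sqint; rewrite re_sub im_sub; split; apply: sqint_lin => //; exact: sqint_lin.
Qed.

Lemma innerL2_subl h : L2 h -> innerL2 g h = innerL2 f h - c * innerL2 e h.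
Proof.
move=> h2; have [hr hi] := (L2_sqint h).1 h2; have [fr' fi] := fr; have [er' ei] := er.
rewrite (innerL2_dot L2_sub h2) (innerL2_dot f2 h2) (innerL2_dot e2 h2) re_sub im_sub.
have s1 := sqint_lin (- complex.Re c) fr' er'; have s2 := sqint_lin (- complex.Re c) fi ei.
rewrite !dot_lin//; case: c => s t /=.
by apply/eqP; rewrite eq_complex /=; apply/andP; split; apply/eqP; ring.
Qed.

Lemma sqnormL2_sub : innerL2 e e = 1 -> innerL2 f e = c ->
  sqnormL2 g = (sqnormL2 f - (Normc.normc c ^+ 2)%:E)%E.
Proof.
move=> ee fe; have [fr' fi] := fr; have [er' ei] := er.
rewrite (sqnormL2_dot L2_sub) (sqnormL2_dot f2) -EFinB re_sub im_sub.
have s1 := sqint_lin (- complex.Re c) fr' er'; have s2 := sqint_lin (- complex.Re c) fi ei.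
have t1 := sqint_lin (complex.Im c) s1 ei; have t2 := sqint_lin (- complex.Im c) s2 er'.
have dR a b p k : sqint a -> sqint b -> sqint p ->
    dot p (fun z => a z + k * b z) = dot p a + k * dot p b.
  by move=> sa sb sp; rewrite dotC dot_lin// (dotC a) (dotC b).
rewrite !dR// !dot_lin//.
move: ee fe; rewrite (innerL2_dot e2 e2) (innerL2_dot f2 e2) normc_sqr.
move=> /(congr1 (@complex.Re R)) /= e1 fe; congr _%:E.
have -> : complex.Re c = dot (re f) (re e) + dot (im f) (im e) by rewrite -fe.
have -> : complex.Im c = dot (im f) (re e) - dot (re f) (im e) by rewrite -fe.
rewrite (dotC (re e) (re f)) (dotC (im e) (im f)) (dotC (re e) (im f)) (dotC (im e) (re f)) (dotC (im e) (re e)).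
have -> : dot (im e) (im e) = 1 - dot (re e) (re e) by rewrite -e1; ring.
ring.
Qed.

End Step.

(** The partial sums of the expansion are orthogonal projections. *)
Lemma parseval (e : nat -> S -> R[i]) f : orthonormal_basis e -> L2 f ->
  sqnormL2 f = (\esum_(j in [set: nat]) (Normc.normc (innerL2 f (e j)) ^+ 2)%:E)%E.
Proof.
move=> [e2 eo ecomp] f2; have ecv := ecomp f f2.
pose c j := innerL2 f (e j).
pose g n x := f x - \sum_(j < n) c j * e j x.
have gS n : g n.+1 = fun x => g n x - c n * e n x.
  by apply/funext => x; rewrite /g big_ord_recr/= opprD addrA.
have gP n : [/\ L2 (g n), forall k, (n <= k)%N -> innerL2 (g n) (e k) = c k
    & sqnormL2 (g n) = (sqnormL2 f - (\sum_(j < n) Normc.normc (c j) ^+ 2)%:E)%E].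
  elim: n => [|n [IH1 IH2 IH3]].
    have -> : g 0%N = f by apply/funext => x; rewrite /g big_ord0 subr0.
    by rewrite big_ord0 sube0.
  rewrite gS; split.
  - exact: L2_sub.
  - move=> k nk; rewrite innerL2_subl// IH2 ?(ltnW nk)// eo.
    by rewrite (ltn_eqF nk) mulr0 subr0.
  - rewrite sqnormL2_sub ?IH2 ?eo ?eqxx// IH3 big_ord_recr/=.
    by rewrite (sqnormL2_dot f2) -!EFinB; congr _%:E; ring.
set N := dot (re f) (re f) + dot (im f) (im f).
have fN : sqnormL2 f = N%:E by exact: sqnormL2_dot.
rewrite fN -nneseries_esumT; last by move=> j; rewrite lee_fin sqr_ge0.
apply/esym/cvg_lim => //.
have h1 : (fun n => N - \sum_(j < n) Normc.normc (c j) ^+ 2) @ \oo --> (0 : R).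
  rewrite (_ : (fun n => _) = fine \o (fun n => sqnormL2 (g n))); first exact: fine_cvg ecv.
  by apply/funext => n; have [_ _] := gP n; rewrite /= fN => ->.
have h2 : (fun n => \sum_(j < n) Normc.normc (c j) ^+ 2) @ \oo --> N.
  rewrite -[X in _ --> X]subr0.
  rewrite (_ : (fun n => _) = (fun n => N - (N - \sum_(j < n) Normc.normc (c j) ^+ 2))).
    by apply: cvgB; [exact: cvg_cst|exact: h1].
  by apply/funext => n; rewrite subKr.
rewrite (_ : (fun n => _) = (fun n => (\sum_(j < n) Normc.normc (c j) ^+ 2)%:E)).
  by apply: cvg_EFin; [near=> n|exact: h2].
by apply/funext => n; rewrite sumEFin big_mkord.
Unshelve. all: by end_near. Qed.

End Hilbert.

(** * Sums over the spectrum grouped by frequency *)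

Section Grouping.
Variables (R : realType) (lambda : nat -> R).
Implicit Types a b : nat -> R.

Let below l := [set j | lambda j <= l].
Let strictly_below l := [set j | lambda j < l].
Let at_level l := [set j | lambda j = l].
Let mass_on a (A : set nat) := (\esum_(j in A) (a j)%:E)%E.

(** Finitely many frequencies below [l] are below their maximum, itself less
    than [l]. *)
Lemma esum_strictly_below_le a b l : (forall j, 0 <= a j) -> (forall j, 0 <= b j) ->
  (forall l, mass_on a (below l) = mass_on b (below l)) ->
  (mass_on a (strictly_below l) <= mass_on b (strictly_below l))%E.
Proof.
move=> a0 b0 ab; apply: ub_ereal_sup => _ [X [Xfin XS] <-].
have [m ml Xm] : exists2 m, m < l & X `<=` below m.
  exists (\big[Num.max/l - 1]_(j <- fset_set X) lambda j).
    rewrite big_seq; elim/big_ind : _ => [|u v ul vl|j]; first by lra.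
      by rewrite gt_max ul vl.
    by rewrite in_fset_set// inE => /XS.
  by move=> j Xj; apply: le_bigmax_seq => //; rewrite in_fset_set// inE.
apply: (@le_trans _ _ (mass_on a (below m))).
  by apply: ereal_sup_ubound; exists X.
rewrite ab; apply: le_ereal_sup => _ [Y [Yfin YS] <-]; exists Y => //; split => //.
by move=> j /YS /= jm; exact: le_lt_trans ml.
Qed.

Lemma esum_at_level a b l : (forall j, 0 <= a j) -> (forall j, 0 <= b j) ->
  (forall l, mass_on a (below l) < +oo)%E ->
  (forall l, mass_on a (below l) = mass_on b (below l)) ->
  mass_on a (at_level l) = mass_on b (at_level l).
Proof.
move=> a0 b0 afin ab.
have split c : (forall j, 0 <= c j) ->
    mass_on c (below l) = (mass_on c (strictly_below l) + mass_on c (at_level l))%E.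
  move=> c0; rewrite /mass_on (@esumID _ _ (strictly_below l))//; last first.
    by move=> j _; rewrite lee_fin.
  congr (_ + _)%E; congr esum; apply/seteqP; split => j /=.
  - by case.
  - by move=> jl; split => //; rewrite /below /= ltW.
  - by rewrite /below /at_level /= => -[jl /negP]; rewrite -leNgt => lj; apply/le_anti/andP.
  - by rewrite /below /at_level /strictly_below /= => ->; rewrite lexx ltxx.
have strict : mass_on a (strictly_below l) = mass_on b (strictly_below l).
  by apply/le_anti/andP; split; apply: esum_strictly_below_le.
have ge0 c (A : set nat) : (forall j, 0 <= c j) -> (0 <= mass_on c A)%E.
  by move=> c0; apply: esum_ge0 => j _; rewrite lee_fin.
have fs : mass_on a (strictly_below l) \is a fin_num.
  rewrite ge0_fin_numE ?ge0//; apply: le_lt_trans (afin l).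
  by rewrite split// leeDl// ge0.
have := ab l; rewrite (split a)// (split b)// -strict.
move=> E; rewrite -[LHS](addeK _ fs) -[RHS](addeK _ fs).
by rewrite ![(mass_on _ (at_level l) + _)%E]addeC E.
Qed.

(** The sum over one frequency is the jump of the counting function, which is
    finite; the total is grouped by frequencies, each represented by the first
    index having it. *)
Lemma esum_weighted a b (w : R -> R) : (forall j, 0 <= a j) -> (forall j, 0 <= b j) ->
  (forall t, 0 <= w t) ->
  (forall l, mass_on a (below l) < +oo)%E ->
  (forall l, mass_on a (below l) = mass_on b (below l)) ->
  (\esum_(j in [set: nat]) (w (lambda j) * a j)%:E =
   \esum_(j in [set: nat]) (w (lambda j) * b j)%:E)%E.
Proof.
move=> a0 b0 w0 afin ab.
pose first k := [set i | lambda i = lambda k] `&` [set i | forall m, (m < k)%N -> lambda m != lambda k].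
have cover : [set: nat] = \bigcup_(k in [set: nat]) first k.
  apply/seteqP; split => // j _; pose P k := lambda k == lambda j.
  have exP : exists k, P k by exists j; rewrite /P.
  exists (ex_minn exP) => //; case: ex_minnP => k /eqP Pk kmin; split; rewrite /= ?Pk// => m mk.
  by apply/negP => mj; have := kmin m mj; rewrite leqNgt mk.
have disj : trivIset [set: nat] first.
  move=> k m _ _ [i [[/= ik kfirst] [/= im mfirst]]].
  have E : lambda k = lambda m by rewrite -ik.
  case: (ltngtP k m) => // km.
  - by have := mfirst k km; rewrite E eqxx.
  - by have := kfirst m km; rewrite E eqxx.
have group c : (forall j, 0 <= c j) -> (\esum_(j in [set: nat]) (w (lambda j) * c j)%:E =
    \esum_(k in [set: nat]) ((w (lambda k))%:E * mass_on c (first k)))%E.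
  move=> c0; rewrite cover esum_bigcupT//; last by move=> j; rewrite lee_fin mulr_ge0.
  rewrite -cover; apply: eq_esum => k _; rewrite /mass_on -esum_mull//.
  by apply: eq_esum => j [/= -> _]; rewrite EFinM.
rewrite !group//; apply: eq_esum => k _; congr (_ * _)%E.
have [kf|kf] := pselect (forall m, (m < k)%N -> lambda m != lambda k).
  have -> : first k = at_level (lambda k) by apply/seteqP; split => [i []|i].
  exact: esum_at_level.
have -> : first k = set0 by apply/seteqP; split => // i [].
by rewrite /mass_on !esum_set0.
Qed.

End Grouping.

(** * The counting function determines the sums of overlaps *)

Lemma adde_double_inj (R : realType) (a b p q : \bar R) : a \is a fin_num -> b \is a fin_num ->
  p \is a fin_num -> q \is a fin_num -> (a + b + (p + p) = a + b + (q + q) -> p = q)%E.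
Proof.
move=> /fineK <- /fineK <- /fineK <- /fineK <-.
by rewrite -!EFinD => -[E]; congr _%:E; lra.
Qed.

Lemma ge0_integral_sqrD d (T : measurableType d) (R : realType) (mu : {measure set T -> \bar R})
    (D : set T) (a b : T -> \bar R) : measurable D ->
  measurable_fun D a -> measurable_fun D b ->
  (forall t, D t -> 0 <= a t)%E -> (forall t, D t -> 0 <= b t)%E ->
  (\int[mu]_(t in D) ((a t + b t) * (a t + b t)) =
   (\int[mu]_(t in D) (a t * a t) + \int[mu]_(t in D) (b t * b t)) +
   (\int[mu]_(t in D) (a t * b t) + \int[mu]_(t in D) (a t * b t)))%E.
Proof.
move=> mD ma mb a0 b0.
have mM (f g : T -> \bar R) : measurable_fun D f -> measurable_fun D g ->
    measurable_fun D (fun t => f t * g t)%E by exact: emeasurable_funM.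
have mA (f g : T -> \bar R) : measurable_fun D f -> measurable_fun D g ->
    measurable_fun D (fun t => f t + g t)%E by exact: emeasurable_funD.
have maa := mM _ _ ma ma; have mbb := mM _ _ mb mb; have mab := mM _ _ ma mb.
have aa0 t : D t -> (0 <= a t * a t)%E by move=> Dt; rewrite mule_ge0 ?a0.
have bb0 t : D t -> (0 <= b t * b t)%E by move=> Dt; rewrite mule_ge0 ?b0.
have ab0 t : D t -> (0 <= a t * b t)%E by move=> Dt; rewrite mule_ge0 ?a0 ?b0.
rewrite -(ge0_integralD mu mD aa0 maa bb0 mbb) -(ge0_integralD mu mD ab0 mab ab0 mab).
rewrite -ge0_integralD//; [|by move=> t Dt; rewrite adde_ge0 ?aa0 ?bb0|exact: mA|
  by move=> t Dt; rewrite adde_ge0 ?ab0|exact: mA].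
apply: eq_integral => t /[!inE] Dt.
have a0t := a0 t Dt; have b0t := b0 t Dt.
rewrite ge0_muleDl// !ge0_muleDr// (muleC (b t) (a t)).
by rewrite [(a t * b t + b t * b t)%E]addeC addeACA.
Qed.

Section Spectral.
Variables (R : realType) (G : deck_group R).
Local Notation plane := (measurableTypeR R * measurableTypeR R)%type.
Local Notation hmeas := (@hmeas R).
Local Notation H := (@halfplane R).
Local Notation D := (@dirichlet R G).
Local Notation S := (surface G).
Local Notation periodized := (@periodized R G).
Implicit Types (phi psi : R -> R) (f : S -> R[i]) (x y : S).

Let mD := @measurable_dirichlet R G.
Let mH := @measurable_halfplane R.
Let DH : D `<=` H. Proof. by move=> z; exact: dirichlet_halfplane. Qed.

Definition lift_point x : R * R := val (repr x).

Lemma lift_halfplane x : H (lift_point x). Proof. exact: hyp_gt0. Qed.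

Lemma repr_to_surface (w : hyp R) : exists2 g, deck G g & g w = repr (to_surface G w).
Proof.
have : to_surface G (repr (to_surface G w)) = to_surface G w by rewrite /to_surface reprK.
move=> /esym/eqmodP h; have {h} : orbit_rel G w (repr (to_surface G w)) by exact: h.
by move=> /asboolP[g Gg gw]; exists g.
Qed.

Lemma to_surface_deck g w : deck G g -> to_surface G (g w) = to_surface G w.
Proof.
move=> Gg; apply/esym/eqmodP; rewrite /equiv /=; apply/asboolP; by exists g.
Qed.

Lemma pullback_val f (w : hyp R) : pullback f (val w) = f (to_surface G w).
Proof. by rewrite /pullback valK. Qed.

Lemma pullback_out f z : ~ H z -> pullback f z = 0.
Proof. by move=> Hz; rewrite /pullback insubF//; apply/negbTE; rewrite notin_setE. Qed.

Lemma pullback_act f g z : deck G g -> H z -> pullback f (act g z) = pullback f z.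
Proof.
by move=> Gg /halfplane_val[w <-]; rewrite act_val !pullback_val to_surface_deck.
Qed.

Lemma pullback_lift f x : pullback f (lift_point x) = f x.
Proof. by rewrite /lift_point pullback_val /to_surface reprK. Qed.

(** The radial kernel of profile [phi] around [x], as a function on the surface. *)
Definition autker phi x : S -> R[i] := fun y => (fine (periodized phi (lift_point x) (lift_point y)))%:C%C.

Lemma pullback_kernel phi x z : H z ->
  pullback (autker phi x) z = (fine (periodized phi (lift_point x) z))%:C%C.
Proof.
move=> /halfplane_val[w <-]; rewrite pullback_val /autker /lift_point.
by have [g Gg <-] := repr_to_surface w; rewrite -act_val periodic_act.
Qed.

Lemma re_kernel phi x z : H z -> re (autker phi x) z = fine (periodized phi (lift_point x) z).
Proof. by move=> Hz; rewrite /re pullback_kernel. Qed.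

Lemma im_kernel phi x z : im (autker phi x) z = 0.
Proof.
have [Hz|Hz] := pselect (H z); first by rewrite /im pullback_kernel.
by rewrite /im pullback_out.
Qed.

Lemma measurable_re_kernel phi C x : profile phi C ->
  measurable_fun (H : set plane) (re (autker phi x) : plane -> measurableTypeR R).
Proof.
move=> p; apply: (eq_measurable_fun (fun z => fine (periodized phi (lift_point x) z))).
  by move=> z /[!inE] Hz; rewrite re_kernel.
apply: measurableT_comp => //.
by apply: (measurable_funS measurableT) => //; exact: measurable_periodic p.
Qed.

Lemma sqnorm_kernel phi C x : profile phi C ->
  sqnormL2 (autker phi x) = (\esum_(g in deck G) overlap phi phi (lift_point x) g)%E.
Proof.
move=> p; rewrite sqnormL2_re_im; [|exact: measurable_re_kernel p|].
  rewrite -(integral_periodic2 G p p (lift_halfplane x)).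
  apply: eq_integral => z /[!inE] /DH Hz; rewrite re_kernel// im_kernel expr0n addr0.
  have pf := periodic_fin G p (lift_halfplane x) Hz.
  by rewrite expr2 EFinM fineK.
rewrite (_ : im _ = cst 0); first exact: measurable_cst.
by apply/funext => z; rewrite im_kernel.
Qed.

Lemma L2_kernel phi C x : profile phi C -> L2 (autker phi x).
Proof.
move=> p; split; [exact: measurable_re_kernel p| |].
  rewrite (_ : (fun z => _) = cst 0); first exact: measurable_cst.
  by apply/funext => z; exact: im_kernel.
rewrite (sqnorm_kernel x p); exact: (overlap_lty G p p (lift_halfplane x)).
Qed.

Lemma dot_kernel phi C x (u : R * R -> R) : profile phi C ->
  measurable_fun (H : set plane) (u : plane -> measurableTypeR R) ->
  (forall g z, deck G g -> H z -> u (act g z) = u z) ->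
  (forall z, ~ H z -> u z = 0) ->
  dot G (re (autker phi x)) u = \int[hmeas]_(z in H) (u z * phi (cdist (lift_point x) z)).
Proof.
move=> p mu uact u0; rewrite /dot /Rintegral.
rewrite -(integral_periodic_signed p (lift_halfplane x) _ uact).
  by congr fine; apply: eq_integral => z /[!inE] /DH Hz; rewrite re_kernel.
rewrite (_ : u = u \_ H); first by apply/(measurable_restrictT _ _).1.
apply/funext => z; rewrite patchE; case: ifPn => // /negP; rewrite inE => Hz; exact: u0.
Qed.

(** [h la] is the scalar by which the kernel of profile [phi] acts on the
    eigenfunctions of frequency [la]. *)
Definition multiplier phi (h : R -> R) : Prop := forall la (u : R * R -> R) (X : R * R),
  eigenH la u -> H X -> \int[hmeas]_(z in H) (u z * phi (cdist X z)) = h la * u X.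

Lemma eigenfunction_re_im f la : laplace_eigenfunction f la -> eigenH la (re f) /\ eigenH la (im f).
Proof.
move=> [c2r c2i E]; split.
  split; first exact: c2r.
  move=> z Hz; have /(congr1 (@complex.Re R)) := E z Hz.
  rewrite -[LHS]/(hlaplacian (re f) z) => ->; rewrite /re.
  by case: (pullback f z) => a b /=; ring.
split; first exact: c2i.
move=> z Hz; have /(congr1 (@complex.Im R)) := E z Hz.
rewrite -[LHS]/(hlaplacian (im f) z) => ->; rewrite /im.
by case: (pullback f z) => a b /=; ring.
Qed.

(** Unfolding the inner product gives the integral over the plane of the
    eigenfunction against the radial kernel. *)
Lemma inner_kernel phi C h f la x : profile phi C -> multiplier phi h ->
  laplace_eigenfunction f la -> L2 f ->
  Normc.normc (innerL2 (autker phi x) f) ^+ 2 = h la ^+ 2 * Normc.normc (f x) ^+ 2.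
Proof.
move=> p hm ef f2; have [er ei] := eigenfunction_re_im ef.
have [sr si] := (L2_sqint f).1 f2.
rewrite (innerL2_dot (L2_kernel x p) f2) normc_sqr /=.
have im0 u : dot G (im (autker phi x)) u = 0.
  rewrite /dot (@eq_Rintegral _ _ _ _ _ (cst 0)); first by rewrite Rintegral_cst// mul0r.
  by move=> z _; rewrite im_kernel mul0r.
rewrite !im0 addr0 sub0r (dot_kernel x p sr.1); first last.
- by move=> z Hz; rewrite /re pullback_out.
- by move=> g z Gg Hz; rewrite /re pullback_act.
rewrite (dot_kernel x p si.1); first last.
- by move=> z Hz; rewrite /im pullback_out.
- by move=> g z Gg Hz; rewrite /im pullback_act.
rewrite (hm _ _ _ er (lift_halfplane x)) (hm _ _ _ ei (lift_halfplane x)).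
by rewrite normc_sqr /re /im pullback_lift; ring.
Qed.

Definition bump_profile (c t : R) : R := pospart (c - t) ^+ 2.

Lemma profile_bump c : profile (bump_profile c) c.
Proof.
split=> [t|t|t ct]; [|exact: sqr_ge0|]; last by rewrite /bump_profile pospart_le0 ?subr_le0// expr0n.
apply: (@continuous_comp _ _ _ (fun t => pospart (c - t)) (fun s => s ^+ 2)); last exact: exprn_continuous.
apply: (@continuous_comp _ _ _ (fun t => c - t) (@pospart R)); last exact: continuous_pospart.
by apply: cvgB; [exact: cvg_cst|exact: cvg_id].
Qed.

Lemma multiplier_bump c : exists h, multiplier (bump_profile c) h.
Proof.
have [c1|c1] := ltP 1 c; first by have [h hP] := moment_multiplier c1; exists h => la u X; exact: hP.
exists (fun=> 0) => la u X _ HX; rewrite mul0r (@eq_Rintegral _ _ _ _ _ (cst 0)).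
  by rewrite Rintegral_cst ?mul0r//; exact: mH.
move=> z /[!inE] Hz; rewrite /bump_profile pospart_le0 ?expr0n ?mulr0//.
by rewrite subr_le0 (le_trans c1)// cdist_ge1.
Qed.

Lemma multiplier_bump_add c c' h h' : multiplier (bump_profile c) h -> multiplier (bump_profile c') h' ->
  multiplier (fun t => bump_profile c t + bump_profile c' t) (fun la => h la + h' la).
Proof.
move=> hm hm' la u X eu HX; have cu := eigenH_continuous eu.
have k2 : (0 < 2)%N by [].
rewrite mulrDl -(hm la u X eu HX) -(hm' la u X eu HX) -RintegralD//.
- by apply: eq_Rintegral => z _; rewrite mulrDr.
- exact: (integrable_bumpH HX c cu k2).
- exact: (integrable_bumpH HX c' cu k2).
Qed.

Section Basis.
Variables (e : nat -> S -> R[i]) (lambda : nat -> R).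
Hypothesis lambda_ge0 : forall j, 0 <= lambda j.
Hypothesis e_basis : orthonormal_basis e.
Hypothesis e_eigen : forall j, laplace_eigenfunction (e j) (lambda j).

(** The square of the norm of the kernel on the surface, unfolded on the left and
    given by Parseval's identity on the right. *)
Lemma spectral_overlap phi C h x : profile phi C -> multiplier phi h ->
  (\esum_(g in deck G) overlap phi phi (lift_point x) g =
   \esum_(j in [set: nat]) (h (lambda j) ^+ 2 * Normc.normc (e j x) ^+ 2)%:E)%E.
Proof.
move=> p hm; rewrite -(sqnorm_kernel x p) (parseval e_basis (L2_kernel x p)).
apply: eq_esum => j _; congr _%:E; apply: inner_kernel p hm (e_eigen j) _.
by case: e_basis.
Qed.

(** Bessel's inequality for a kernel whose multiplier is bounded below on the
    frequencies up to [l]. *)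
Lemma weyl_counting_lty x l : (weyl_counting e lambda x l < +oo)%E.
Proof.
have [c [c1 [k k0 kP]]] := moment_lower_bound l.
have p := profile_bump c; have [h hm] := multiplier_bump c.
have fin := overlap_lty G p p (lift_halfplane x).
rewrite (spectral_overlap x p hm) in fin.
have k20 : 0 < k ^+ 2 by rewrite exprn_gt0.
have E0 j : 0 <= Normc.normc (e j x) ^+ 2 by rewrite sqr_ge0.
suff : ((k ^+ 2)%:E * weyl_counting e lambda x l < +oo)%E.
  move=> hlt; rewrite ltey; apply/eqP => wE; move: hlt.
  by rewrite wE gt0_muley ?lte_fin// ltxx.
rewrite /weyl_counting -esum_mull ?(ltW k20)//.
apply: le_lt_trans fin; apply: (@le_trans _ _ (\esum_(j in [set j | (lambda j <= l)%R])
    (h (lambda j) ^+ 2 * Normc.normc (e j x) ^+ 2)%:E)%E).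
  apply: le_esum => j /= jl; rewrite -EFinM lee_fin.
  have [er ei] := eigenfunction_re_im (e_eigen j).
  have lj : `|lambda j| <= l by rewrite ger0_norm.
  have bound u : eigenH (lambda j) u -> k ^+ 2 * u (lift_point x) ^+ 2 <= h (lambda j) ^+ 2 * u (lift_point x) ^+ 2.
    move=> eu; have := kP _ u (lift_point x) lj eu (lift_halfplane x).
    rewrite (hm _ _ _ eu (lift_halfplane x) : moment (lift_point x) u c 2 = _) => b.
    rewrite -!exprMn -[(h _ * _) ^+ 2]real_normK ?num_real//.
    rewrite -[(k * _) ^+ 2]real_normK ?num_real// lerXn2r ?nnegrE//.
    by rewrite normrM (gtr0_norm k0).
  rewrite normc_sqr !mulrDr -(pullback_lift (e j) x).
  by apply: lerD; [exact: (bound (re (e j)))|exact: (bound (im (e j)))].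
apply: le_ereal_sup => _ [Y [Yfin YS] <-]; exists Y => //.
Qed.

Variables x y : S.
Hypothesis eqN : forall l, weyl_counting e lambda x l = weyl_counting e lambda y l.

Lemma overlap_diag_eq phi C h : profile phi C -> multiplier phi h ->
  (\esum_(g in deck G) overlap phi phi (lift_point x) g = \esum_(g in deck G) overlap phi phi (lift_point y) g)%E.
Proof.
move=> p hm; rewrite !(spectral_overlap _ p hm).
apply: (@esum_weighted R lambda (fun j => Normc.normc (e j x) ^+ 2) (fun j => Normc.normc (e j y) ^+ 2)
  (fun t => h t ^+ 2)) => [j|j|t|l|l]; rewrite ?sqr_ge0//.
- exact: weyl_counting_lty.
- exact: eqN.
Qed.

(** Polarisation of [overlap_diag_eq], for two kernels and their sum. *)
Lemma overlap_eq c c' :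
  (\esum_(g in deck G) overlap (bump_profile c) (bump_profile c') (lift_point x) g =
   \esum_(g in deck G) overlap (bump_profile c) (bump_profile c') (lift_point y) g)%E.
Proof.
have p := profile_bump c; have p' := profile_bump c'; have pp := profile_add p p'.
have [h hm] := multiplier_bump c; have [h' hm'] := multiplier_bump c'.
have hh := multiplier_bump_add hm hm'.
have E1 := overlap_diag_eq p hm; have E2 := overlap_diag_eq p' hm'; have E3 := overlap_diag_eq pp hh.
pose I phi psi z := (\esum_(g in deck G) overlap phi psi (lift_point z) g)%E.
have expand z : I (fun t => bump_profile c t + bump_profile c' t) (fun t => bump_profile c t + bump_profile c' t) z =
  ((I (bump_profile c) (bump_profile c) z + I (bump_profile c') (bump_profile c') z) +
   (I (bump_profile c) (bump_profile c') z + I (bump_profile c) (bump_profile c') z))%E.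
  have Hz := lift_halfplane z.
  have ge0 b t : D t -> (0 <= periodized (bump_profile b) (lift_point z) t)%E.
    by move=> _; exact: periodic_ge0 (profile_bump b).
  have ms b : measurable_fun (D : set plane) (periodized (bump_profile b) (lift_point z) : plane -> \bar R).
    by apply: measurable_funTS; exact: measurable_periodic (profile_bump b).
  rewrite /I -(integral_periodic2 G pp pp Hz) -(integral_periodic2 G p p Hz).
  rewrite -(integral_periodic2 G p' p' Hz) -(integral_periodic2 G p p' Hz).
  rewrite -(ge0_integral_sqrD hmeas mD (ms c) (ms c') (ge0 c) (ge0 c')).
  by apply: eq_integral => t _; rewrite (periodic_add _ _ _ p p').
have fin c1 c2 z : I (bump_profile c1) (bump_profile c2) z \is a fin_num.
  have p1 := profile_bump c1; have p2 := profile_bump c2.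
  rewrite ge0_fin_numE; first exact: (overlap_lty G p1 p2 (lift_halfplane z)).
  by apply: esum_ge0 => g _; exact: (overlap_ge0 _ _ p1 p2).
have e1 : I (bump_profile c) (bump_profile c) x = I (bump_profile c) (bump_profile c) y := E1.
have e2 : I (bump_profile c') (bump_profile c') x = I (bump_profile c') (bump_profile c') y := E2.
have := expand x; rewrite [X in X = _](E3 : I _ _ x = I _ _ y) expand e1 e2.
move=> /esym; exact: (adde_double_inj (fin c c y) (fin c' c' y) (fin c c' x) (fin c c' y)).
Qed.

End Basis.
End Spectral.

(** * Counting loops by second differences *)

Section Counting.
Variables (R : realType) (G : deck_group R).
Local Notation hmeas := (@hmeas R).
Local Notation H := (@halfplane R).
Local Notation S := (surface G).
Local Notation ipt := (@ipt R).
Implicit Types (x y : S) (z w X : R * R).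

Let mH := @measurable_halfplane R.

(** The kernels are squares of [a - s], cut off at [a]: their second difference in
    the radius is constant where no cut-off occurs. *)
Lemma bump_profile_diff2 (a h s : R) : 0 <= h -> s <= a - 2 * h ->
  bump_profile a s + bump_profile (a - 2 * h) s =
  bump_profile (a - h) s + bump_profile (a - h) s + 2 * h ^+ 2.
Proof.
move=> h0 sa; have pos (r : R) : s <= r -> pospart (r - s) = r - s.
  by move=> sr; rewrite /pospart max_l// subr_ge0.
rewrite /bump_profile !pos; [ring|lra|lra|lra].
Qed.

Lemma bump_profile_out (a s : R) : a <= s -> bump_profile a s = 0.
Proof. by move=> sa; rewrite /bump_profile pospart_le0 ?subr_le0// expr0n. Qed.

Lemma integral_bump_profile c X : H X ->
  (\int[hmeas]_(z in H) (bump_profile c (cdist X z))%:E = (bump_mass c)%:E)%E.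
Proof.
move=> HX; rewrite /bump_mass -(moment_radial c 2 HX) /moment /Rintegral fineK.
  by apply: eq_integral => z _; rewrite mul1r.
have k2 : (0 < 2)%N by [].
have c1 : continuousH (fun=> 1 : R) by move=> z _; exact: cvg_cst.
exact: (integrable_fin_num mH (integrable_bumpH HX c c1 k2)).
Qed.

Let M (a h : R) : R := 1 + h / a.

(** The conclusion of [cdist_near_mul]; with the ratio [M a h] it keeps the values
    up to [a - 3 h] below [a - 2 h], and those from [a + h] above [a]. *)
Definition near_ratio (m e : R) : Prop := forall p q w : R * R, 0 < p.2 -> 0 < q.2 -> 0 < w.2 ->
  cdist q w <= 1 + e -> cdist p w <= m * cdist p q.

(** The small ball around the translate misses the supports of the kernels around
    [X]. *)
Lemma overlap_far (a a' h e : R) X g : 0 < a -> 0 < h -> a' <= a -> H X -> deck G g ->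
  near_ratio (M a h) e ->
  a + h <= cdist X (act g X) ->
  overlap (bump_profile a') (bump_profile (1 + e)) X g = 0%E.
Proof.
move=> a0 h0 aa HX Gg near far; have Hg : H (act g X) by exact: act_halfplane.
apply: integral0_eq => z Hz.
have [zc|zc] := leP (1 + e) (cdist (act g X) z); first by rewrite (bump_profile_out zc) mulr0.
rewrite bump_profile_out ?mul0r//; apply: (le_trans aa).
rewrite cdistC in zc; have := near X z (act g X) HX Hz Hg (ltW zc) => near1.
have M0 : 0 < M a h by rewrite /M addr_gt0// divr_gt0.
rewrite -(ler_pM2l M0); apply: le_trans near1; apply: le_trans far.
by rewrite /M mulrDl mul1r divfK// gt_eqF.
Qed.

(** The small ball around the translate lies where the second difference of the
    kernels around [X] is constant. *)
Lemma overlap_near (a h e : R) X g : 0 < a -> 0 < h -> H X -> deck G g ->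
  near_ratio (M a h) e ->
  cdist X (act g X) <= a - 3 * h ->
  (overlap (bump_profile a) (bump_profile (1 + e)) X g +
   overlap (bump_profile (a - 2 * h)) (bump_profile (1 + e)) X g =
   overlap (bump_profile (a - h)) (bump_profile (1 + e)) X g +
   overlap (bump_profile (a - h)) (bump_profile (1 + e)) X g + (2 * h ^+ 2 * bump_mass (1 + e))%:E)%E.
Proof.
move=> a0 h0 HX Gg near close; have Hg : H (act g X) by exact: act_halfplane.
pose c := 1 + e; pose T b z := bump_profile b (cdist X z) * bump_profile c (cdist (act g X) z).
have T0 b z : (0 <= (T b z)%:E)%E by rewrite lee_fin mulr_ge0// sqr_ge0.
have p0 b z : (0 <= (bump_profile b (cdist (act g X) z))%:E)%E by rewrite lee_fin sqr_ge0.
have mp b Y : measurable_fun H (fun z => (bump_profile b (cdist Y z))%:E).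
  by apply: measurable_funTS; exact: measurable_radial_id (profile_bump b).
have mT b : measurable_fun H (fun z => (T b z)%:E).
  by rewrite /T; under eq_fun do rewrite EFinM; exact: emeasurable_funM.
have k0 : 0 <= 2 * h ^+ 2 by rewrite mulr_ge0// sqr_ge0.
have split2 b b' : (overlap (bump_profile b) (bump_profile c) X g + overlap (bump_profile b') (bump_profile c) X g =
   \int[hmeas]_(z in H) ((T b z)%:E + (T b' z)%:E))%E.
  exact: (esym (ge0_integralD hmeas mH (fun z _ => T0 b z) (mT b) (fun z _ => T0 b' z) (mT b'))).
rewrite -[1 + e]/c (EFinM (2 * h ^+ 2)) -(integral_bump_profile c Hg).
rewrite (split2 a) (split2 (a - h) (a - h)) -ge0_integralZl//; last exact: mp.
have mk : measurable_fun H (fun z => (2 * h ^+ 2)%:E * (bump_profile c (cdist (act g X) z))%:E)%E.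
  exact: emeasurable_funM.
have mTT : measurable_fun H (fun z => (T (a - h) z)%:E + (T (a - h) z)%:E)%E.
  exact: emeasurable_funD.
rewrite -(ge0_integralD hmeas mH _ mTT _ mk); first last.
- by move=> z _; rewrite mule_ge0.
- by move=> z _; rewrite adde_ge0.
apply: eq_integral => z /[!inE] Hz; 
rewrite -[LHS]/((T a z + T (a - 2 * h) z)%:E) -[RHS]/((T (a - h) z + T (a - h) z
  + 2 * h ^+ 2 * bump_profile c (cdist (act g X) z))%:E); congr _%:E; rewrite /T.
have [zc|zc] := leP c (cdist (act g X) z); first by rewrite (bump_profile_out zc) !mulr0 !addr0.
have le : cdist X z <= a - 2 * h.
  have near1 := near X (act g X) z HX Hg Hz (ltW zc).
  have M0 : 0 <= M a h by rewrite /M addr_ge0// divr_ge0// ltW.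
  apply: le_trans near1 _; apply: le_trans (ler_wpM2l M0 close) _.
  have ha : 0 <= h * (3 * h) / a by rewrite divr_ge0 ?mulr_ge0// ltW.
  rewrite (_ : M a h * (a - 3 * h) = a - 2 * h - h * (3 * h) / a); first by lra.
  by rewrite /M; field; rewrite gt_eqF.
by rewrite -[LHS]mulrDl (bump_profile_diff2 (ltW h0) le); ring.
Qed.

(** The number of elements of the deck group moving [X] by at most [a], for the
    hyperbolic cosine of the distance. *)
Definition deck_count X (a : R) : \bar R :=
  (\esum_(g in deck G `&` [set g | (cdist X (act g X) <= a)%R]) 1)%E.

(** A translate in this window would have a small ball meeting the shell where
    the second difference is neither constant nor zero. *)
Definition gap (a h : R) X : Prop := forall g, deck G g ->
  cdist X (act g X) <= a - 3 * h \/ a + h <= cdist X (act g X).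

(** The second difference in the radius of the first kernel turns the sum of
    overlaps into a count of translates. *)
Lemma overlap_diff2 (a h e : R) X : 0 < a -> 0 < h -> H X -> gap a h X ->
  near_ratio (M a h) e ->
  0 <= bump_mass (1 + e) ->
  let I b := (\esum_(g in deck G) overlap (bump_profile b) (bump_profile (1 + e)) X g)%E in
  (I a + I (a - 2 * h)%R = I (a - h)%R + I (a - h)%R + (2 * h ^+ 2 * bump_mass (1 + e))%R%:E * deck_count X a)%E.
Proof.
move=> a0 h0 HX gaps near mass0 I.
have ov0 b g : (0 <= overlap (bump_profile b) (bump_profile (1 + e)) X g)%E.
  exact: (overlap_ge0 _ _ (profile_bump b) (profile_bump (1 + e))).
have k0 : 0 <= 2 * h ^+ 2 * bump_mass (1 + e) by rewrite mulr_ge0// mulr_ge0// sqr_ge0.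
rewrite /deck_count -esum_mull// esum_mkcondr /I -!esumD//; last 2 first.
- by move=> g _; rewrite adde_ge0.
- by move=> g _; case: ifP => // _; rewrite mule_ge0// lee_fin.
apply: eq_esum => g Gg; have [close|far] := gaps g Gg.
  rewrite (overlap_near a0 h0 HX Gg near close); congr (_ + _)%E.
  by rewrite mem_set ?mule1//=; lra.
have ah : ~ cdist X (act g X) <= a by lra.
rewrite memNset// adde0.
rewrite !(overlap_far a0 h0 _ HX Gg near far) ?adde0//; lra.
Qed.

Lemma deck_count_fin X a : H X -> deck_count X a \is a fin_num.
Proof.
move=> /halfplane_val[X' <-]; rewrite ge0_fin_numE; last by apply: esum_ge0.
rewrite /deck_count; apply: esum_finite_lty => [|g _]; last by rewrite lee_fin ler01 ltry.
rewrite (_ : _ `&` _ = [set g | deck G g /\ cdist (val X') (val (g X')) <= a]).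
  exact: deck_locally_finite.
by apply/seteqP; split => g [Gg]; rewrite /= act_val.
Qed.

(** The radius of the second kernel is chosen after [a] and [h]; its mass is
    positive, so that the counts can be read off. *)
Lemma deck_count_eq (a h : R) X Y : 3 * h < a -> 0 < h -> H X -> H Y -> gap a h X -> gap a h Y ->
  (forall c c', (\esum_(g in deck G) overlap (bump_profile c) (bump_profile c') X g =
                 \esum_(g in deck G) overlap (bump_profile c) (bump_profile c') Y g)%E) ->
  deck_count X a = deck_count Y a.
Proof.
move=> ha h0 HX HY gX gY eqI; have a0 : 0 < a by lra.
have M1 : 1 < M a h by rewrite /M ltrDl divr_gt0.
have [e0 e0_gt0 near0] := @cdist_near_mul R (M a h) M1.
pose e := Num.min e0 1.
have e1 : 0 < e by rewrite lt_min e0_gt0 ltr01.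
have e2 : e <= 1 by rewrite ge_min lexx orbT.
have near : near_ratio (M a h) e.
  by move=> p q w p0 q0 w0 qw; apply: near0 => //; apply: le_trans qw _; rewrite lerD2l ge_min lexx.
have mass_gt0 : 0 < bump_mass (1 + e).
  have c1 : 1 < 1 + e by lra.
  have c2 : 1 + e <= 2 by lra.
  have /andP[m1 _] := mass_bounds c1 c2; apply: lt_le_trans m1.
  by rewrite divr_gt0// exprn_gt0//; lra.
have := overlap_diff2 a0 h0 HX gX near (ltW mass_gt0).
have := overlap_diff2 a0 h0 HY gY near (ltW mass_gt0) => /= EY EX.
rewrite (eqI a (1 + e)) (eqI (a - 2 * h) (1 + e)) (eqI (a - h) (1 + e)) EY in EX; move: EX.
have fI b : (\esum_(g in deck G) overlap (bump_profile b) (bump_profile (1 + e)) Y g)%E \is a fin_num.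
  rewrite ge0_fin_numE; first exact: (overlap_lty G (profile_bump b) (profile_bump (1 + e)) HY).
  by apply: esum_ge0 => g _; exact: (overlap_ge0 _ _ (profile_bump b) (profile_bump (1 + e))).
have k0 : 2 * h ^+ 2 * bump_mass (1 + e) != 0.
  by rewrite gt_eqF// mulr_gt0// mulr_gt0// exprn_gt0.
rewrite -(fineK (deck_count_fin a HX)) -(fineK (deck_count_fin a HY)) -(fineK (fI (a - h))).
by rewrite -!EFinM -!EFinD => -[/addrI/(mulfI k0) ->].
Qed.

Lemma finite_gap (T : choiceType) (A : set T) (f : T -> R) (t : R) : finite_set A ->
  exists2 d, 0 < d & forall i, A i -> f i = t \/ d <= `|f i - t|.
Proof.
move=> Afin; exists (\big[Num.min/1]_(i <- fset_set A | f i != t) `|f i - t|).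
  by elim/big_ind : _ => // [u v u0 v0|i it]; rewrite ?lt_min ?u0// normr_gt0 subr_eq0.
move=> i Ai; have [|it] := eqVneq (f i) t; [by left|right].
by apply: ge_bigmin_seq => //; rewrite in_fset_set// inE.
Qed.

Definition deck_level X (t : R) : set (hyp R -> hyp R) :=
  [set g | deck G g /\ cdist X (act g X) = t].

Lemma esum_card (T : choiceType) (A : set T) : finite_set A ->
  (\esum_(i in A) 1 = (#|` fset_set A|%fset%:R)%:E :> \bar R)%E.
Proof.
move=> Afin; rewrite esum_fset// fsbig_finite//= sumEFin big_const_seq count_predT.
by rewrite iter_addr_0.
Qed.

Lemma deck_level_finite X t : H X -> finite_set (deck_level X t).
Proof.
move=> /halfplane_val[X' <-]; apply: sub_finite_set (deck_locally_finite G X' X' t).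
by move=> g [Gg]; rewrite act_val => <-; split.
Qed.

Lemma deck_gap X (t : R) : H X -> exists2 d, 0 < d & forall g, deck G g ->
  cdist X (act g X) = t \/ d <= `|cdist X (act g X) - t|.
Proof.
move=> /halfplane_val[X' XX'].
have [d d0 dP] := finite_gap (fun g => cdist X (act g X)) t (deck_locally_finite G X' X' (t + 1)).
exists (Num.min d 1); first by rewrite lt_min d0 ltr01.
move=> g Gg; have [gt|gt] := leP (cdist X (act g X)) (t + 1).
  have [||h] := dP g; [by split => //; rewrite -[val (g X')]act_val XX'|by left|].
  by right; rewrite ge_min h.
right; rewrite ge_min; apply/orP; right; apply: le_trans (ler_norm _); lra.
Qed.

(** The counts just above and just below [t] differ by the number of elements
    of the level; local finiteness provides windows that serve for [X] and for
    [Y]. *)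
Lemma deck_level_card X Y (t : R) : H X -> H Y -> 0 < t ->
  (forall c c', (\esum_(g in deck G) overlap (bump_profile c) (bump_profile c') X g =
                 \esum_(g in deck G) overlap (bump_profile c) (bump_profile c') Y g)%E) ->
  #|` fset_set (deck_level X t)|%fset = #|` fset_set (deck_level Y t)|%fset.
Proof.
move=> HX HY t0 eqI.
have [d1 d10 gX] := deck_gap t HX; have [d2 d20 gY] := deck_gap t HY.
pose d := Num.min (t / 2) (Num.min d1 d2); pose h := d / 5.
have d0 : 0 < d by rewrite !lt_min d10 d20 divr_gt0.
have dt : d <= t / 2 by rewrite ge_min lexx.
have dd1 : d <= d1 by rewrite !ge_min lexx orbT.
have dd2 : d <= d2 by rewrite !ge_min lexx !orbT.
have h0 : 0 < h by rewrite divr_gt0.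
have dh : d = 5 * h by rewrite /h; field.
have far s d' : d <= d' -> (s = t \/ d' <= `|s - t|) -> [\/ s = t, s <= t - 5 * h | t + 5 * h <= s].
  move=> dd' [st|]; first exact: Or31.
  rewrite ler_normr => /orP[] h1; [apply: Or33|apply: Or32]; lra.
(* [h] is a fifth of a distance to [t] free of other values: the windows
   [t + h/2, t + 9h/2] and [t - 9h/2, t - h/2] contain none. *)
have gap1 Z d' : d <= d' -> (forall g, deck G g -> cdist Z (act g Z) = t \/ d' <= `|cdist Z (act g Z) - t|) ->
    gap (t + 7 / 2 * h) h Z /\ gap (t - 3 / 2 * h) h Z.
  move=> dd' gZ; split=> g Gg; have [] := far _ _ dd' (gZ g Gg) => h1;
    solve [left; lra|right; lra].
have [gX1 gX2] := gap1 X d1 dd1 gX; have [gY1 gY2] := gap1 Y d2 dd2 gY.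
have c1 : deck_count X (t + 7 / 2 * h) = deck_count Y (t + 7 / 2 * h).
  by apply: (deck_count_eq (h := h)) => //; lra.
have c2 : deck_count X (t - 3 / 2 * h) = deck_count Y (t - 3 / 2 * h).
  by apply: (deck_count_eq (h := h)) => //; lra.
have split Z d' : H Z -> d <= d' ->
    (forall g, deck G g -> cdist Z (act g Z) = t \/ d' <= `|cdist Z (act g Z) - t|) ->
    (deck_count Z (t + 7 / 2 * h) = deck_count Z (t - 3 / 2 * h) +
      (#|` fset_set (deck_level Z t)|%fset%:R)%:E)%E.
  move=> HZ dd' gZ; rewrite -esum_card; last exact: deck_level_finite.
  rewrite /deck_count (@esumID _ _ [set g | cdist Z (act g Z) <= t - 3 / 2 * h])//.
  congr (_ + _)%E; congr esum; apply/seteqP; split=> g /=.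
  - by move=> [[]].
  - by move=> [Gg gt]; split => //; split => //; lra.
  - move=> [[Gg g1] g2]; split => //; have [//|lo|hi] := far _ _ dd' (gZ g Gg); lra.
  - by move=> [Gg gt]; split; [split => //|]; lra.
move: (split X d1 HX dd1 gX) (split Y d2 HY dd2 gY); rewrite c1 c2 => -> /eqP.
rewrite -(fineK (deck_count_fin (t - 3 / 2 * h) HY)) -!EFinD eqe.
by move=> /eqP/addrI/eqP; rewrite eqr_nat => /eqP.
Qed.

Lemma hdistzz (z : hyp R) : hdist z z = 0.
Proof. by rewrite hdist_cdist cdistzz /arcosh expr1n subrr sqrtr0 addr0 ln1. Qed.

(** Lengths and their hyperbolic cosines have the same level sets. The hyperbolic
    cosine of [r] is taken from a loop [g0] of length [r], wherever it is
    based. *)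
Lemma loops_deck_level x y (r : R) g0 : 0 < r ->
  hdist (repr y) (g0 (repr y)) = r ->
  loops x r = deck_level (lift_point x) (cdist (lift_point y) (act g0 (lift_point y))).
Proof.
move=> r0 rE; rewrite -rE in r0 *; apply/seteqP; split => g.
  move=> [[Gg _] /eqP]; rewrite eq_hdist => /eqP E; split => //.
  by rewrite /lift_point !act_val.
move=> [Gg]; rewrite /lift_point !act_val => /eqP; rewrite -eq_hdist => /eqP E.
by split => //; split => // gid; move: r0; rewrite -E gid hdistzz ltxx.
Qed.

End Counting.

Lemma nonemptyN (T : Type) (A : set T) : ~ (A !=set0) -> A = set0.
Proof. by move=> A0; apply/seteqP; split => // i Ai; apply: A0; exists i. Qed.

Theorem lemma4p2 (R : realType) (G : deck_group R)
    (M_compact : compact [set: surface G])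
    (e : nat -> surface G -> R[i]) (lambda : nat -> R)
    (lambda_ge0 : forall j, 0 <= lambda j)
    (e_basis : orthonormal_basis e)
    (e_eigen : forall j, laplace_eigenfunction (e j) (lambda j))
    (x y : surface G)
    (eqN : forall l, weyl_counting e lambda x l = weyl_counting e lambda y l) :
  (forall r : R, 0 < r -> multiplicity x r = multiplicity y r) /\
  looping_times x = looping_times y.
Proof.
have eqI := overlap_eq lambda_ge0 e_basis e_eigen eqN.
have mult r : 0 < r -> multiplicity x r = multiplicity y r.
  move=> r0; have level (q : surface G) g0 : deck G g0 -> hdist (repr q) (g0 (repr q)) = r ->
      multiplicity x r = multiplicity y r.
    move=> Gg0 gr; rewrite /multiplicity !(loops_deck_level _ r0 gr).
    apply: deck_level_card => //; [exact: lift_halfplane|exact: lift_halfplane|].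
    apply: lt_le_trans ltr01 _; apply: cdist_ge1; first exact: lift_halfplane.
    exact/act_halfplane/lift_halfplane.
  have [[g [[Gg _] gr]]|nx] := pselect (loops x r !=set0); first exact: level Gg gr.
  have [[g [[Gg _] gr]]|ny] := pselect (loops y r !=set0); first exact: level Gg gr.
  by rewrite /multiplicity (nonemptyN nx) (nonemptyN ny).
split; first exact: mult.
(* A looping time is positive because the group acts freely, and it is a radius
   of nonzero multiplicity because the set of loops is finite. *)
have looping (q : surface G) r : looping_times q r <-> 0 < r /\ multiplicity q r <> 0%N.
  split=> [[g [Gg gid] <-]|[r0 m]].
    have r0 : 0 < hdist (repr q) (g (repr q)).
      rewrite -(hdistzz (repr q)) ltNge le_hdist cdistzz; apply/negP => le1; apply: gid => /=.
      apply: (deck_free Gg (z := repr q)); apply/val_inj/esym/cdist_eq1; rewrite ?hyp_gt0//.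
      by apply/le_anti/andP; split; rewrite ?le1 ?cdist_ge1 ?hyp_gt0.
    split => // /eqP; rewrite /multiplicity cardfs_eq0 (loops_deck_level _ r0 erefl) => /eqP E.
    have : g \in fset_set (deck_level G (lift_point q) (cdist (lift_point q) (act g (lift_point q)))).
      by rewrite in_fset_set ?inE//; exact: deck_level_finite (lift_halfplane q).
    by rewrite E inE.
  have [[g [Gg gr]]|no] := pselect (loops q r !=set0); first by exists g.
  by case: m; rewrite /multiplicity (nonemptyN no) fset_set0 cardfs0.
by apply/seteqP; split => r /looping[r0 m]; apply/looping; split => //; [rewrite -mult|rewrite mult].
Qed.
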